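(* Let $f\in H^\infty$ have no zeros in $\mathbb{D}$ and satisfy $\|f\|_{H^\infty}\le1$, and let $\nu=\nu_f$ be its associated Herglotz–Nevanlinna measure. Then $1/f\in\mathcal{B}$ if and only if there exists a constant $C=C(f)>0$ such that for any pair of contiguous arcs $I,I'\subset\partial\mathbb{D}$ of the same length, $$\left|\frac{\nu(I)}{|I|}-\frac{\nu(I')}{|I'|}\right|\le C\exp\left(-\frac{\nu(I)}{|I|}\right).$$
   Context: If $f\in H^\infty$ has no zeros in $\mathbb{D}$, write $f=FS_\mu$ with $F$ outer and $S_\mu$ singular inner with singular measure $\mu$; the Herglotz–Nevanlinna measure is $d\nu_f=-\log|f(\zeta)|\,dm(\zeta)+d\mu(\zeta)$, $m$ normalized Lebesgue measure. $|I|$ is normalized arc length; contiguous arcs have disjoint interiors and a common endpoint. $\mathcal{B}$ is the Bloch space of analytic $g$ on $\mathbb{D}$ with $|g(0)|+\sup_z(1-|z|)|g'(z)|<\infty$. *)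

(* Defs.v *)
From Stdlib Require Import Reals.
From Coquelicot Require Import Coquelicot.
From mathcomp Require Import all_boot all_order all_algebra.
From mathcomp Require Import all_classical all_reals.
From mathcomp Require Import all_analysis.
From mathcomp Require Import Rstruct Rstruct_topology.

Set Implicit Arguments.
Unset Strict Implicit.
Unset Printing Implicit Defensive.

Local Open Scope classical_set_scope.
Local Open Scope R_scope.

(* [0,1), parametrizing the unit circle. *)
Definition I01 : set R := [set t : R | 0 <= t /\ t < 1].

Definition in_disc (z : C) : Prop := (Cmod z < 1).

Definition zeta (t : R) : C := (cos (2 * PI * t), sin (2 * PI * t)).

(* Poisson kernel P(z, e^{2 pi i t}) = (1 - |z|^2) / |e^{2 pi i t} - z|^2
   (normalized so that its integral against dt over [0,1) is 1). *)
Definition poisson (z : C) (t : R) : R :=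
  ((1 - Cmod z ^ 2) / (Cmod (Cminus (zeta t) z) ^ 2)).

Definition holomorphic_disc (g : C -> C) : Prop :=
  forall z : C, in_disc z -> Coquelicot.Derive.ex_derive (K := C_AbsRing) (V := C_NormedModule) g z.

Definition bloch (g : C -> C) : Prop :=
  exists g' : C -> C,
    (forall z : C, in_disc z ->
       Coquelicot.Derive.is_derive (K := C_AbsRing) (V := C_NormedModule) g z (g' z)) /\
    exists M : R, forall z : C, in_disc z -> ((1 - Cmod z) * Cmod (g' z) <= M).

(* Measures on the unit circle are represented, via t |-> zeta t, as Borel
   measures on R carried by [0,1).  [nu] is the Herglotz-Nevanlinna measure of
   f: the finite positive measure on the circle whose Poisson integral is the
   positive harmonic function -log|f|, i.e. -log|f| = P[-log|f*| dm + d mu]. *)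
Definition circ_measure : Type := measure (measurableTypeR R) R.

Definition HN_measure (f : C -> C) (nu : circ_measure) : Prop :=
  nu (~` I01) = 0%E /\
  (nu I01 < +oo)%E /\
  forall z : C, in_disc z ->
    ((- ln (Cmod (f z))))%:E = (\int[nu]_(t in I01) (poisson z t)%:E)%E.

(* The arc {zeta t : a <= t < a + l} (0 < l <= 1), as a subset of [0,1). *)
Definition arc (a l : R) : set R :=
  [set t | 0 <= t /\ t < 1 /\ exists k : Z, (a <= t + IZR k /\ t + IZR k < a + l)].

(* nu(I) for the arc I = arc a l (a real number, nu being finite). *)
Definition arc_measure (nu : circ_measure) (a l : R) : R :=
  fine (nu (arc a l)).

Definition contiguous_same_length (a l a' l' : R) : Prop :=
  l = l' /\ (0 < l <= 1 / 2) /\ (a' = a + l \/ a = a' + l).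

(* Main.v *)
(** Let [u = - ln |f|], the Poisson integral of [nu]. With the Herglotz integral [h] of [nu],
    [f' = - f h'], so [1/f] is a Bloch function iff [(1 - |z|) |h' z| <= M e^(- u z)].

    Both directions transport the quantity [e^u] (resp. [e^a], [a] the average of [nu] over an
    arc) through dyadic scales.  By hypothesis it changes by at most an additive constant from
    one scale to the next, so with a suitable shift [c] the weight [1 / (e^u + c)], comparable to
    [e^(-u)], changes at most by the factor [3/2].  As [3/2 < 2], all sums over scales are
    geometric.

    Arcs to Bloch: bisecting arcs, the distribution function of [nu] deviates from a linear
    function, at distance [2^n L] from the centre of an arc of length [L], by at most
    [C 3^n L e^(-a)].  The variation of the Poisson kernel at height [L] over that dyadic range is
    [O(4^(-n) / L)], so summation by parts bounds [|u - a|]; the same argument with differences of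
    Poisson kernels bounds the increments of [u], hence [h'].

    Bloch to arcs: the integral of [u] over an arc of the circle of radius [r] has the explicit
    representation [int (arctan kernel) d nu]; its derivative in [r] is a difference of values of
    the conjugate function [Im h], controlled by chaining radially from height [l].  Letting [r]
    tend to 1 (the Bloch condition excludes atoms) gives [|nu(I)/l - u(z_I)| <= C e^(- u(z_I))]. *)
From Pilot Require Import Defs.
From Stdlib Require Import Reals Lra Lia.
From Coquelicot Require Import Coquelicot.
From mathcomp Require Import all_classical all_reals.
From mathcomp Require Import ereal measure lebesgue_measure lebesgue_integral.
From mathcomp Require Import Rstruct Rstruct_topology.
From mathcomp Require all_boot all_order all_algebra all_analysis.
From mathcomp Require Import ssreflect ssrfun ssrbool.
From mathcomp Require ring.

Set Implicit Arguments.
Unset Strict Implicit.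
Unset Printing Implicit Defensive.

(** * The measure on arcs *)

Section MeasureInterface.
Import mathcomp.algebra_tactics.ring.
Import all_boot all_order all_algebra all_classical all_reals all_analysis.
Import mathcomp.analysis.measurable_realfun Rstruct Rstruct_topology.
Import Order.TTheory GRing.Theory Num.Theory numFieldNormedType.Exports.
Import Pilot.Defs.
Local Open Scope classical_set_scope.
Local Open Scope ring_scope.

Ltac stdops := rewrite -?RminusE -?RplusE -?RoppE -?RmultE.

(** Each hypothesis bounds a change of [a] or [u] by its exponential at the place where the change
    occurs, whereas the conclusion measures everything by the exponential at one fixed arc or point.
    Knowing only that the change per scale is bounded would cost a factor [e^C] at every scale, too
    much for geometric decay when [C] is large. Working with [e^a] cures this: the inequality
    [e^x >= 1 + x] shows that it drops by at most a constant [d], so that [e^a + c] keeps at least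
    the fraction [1 - d / c], as close to 1 as desired. Positivity of [nu] gives [a >= 0] and
    [u >= 0], so the shift costs only the factor [1 + c]. The measure may be singular, so it has no
    density to compare with [a]. Kernels are instead tested on cells of small mesh [h]; the
    Lipschitz constant of the kernel makes the discretization error vanish with [h], and an explicit
    primitive of the kernel supplies the main term by telescoping. The same primitive,
    [arg (1 - r e^(i phi))] up to sign, is the arctan kernel of the converse: at [r = 1] it becomes
    a sawtooth whose jump detects membership in an arc. *)

Lemma cosRE (x : R) : trigo.cos x = Rtrigo_def.cos x.
Proof.
rewrite /Rtrigo_def.cos; case: exist_cos => y; rewrite /cos_in /infinite_sum => Hy.
apply: (@cvg_unique R^o _ _ _ _ _ (@cvg_cos_coeff' R x)); first exact: norm_hausdorff.
rewrite /= -cvg_shiftS /=; apply/(@cvgrPdist_lt R R^o) => /= e /RltP /Hy [N HN].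
near=> n.
have nN : (n >= N)%coq_nat by apply/ssrnat.leP; near: n; exact: nbhs_infty_ge.
move: HN => /(_ _ nN) /[!RdistE] /RltP /=.
rewrite distrC sum_f_R0E; congr (`| _ - _ | < e).
apply: eq_bigr => k _; rewrite /cos_coeff' /cos_n RmultE RdivE !RpowE factE INRE.
by rewrite /Rsqr RmultE -expr2 -exprM multE mul2n mulrAC -exprnP.
Unshelve. all: by end_near. Qed.

(** One definition of the sine is [x] times a series in [x ^ 2], the other a series of odd powers;
    [x] is factored out of the partial sums before uniqueness of the limit applies. [zeta] is
    written with the second pair of functions, the analysis below uses the first. *)
Lemma sinRE (x : R) : trigo.sin x = Rtrigo_def.sin x.
Proof.
rewrite /Rtrigo_def.sin; case: exist_sin => y; rewrite /sin_in /infinite_sum => Hy.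
apply: (@cvg_unique R^o _ _ _ _ _ (@cvg_sin_coeff' R x)); first exact: norm_hausdorff.
rewrite (_ : series (sin_coeff' x) = (fun n => x * series (fun k => (-1) ^+ k / (k.*2.+1)`!%:R * (x ^+ 2) ^+ k) n)); last first.
  apply/funext => n; rewrite /series /= mulr_sumr; apply: eq_bigr => k _.
  by rewrite /sin_coeff' -exprM mul2n exprS -exprnP; ring.
rewrite /=; apply: (@cvgMr R).
rewrite -cvg_shiftS /=; apply/(@cvgrPdist_lt R R^o) => /= e /RltP /Hy [N HN].
near=> n.
have nN : (n >= N)%coq_nat by apply/ssrnat.leP; near: n; exact: nbhs_infty_ge.
move: HN => /(_ _ nN) /[!RdistE] /RltP /=.
rewrite distrC sum_f_R0E; congr (`| _ - _ | < e).
apply: eq_bigr => k _; rewrite /sin_n RmultE RdivE !RpowE factE INRE.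
by rewrite /Rsqr RmultE -expr2 plusE multE mul2n addn1.
Unshelve. all: by end_near. Qed.


Lemma continuity_continuous (k : R -> R) : continuity k -> continuous k.
Proof. by move=> kc x; apply/continuity_pt_cvg; exact: kc. Qed.

Lemma Un_cv_cvg (u : nat -> R) (l : R) : Un_cv u l <-> u @ \oo --> (l : R^o).
Proof.
split.
  move=> H; apply/(@cvgrPdist_lt R R^o) => /= e /RltP /H [N HN].
  near=> n.
  have nN : (n >= N)%coq_nat by apply/ssrnat.leP; near: n; exact: nbhs_infty_ge.
  by move: HN => /(_ _ nN) /[!RdistE] /RltP; rewrite distrC.
move=> /(@cvgrPdist_lt R R^o) H e /RltP /H [N _ HN].
exists N => n /ssrnat.leP nN; apply/RltP; rewrite RdistE distrC.
exact: HN.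
Unshelve. all: by end_near. Qed.

Lemma measurable_I01 : measurable (I01 : set (measurableTypeR R)).
Proof.
rewrite (_ : I01 = [set` Interval (BLeft (0:R)) (BLeft (1:R))]); first exact: measurable_itv.
apply/seteqP; split => t; rewrite /I01 /= in_itv /=.
  by move=> [/RleP -> /RltP ->].
by move=> /andP[/RleP ? /RltP ?].
Qed.

(** Splitting the integer shift by sign presents the arc as [I01] cut with two countable unions of
    half-open intervals. *)
Lemma measurable_arc a l : measurable (arc a l : set (measurableTypeR R)).
Proof.
have -> : arc a l = I01 `&` (\bigcup_(n : nat) [set` Interval (BLeft (a - n%:R)) (BLeft (a + l - n%:R))]
     `|` \bigcup_(n : nat) [set` Interval (BLeft (a + n%:R)) (BLeft (a + l + n%:R))]).
  apply/seteqP; split => t; rewrite /arc /I01 /=.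
    move=> [t0 [t1 [k [ka kl]]]]; split=> //.
    have [k0|k0] := Z.le_ge_cases 0 k.
      left; exists (Z.to_nat k) => //=; rewrite in_itv /= -INRE INR_IZR_INZ Znat.Z2Nat.id //.
      by apply/andP; split; [apply/RleP | apply/RltP]; stdops; Lra.lra.
    right; exists (Z.to_nat (- k)) => //=; rewrite in_itv /= -INRE INR_IZR_INZ Znat.Z2Nat.id; last by Lia.lia.
    by rewrite opp_IZR; apply/andP; split; [apply/RleP | apply/RltP]; stdops; Lra.lra.
  move=> [[t0 t1]] [[n _]|[n _]] /=; rewrite in_itv /= => /andP[/RleP A /RltP B]; split=> //; split=> //.
    exists (Z.of_nat n); rewrite -INR_IZR_INZ.
    by move: A B; rewrite -!INRE; stdops; Lra.lra.
  exists (Z.opp (Z.of_nat n)); rewrite opp_IZR -INR_IZR_INZ.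
  by move: A B; rewrite -!INRE; stdops; Lra.lra.
apply: measurableI; first exact: measurable_I01.
by apply: measurableU; apply: bigcup_measurable => n _; exact: measurable_itv.
Qed.


Lemma arc_sub_I01 a l : arc a l `<=` I01.
Proof. by move=> t [? [? _]]. Qed.

Lemma arc_full a : arc a 1 = I01.
Proof.
apply/seteqP; split; first exact: arc_sub_I01.
move=> t [t0 t1]; split=> //; split=> //.
(* [up y] exceeds [y] by an amount in []0, 1]], so this shift moves [t] into [[a, a + 1[]. *)
exists (Z.sub (Zpos xH) (up (Rminus t a))).
by have [A B] := archimed (Rminus t a); rewrite minus_IZR; Lra.lra.
Qed.

Lemma arc_split a l1 l2 : Rle 0 l1 -> Rle 0 l2 ->
  arc a (Rplus l1 l2) = arc a l1 `|` arc (Rplus a l1) l2.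
Proof.
move=> h1 h2; apply/seteqP; split => t.
  move=> [t0 [t1 [k [A B]]]].
  have [C|C] := Rlt_le_dec (t + IZR k)%coqR (Rplus a l1).
    by left; split=> //; split=> //; exists k.
  by right; split=> //; split=> //; exists k; Lra.lra.
move=> [|] [t0 [t1 [k [A B]]]]; split=> //; split=> //; exists k; Lra.lra.
Qed.

(** A common point would have integer shifts with [k < j < k + 1]; the second inequality comes from
    the total length being at most 1. *)
Lemma arc_disj a l1 l2 : Rle 0 l1 -> Rle 0 l2 -> Rle (Rplus l1 l2) 1 ->
  [disjoint arc a l1 & arc (Rplus a l1) l2].
Proof.
move=> h1 h2 h; apply/eqP/seteqP; split=> // t [[t0 [t1 [k [A B]]]] [_ [_ [j [C D]]]]].
have E : Z.lt k j by apply: lt_IZR; Lra.lra.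
have F : Z.lt j (Z.add k (Zpos xH)) by apply: lt_IZR; rewrite plus_IZR; Lra.lra.
Lia.lia.
Qed.

(** * Integrals of continuous functions over arcs for a finite measure *)

Section Finite.
Variable nu : circ_measure.
Hypothesis nu_fin : (nu I01 < +oo)%E.

Definition arcint (k : R -> R) (a l : R) : R := Rintegral nu (arc a l) k.
Definition cint (k : R -> R) : R := Rintegral nu I01 k.

Lemma sub_I01_fin (E : set (measurableTypeR R)) : measurable E -> E `<=` I01 -> (nu E < +oo)%E.
Proof.
move=> mE EI; apply: le_lt_trans nu_fin; apply: le_measure => //; rewrite inE //.
exact: measurable_I01.
Qed.

Lemma cont_bounded (k : R -> R) : continuity k ->
  exists B, forall t, I01 t -> Rle (Rabs (k t)) B.
Proof.
move=> kc.
have [|M [HM _]] := @continuity_ab_maj k 0%coqR 1%coqR (Rlt_le _ _ Rlt_0_1); first by move=> *; exact: kc.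
have [|m [Hm _]] := @continuity_ab_min k 0%coqR 1%coqR (Rlt_le _ _ Rlt_0_1); first by move=> *; exact: kc.
exists (Rmax (k M) (- k m)%coqR) => t [t0 t1].
have A := HM t (conj t0 (Rlt_le _ _ t1)).
have B := Hm t (conj t0 (Rlt_le _ _ t1)).
apply: Rabs_le; have := Rmax_l (k M) (- k m)%coqR; have := Rmax_r (k M) (- k m)%coqR; Lra.lra.
Qed.

Lemma integrable_cont (k : R -> R) (E : set (measurableTypeR R)) : continuity k -> measurable E ->
  E `<=` I01 -> nu.-integrable E (EFin \o k).
Proof.
move=> kc mE EI; apply: measurable_bounded_integrable => //; first exact: sub_I01_fin.
  by apply: (measurable_funS (E := setT)) => //; apply: continuous_measurable_fun; exact: continuity_continuous.
have [B HB] := cont_bounded kc.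
exists B; split; first exact: num_real.
move=> x Bx t Et /=; apply: le_trans (ltW Bx).
by have /RleP := HB t (EI _ Et); rewrite RabsE.
Qed.

Lemma arcint_add k a l1 l2 : continuity k -> Rle 0 l1 -> Rle 0 l2 -> Rle (Rplus l1 l2) 1 ->
  arcint k a (Rplus l1 l2) = Rplus (arcint k a l1) (arcint k (Rplus a l1) l2).
Proof.
move=> kc h1 h2 h; rewrite /arcint arc_split // Rintegral_setU //.
- exact: measurable_arc.
- exact: measurable_arc.
- rewrite -arc_split //; apply: integrable_cont => //; first exact: measurable_arc.
  exact: arc_sub_I01.
- exact: arc_disj.
Qed.

Lemma continuity_cst (c : R) : continuity (fun=> c).
Proof. exact: continuity_const. Qed.

Lemma arcint_cst c a l : arcint (fun=> c) a l = Rmult c (arc_measure nu a l).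
Proof. by rewrite /arcint Rintegral_cst //; exact: measurable_arc. Qed.

Lemma arc_measure_ge0 a l : Rle 0 (arc_measure nu a l).
Proof. by apply/RleP; exact: fine_ge0. Qed.

Lemma fine_measure_ge0 (E : set (measurableTypeR R)) : Rle 0 (fine (nu E)).
Proof. by apply/RleP; exact: fine_ge0. Qed.

Lemma arcint_full k a : arcint k a (IZR 1) = cint k.
Proof. by rewrite /arcint arc_full. Qed.

Lemma arcint_bound k c e a l : continuity k ->
  (forall t, arc a l t -> Rle (Rabs (Rminus (k t) c)) e) ->
  Rle (Rabs (Rminus (arcint k a l) (Rmult c (arc_measure nu a l))))
      (Rmult e (arc_measure nu a l)).
Proof.
move=> kc H; rewrite -!arcint_cst.
have mA := @measurable_arc a l.
have ic : nu.-integrable (arc a l) (EFin \o (fun=> c)).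
  by apply: integrable_cont => //; [exact: continuity_cst | exact: arc_sub_I01].
have ie : nu.-integrable (arc a l) (EFin \o (fun=> e)).
  by apply: integrable_cont => //; [exact: continuity_cst | exact: arc_sub_I01].
have ik : nu.-integrable (arc a l) (EFin \o k).
  by apply: integrable_cont => //; exact: arc_sub_I01.
have kcc : continuity (fun t => Rminus (k t) c) by apply: continuity_minus => //; exact: continuity_cst.
have ikc : nu.-integrable (arc a l) (EFin \o (fun t => k t - c)).
  by apply: integrable_cont => //; exact: arc_sub_I01.
rewrite /arcint RabsE RminusE -RintegralB //; apply/RleP.
apply: le_trans (le_normr_Rintegral _ ikc) _ => //.
apply: le_Rintegral => //.
  apply: (@integrable_cont (fun t => Rabs (k t - c))) => //; last exact: arc_sub_I01.
  by apply: (@continuity_comp (fun t => Rminus (k t) c) Rabs) => //; exact: Rcontinuity_abs.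
by move=> t At; apply/RleP; rewrite -RabsE; exact: H.
Qed.


Lemma cint_add k1 k2 : continuity k1 -> continuity k2 ->
  cint (fun t => Rplus (k1 t) (k2 t)) = Rplus (cint k1) (cint k2).
Proof.
move=> c1 c2; rewrite /cint RintegralD //; first exact: measurable_I01.
- by apply: integrable_cont => //; exact: measurable_I01.
- by apply: integrable_cont => //; exact: measurable_I01.
Qed.

Lemma cint_scal c k : continuity k -> cint (fun t => Rmult c (k t)) = Rmult c (cint k).
Proof.
move=> kc; rewrite /cint RintegralZl //; first exact: measurable_I01.
by apply: integrable_cont => //; exact: measurable_I01.
Qed.

Lemma cint_ext k1 k2 : (forall t, k1 t = k2 t) -> cint k1 = cint k2.
Proof. by move=> /funext ->. Qed.

Lemma cint_bound k B : continuity k -> (forall t, Rle (Rabs (k t)) B) ->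
  Rle (Rabs (cint k)) (Rmult B (arc_measure nu 0%coqR (IZR 1))).
Proof.
move=> kc H; have := @arcint_bound k 0%coqR B 0%coqR (IZR 1) kc; rewrite arcint_full.
rewrite Rmult_0_l Rminus_0_r; apply => t _; rewrite Rminus_0_r; exact: H.
Qed.

(** Splitting off the point [p] leaves a nonnegative remainder. This bounds the Poisson integral
    from below near a possible atom, and also yields its positivity. *)
Lemma cint_atom k p : continuity k -> I01 p -> (forall t, Rle 0 (k t)) ->
  Rle (Rmult (k p) (fine (nu [set p]))) (cint k).
Proof.
move=> kc Ip k0.
have mp : measurable ([set p] : set (measurableTypeR R)) by exact: measurable_set1.
have mD : measurable (I01 `\ p : set (measurableTypeR R)) by apply: measurableD => //; exact: measurable_I01.
have E : I01 = [set p] `|` (I01 `\ p) by rewrite setDUK // => x ->.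
rewrite /cint E Rintegral_setU //.
- rewrite [X in Rle _ (X + _)](_ : _ = Rmult (k p) (fine (nu [set p]))).
    by rewrite RmultE -[X in Rle X _]addr0; apply/RleP; rewrite lerD2l; apply: Rintegral_ge0 => t _; exact/RleP.
  rewrite RmultE -Rintegral_cst //; apply: eq_Rintegral => t.
  by rewrite inE /= => ->.
- rewrite -E; apply: integrable_cont => //; exact: measurable_I01.
- by apply/eqP/seteqP; split=> // t [/= -> [_]]; apply.
Qed.

Lemma arc_measure_full a : arc_measure nu a (IZR 1) = fine (nu I01).
Proof. by rewrite /arc_measure arc_full. Qed.

(** Dominated convergence towards a step function, [c1] on the arc and [c2] off it; constants
    dominate because the measure is finite. In its use [p1] and [p2] represent the endpoints of the
    arc, where the kernels have a different limit, and which are negligible because they carry no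
    mass. *)
Lemma cint_dct (kn : nat -> R -> R) B c1 c2 a l p1 p2 :
  (forall n, continuity (kn n)) -> (forall n t, Rle (Rabs (kn n t)) B) ->
  I01 p1 -> I01 p2 -> fine (nu [set p1]) = 0%coqR -> fine (nu [set p2]) = 0%coqR ->
  (forall t, I01 t -> t <> p1 -> t <> p2 -> arc a l t -> Un_cv (fun n => kn n t) c1) ->
  (forall t, I01 t -> t <> p1 -> t <> p2 -> ~ arc a l t -> Un_cv (fun n => kn n t) c2) ->
  Un_cv (fun n => cint (kn n))
    (Rplus (Rmult c1 (arc_measure nu a l)) (Rmult c2 (Rminus (arc_measure nu 0%coqR (IZR 1)) (arc_measure nu a l)))).
Proof.
move=> kc kB Ip1 Ip2 n1 n2 H1 H2.
have mA := @measurable_arc a l; have mI := measurable_I01.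
have mD : measurable (I01 `\` arc a l : set (measurableTypeR R)) by exact: measurableD.
pose f (t : measurableTypeR R) : R := if t \in arc a l then c1 else c2.
have mf : measurable_fun (I01 : set (measurableTypeR R)) (f : _ -> measurableTypeR R).
  have -> : f = (fun t => (c1 - c2) * \1_(arc a l) t + c2).
    apply/funext => t; rewrite /f indicE; case: (t \in arc a l).
      by rewrite mulr1 subrK.
    by rewrite mulr0 add0r.
  by apply: measurable_funD => //; apply: measurable_funM => //; exact: measurable_indic.
have E : I01 = arc a l `|` (I01 `\` arc a l) by rewrite setDUK //; exact: arc_sub_I01.
have nul p : I01 p -> fine (nu [set p]) = 0%coqR -> nu.-negligible [set p].
  move=> Ip np; exists [set p]; split=> //.
  have : nu [set p] \is a fin_num.
    by rewrite ge0_fin_numE //; apply: sub_I01_fin => // x ->.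
  by move=> /fineK <-; rewrite np.
have iB : nu.-integrable I01 (EFin \o (fun=> B)) by apply: integrable_cont => //; exact: continuity_cst.
have [||||i_f _] := @dominated_convergence _ _ _ nu I01 mI (fun n t => (kn n t)%:E) (EFin \o f) (EFin \o (fun=> B)) _ _ _ iB.
- move=> n; apply/measurable_EFinP.
  by apply: (measurable_funS (E := setT)) => //; apply: continuous_measurable_fun; exact: continuity_continuous.
- exact/measurable_EFinP.
- rewrite /prop_near1 /nbhs /= /almost_everywhere.
  apply: (@negligibleS _ _ _ nu ([set p1] `|` [set p2])); last by apply: negligibleU; exact: nul.
  move=> t /= /existsNP [It nt]; apply: contrapT => /not_orP [np1 np2]; apply: nt.
  suff H : kn ^~ t @ \oo --> (f t : R^o).
    by apply: (@cvg_EFin R nat \oo _ (fun n => (kn n t)%:E) (f t) _ H); exact: nearW.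
  rewrite /f; case: ifPn => [/set_mem At|/negP nA].
    by apply/Un_cv_cvg; exact: H1.
  by apply/Un_cv_cvg; apply: H2 => // At; apply: nA; exact: mem_set.
- by apply: aeW => t n It /=; rewrite lee_fin -RabsE; exact/RleP.
have -> : (\int[nu]_(x in I01) (EFin \o f) x = (Rintegral nu I01 f)%:E)%E.
  by rewrite /Rintegral fineK //; exact: integrable_fin_num.
move=> /fine_cvg cv; apply/Un_cv_cvg.
have i_f' : nu.-integrable (arc a l `|` (I01 `\` arc a l)) (EFin \o f) by rewrite -E.
have dj : [disjoint arc a l & (I01 `\` arc a l)].
  by apply/eqP/seteqP; split=> // t [At [_]]; apply.
have e1 : Rintegral nu (arc a l) f = c1 * fine (nu (arc a l)).
  rewrite -Rintegral_cst //; apply: eq_Rintegral => t /set_mem At.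
  by rewrite /f mem_set.
have e2 : Rintegral nu (I01 `\` arc a l) f = c2 * fine (nu (I01 `\` arc a l)).
  rewrite -Rintegral_cst //; apply: eq_Rintegral => t /set_mem [_ At].
  by rewrite /f memNset.
have e3 : fine (nu I01) = fine (nu (arc a l)) + fine (nu (I01 `\` arc a l)).
  rewrite [in LHS]E measureU //; last by apply/seteqP; split=> // t [At [_]]; apply.
  rewrite fineD //.
    by rewrite ge0_fin_numE //; apply: sub_I01_fin => //; exact: arc_sub_I01.
  by rewrite ge0_fin_numE //; apply: sub_I01_fin => // t [].
suff <- : Rintegral nu I01 f = Rplus (Rmult c1 (arc_measure nu a l))
  (Rmult c2 (Rminus (arc_measure nu 0%coqR (IZR 1)) (arc_measure nu a l))) by [].
have -> : Rintegral nu I01 f = Rintegral nu (arc a l `|` (I01 `\` arc a l)) f by rewrite -E.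
rewrite (Rintegral_setU mA mD i_f' dj) e1 e2 arc_measure_full e3 /arc_measure.
by rewrite RminusE (addrC (fine (nu (arc a l)))) addrK.
Qed.

End Finite.

Lemma HN_log (f : C -> C) (nu : circ_measure) : HN_measure f nu ->
  forall z, in_disc z -> Ropp (Rpower.ln (Cmod (f z))) = cint nu (poisson z).
Proof.
by move=> [_ [_ H]] z zD; rewrite RlnE /cint /Rintegral -H.
Qed.

Lemma zetaE t : zeta t = (Rtrigo_def.cos (Rmult (Rmult 2 PI) t), Rtrigo_def.sin (Rmult (Rmult 2 PI) t)).
Proof. by rewrite /zeta cosRE sinRE. Qed.

End MeasureInterface.

Local Open Scope R_scope.
Unset SsrRewrite.

(** * Averages of the measure over dyadic arcs *)

Lemma INR_pow2 k : INR (2 ^ k) = 2 ^ k.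
Proof. rewrite pow_INR; f_equal; simpl; ring. Qed.

Section DyadicAverages.
Variables (m : R -> R -> R) (C : R).
Hypothesis m_ge0 : forall x l, 0 <= m x l.
Hypothesis m_add : forall x l1 l2, 0 <= l1 -> 0 <= l2 -> l1 + l2 <= 1 ->
  m x (l1 + l2) = m x l1 + m (x + l1) l2.
Hypothesis C_gt0 : 0 < C.
Hypothesis m_fwd : forall x l, 0 < l <= 1 / 2 ->
  Rabs (m x l / l - m (x + l) l / l) <= C * exp (- (m x l / l)).
Hypothesis m_bwd : forall x l, 0 < l <= 1 / 2 ->
  Rabs (m (x + l) l / l - m x l / l) <= C * exp (- (m (x + l) l / l)).

Definition avg (x l : R) : R := m x l / l.
(* [e^-a] up to constants for [a >= 0]; the shift by [3 C / 2] makes the ratio between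
   consecutive dyadic scales at most [3/2 < 2], so that geometric series converge. *)
Definition weight (a : R) : R := / (exp a + 3 * C / 2).
Definition dev_const : R := C * (1 + 3 * C / 2).

Lemma avg_ge0 x l : 0 < l -> 0 <= avg x l.
Proof.
intros Hl; unfold avg; apply Rmult_le_pos; [apply m_ge0|].
left; now apply Rinv_0_lt_compat.
Qed.

Lemma m_avg x l : 0 < l -> m x l = l * avg x l.
Proof. intros Hl; unfold avg; field; lra. Qed.

Lemma weight_gt0 a : 0 < weight a.
Proof. apply Rinv_0_lt_compat; generalize (exp_pos a); lra. Qed.

Lemma dev_const_gt0 : 0 < dev_const.
Proof. unfold dev_const; nra. Qed.

(** Multiply [exp (b - a) >= 1 + (b - a)] by [exp a]: the relative bound [d * exp (- a)] becomes an
    additive loss [d]. *)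
Lemma exp_dev a b d : 0 <= d -> Rabs (b - a) <= d * exp (- a) -> exp a - d <= exp b.
Proof.
intros Hd H.
assert (E : exp b = exp a * exp (b - a)) by (rewrite <- exp_plus; f_equal; ring).
assert (F : exp a * exp (- a) = 1) by (rewrite <- exp_plus, Rplus_opp_r; apply exp_0).
generalize (exp_ineq1_le (b - a)) (exp_pos a); intros G P.
assert (b - a >= - (d * exp (- a))).
{ unfold Rabs in H; destruct Rcase_abs in H; lra. }
rewrite E; nra.
Qed.

(** With the shift [c = 3 C / 2], a loss [d <= (1 - q) c] leaves [exp b + c >= q (exp a + c)].
    Halving or doubling an arc has [d = C / 2] and [q = 2/3]; passing to the neighbouring arc has
    [d = C] and [q = 1/3]. *)
Lemma weight_ratio a b d q : 0 < q <= 1 -> 0 <= d <= (1 - q) * (3 * C / 2) ->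
  Rabs (b - a) <= d * exp (- a) -> weight b <= / q * weight a.
Proof.
intros Hq Hd H.
assert (E := exp_dev (proj1 Hd) H); assert (P := exp_pos a).
unfold weight; rewrite <- Rinv_mult; apply Rinv_le_contravar; nra.
Qed.

(** Since [exp a >= 1], the shifted exponential is at most [(1 + 3 C / 2) exp a]; this is the origin
    of [dev_const]. *)
Lemma exp_le_weight a : 0 <= a -> C * exp (- a) <= dev_const * weight a.
Proof.
intros Ha.
assert (E : 1 <= exp a) by (rewrite <- exp_0; destruct Ha as [Ha|<-]; [left; now apply exp_increasing|lra]).
unfold dev_const; rewrite Rmult_assoc; apply Rmult_le_compat_l; [lra|].
rewrite exp_Ropp; unfold weight.
apply Rmult_le_reg_l with (exp a); [lra|].
rewrite Rinv_r by lra.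
apply Rmult_le_reg_r with (exp a + 3 * C / 2); [lra|].
rewrite <- Rmult_assoc, (Rmult_assoc _ (/ _)), Rinv_l by lra.
nra.
Qed.

Lemma avg_double x h : 0 < h <= 1 / 2 -> avg x (2 * h) = (avg x h + avg (x + h) h) / 2.
Proof.
intros Hh; unfold avg.
replace (2 * h) with (h + h) by ring; rewrite m_add by lra; field; lra.
Qed.

(** The hypothesis is applied from the half with the larger average, which is at least the average
    of the whole arc; each half differs from that average by half the difference of the two. *)
Lemma avg_half x h : 0 < h <= 1 / 2 ->
  Rabs (avg x h - avg x (2 * h)) <= C / 2 * exp (- avg x (2 * h)) /\
  Rabs (avg (x + h) h - avg x (2 * h)) <= C / 2 * exp (- avg x (2 * h)).
Proof.
intros Hh; rewrite avg_double by exact Hh.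
generalize (m_fwd x Hh) (m_bwd x Hh); fold (avg x h); fold (avg (x + h) h).
generalize (avg x h) (avg (x + h) h); intros a b H1 H2.
assert (K : Rabs (a - b) <= C * exp (- ((a + b) / 2))).
{ destruct (Rle_dec a b) as [L|L].
  - rewrite Rabs_minus_sym; eapply Rle_trans; [exact H2|].
    apply Rmult_le_compat_l; [lra|].
    destruct (Req_dec a b) as [->|N]; [right; f_equal; field|].
    left; apply exp_increasing; lra.
  - eapply Rle_trans; [exact H1|].
    apply Rmult_le_compat_l; [lra|]; left; apply exp_increasing; lra. }
replace (a - (a + b) / 2) with ((a - b) * / 2) by field.
replace (b - (a + b) / 2) with ((b - a) * / 2) by field.
rewrite !Rabs_mult, (Rabs_minus_sym b a), (Rabs_right (/ 2)) by lra.
lra.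
Qed.

Lemma avg_up x h : 0 < h <= 1 / 2 ->
  Rabs (avg x (2 * h) - avg x h) <= C / 2 * exp (- avg x h).
Proof.
intros Hh; rewrite avg_double by exact Hh.
generalize (m_fwd x Hh); fold (avg x h); fold (avg (x + h) h).
generalize (avg x h) (avg (x + h) h); intros a b H1.
replace ((a + b) / 2 - a) with ((b - a) * / 2) by field.
rewrite Rabs_mult, Rabs_minus_sym, (Rabs_right (/ 2)) by lra; lra.
Qed.

Lemma m_0 x : m x 0 = 0.
Proof.
generalize (@m_add x 0 0 (Rle_refl 0) (Rle_refl 0)); rewrite !Rplus_0_r; intros H; lra.
Qed.

Lemma half_le1 : 1 / 2 <= 1.
Proof. lra. Qed.

(** Bisection. In units of [L / 2] times [dev_const * weight], the inductive error on one half is at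
    most [3/2] and the change of average adds at most [1/2]. The sum 2 is exactly one unit of [L],
    so the constant is the same at every depth [k]. *)
Lemma avg_grid k : forall x L j, 0 < L <= 1 -> (j <= 2 ^ k)%nat ->
  Rabs (m x (INR j / 2 ^ k * L) - INR j / 2 ^ k * m x L) <= L * (dev_const * weight (avg x L)).
Proof.
induction k as [|k IH]; intros x L j HL Hj.
- assert (P := weight_gt0 (avg x L)); assert (Q := dev_const_gt0).
  assert (0 <= L * (dev_const * weight (avg x L))) by (apply Rmult_le_pos; nra).
  destruct j as [|[|j]]; [| |simpl in Hj; lia]; simpl.
  + replace (0 / 1) with 0 by field; rewrite !Rmult_0_l, m_0, Rminus_0_r, Rabs_R0; lra.
  + replace (1 / 1) with 1 by field; rewrite !Rmult_1_l, Rminus_diag, Rabs_R0; lra.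
- pose (h := L / 2); assert (Hh : 0 < h <= 1 / 2) by (unfold h; lra).
  assert (EL : L = 2 * h) by (unfold h; field).
  assert (P2 : 0 < 2 ^ k) by (apply pow_lt; lra).
  rewrite EL.
  destruct (avg_half x Hh) as [D1 D2].
  assert (D3 := avg_double x Hh).
  assert (A0 : 0 <= avg x (2 * h)) by (apply avg_ge0; lra).
  assert (W0 := exp_le_weight A0).
  assert (W1 : weight (avg x h) <= 3 / 2 * weight (avg x (2 * h))).
  { replace (3 / 2) with (/ (2 / 3)) by field. eapply weight_ratio; [| |exact D1]; lra. }
  assert (W2 : weight (avg (x + h) h) <= 3 / 2 * weight (avg x (2 * h))).
  { replace (3 / 2) with (/ (2 / 3)) by field. eapply weight_ratio; [| |exact D2]; lra. }
  rewrite (m_avg x (l := 2 * h)) by lra.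
  destruct (Compare_dec.le_lt_dec j (2 ^ k)) as [Hk|Hk].
  + assert (I1 := IH x h j (conj (proj1 Hh) (Rle_trans _ _ _ (proj2 Hh) half_le1)) Hk).
    pose (t := INR j / 2 ^ k). fold t in I1.
    replace (INR j / 2 ^ S k) with (t / 2) by (unfold t; simpl; field; lra).
    replace (t / 2 * (2 * h)) with (t * h) by field.
    assert (Ht : 0 <= t <= 1).
    { unfold t; split.
      - apply Rmult_le_pos; [apply pos_INR|left; now apply Rinv_0_lt_compat].
      - apply Rmult_le_reg_r with (2 ^ k); [lra|]; unfold Rdiv; rewrite Rmult_assoc, Rinv_l, Rmult_1_r, Rmult_1_l by lra.
        apply le_INR in Hk; rewrite INR_pow2 in Hk; exact Hk. }
    rewrite (m_avg x (l := h)) in I1 by lra.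
    assert (Hd := dev_const_gt0).
    revert I1 D1 W0 W1; generalize (avg x h) (avg x (2 * h)) (m x (t * h)); intros a1 a M I1 D1 W0 W1.
    apply Rabs_le_between in I1; apply Rabs_le_between in D1; apply Rabs_le_between.
    assert (E1 : - (C / 2 * exp (- a)) <= t * (a1 - a) <= C / 2 * exp (- a)) by nra.
    assert (E2 : - (h * (C / 2 * exp (- a))) <= h * (t * (a1 - a)) <= h * (C / 2 * exp (- a))) by nra.
    assert (E3 : h * (dev_const * weight a1) <= h * (dev_const * (3 / 2 * weight a))).
    { apply Rmult_le_compat_l; [lra|]; apply Rmult_le_compat_l; lra. }
    assert (E4 : h * (C * exp (- a)) <= h * (dev_const * weight a)) by (apply Rmult_le_compat_l; lra).
    lra.
  + pose (i := (j - 2 ^ k)%nat).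
    assert (Hi : (i <= 2 ^ k)%nat) by (unfold i; simpl in Hj; lia).
    assert (I1 := IH (x + h) h i (conj (proj1 Hh) (Rle_trans _ _ _ (proj2 Hh) half_le1)) Hi).
    pose (t := INR i / 2 ^ k). fold t in I1.
    assert (Ht : 0 <= t <= 1).
    { unfold t; split.
      - apply Rmult_le_pos; [apply pos_INR|left; now apply Rinv_0_lt_compat].
      - apply Rmult_le_reg_r with (2 ^ k); [lra|]; unfold Rdiv; rewrite Rmult_assoc, Rinv_l, Rmult_1_r, Rmult_1_l by lra.
        apply le_INR in Hi; rewrite INR_pow2 in Hi; exact Hi. }
    replace (INR j / 2 ^ S k) with ((1 + t) / 2).
    2:{ unfold t, i; rewrite minus_INR, INR_pow2 by lia; simpl; field; lra. }
    replace ((1 + t) / 2 * (2 * h)) with (h + t * h) by field.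
    rewrite m_add; try nra.
    rewrite (m_avg (x + h) (l := h)) in I1 by lra.
    rewrite (m_avg x (l := h)) by lra.
    assert (Hd := dev_const_gt0).
    revert I1 D1 D3 W0 W2; generalize (avg x h) (avg (x + h) h) (avg x (2 * h)) (m (x + h) (t * h)); intros a1 a2 a M I1 D1 D3 W0 W2.
    apply Rabs_le_between in I1; apply Rabs_le_between in D1; apply Rabs_le_between.
    (* With [a2 = 2 a - a1], the linear part [h a1 + t h a2] misses [(1 + t) h a] by
       [(1 - t) h (a1 - a)]. *)
    assert (E1 : - (C / 2 * exp (- a)) <= (1 - t) * (a1 - a) <= C / 2 * exp (- a)) by nra.
    assert (E2 : - (h * (C / 2 * exp (- a))) <= h * ((1 - t) * (a1 - a)) <= h * (C / 2 * exp (- a))) by nra.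
    assert (E3 : h * (dev_const * weight a2) <= h * (dev_const * (3 / 2 * weight a))).
    { apply Rmult_le_compat_l; [lra|]; apply Rmult_le_compat_l; lra. }
    assert (E4 : h * (C * exp (- a)) <= h * (dev_const * weight a)) by (apply Rmult_le_compat_l; lra).
    replace a2 with (2 * a - a1) in * by lra.
    lra.
Qed.

(** A doubling changes the average by at most half of [dev_const] times the current weight, and
    [(3/2)^n + (1/2) (3/2)^n = (3/2)^(n+1)]: the error bound reproduces itself together with the
    bound on the weight. *)
Lemma avg_scale x L0 n : 0 < L0 -> 2 ^ n * L0 <= 1 ->
  weight (avg x (2 ^ n * L0)) <= (3 / 2) ^ n * weight (avg x L0) /\
  Rabs (avg x (2 ^ n * L0) - avg x L0) <= dev_const * ((3 / 2) ^ n * weight (avg x L0)).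
Proof.
intros HL0; induction n as [|n IH]; intros Hn.
- assert (P := weight_gt0 (avg x L0)); assert (Q := dev_const_gt0).
  simpl; rewrite !Rmult_1_l, Rminus_diag, Rabs_R0; split; nra.
- assert (P2 : 0 < 2 ^ n) by (apply pow_lt; lra).
  simpl in Hn |- *.
  assert (Hh : 0 < 2 ^ n * L0 <= 1 / 2) by (split; nra).
  destruct IH as [IH1 IH2]; [lra|].
  assert (U := avg_up x Hh); rewrite (Rmult_assoc 2).
  assert (A0 : 0 <= avg x (2 ^ n * L0)) by (apply avg_ge0; lra).
  assert (W0 := exp_le_weight A0).
  assert (W1 : weight (avg x (2 * (2 ^ n * L0))) <= 3 / 2 * weight (avg x (2 ^ n * L0))).
  { replace (3 / 2) with (/ (2 / 3)) by field. eapply weight_ratio; [| |exact U]; lra. }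
  assert (Q := dev_const_gt0).
  split; [lra|].
  eapply Rle_trans; [|].
  { replace (avg x (2 * (2 ^ n * L0)) - avg x L0) with
      ((avg x (2 * (2 ^ n * L0)) - avg x (2 ^ n * L0)) + (avg x (2 ^ n * L0) - avg x L0)) by ring.
    apply Rabs_triang. }
  assert (dev_const * weight (avg x (2 ^ n * L0)) <= dev_const * ((3 / 2) ^ n * weight (avg x L0))).
  { apply Rmult_le_compat_l; lra. }
  lra.
Qed.

(** [3 ^ n * L0] is the length [2 ^ n * L0] times the growth [(3/2) ^ n] of the weight. To the left,
    the measure next to [x] is the complement of a grid arc in the neighbour starting at [x - L].
    The weight of that neighbour may be 3 times larger, and the changes of average between
    neighbours and between scales add one unit each: [5 = 3 + 1 + 1]. *)
Lemma grid_deviation x L0 n k j : 0 < L0 -> 2 ^ n * L0 <= 1 / 2 -> (j <= 2 ^ (n + k))%nat ->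
  let t := INR j * (L0 / 2 ^ k) in
  Rabs (m x t - t * avg x L0) <= 5 * dev_const * 3 ^ n * L0 * weight (avg x L0) /\
  Rabs (m (x - t) t - t * avg x L0) <= 5 * dev_const * 3 ^ n * L0 * weight (avg x L0).
Proof.
intros HL0 Hn Hj t.
pose (L := 2 ^ n * L0); pose (s := INR j / 2 ^ (n + k)).
assert (Pn : 0 < 2 ^ n) by (apply pow_lt; lra).
assert (Pk : 0 < 2 ^ k) by (apply pow_lt; lra).
assert (HL : 0 < L <= 1 / 2) by (unfold L; split; nra).
assert (Et : t = s * L) by (unfold t, s, L; rewrite pow_add; field; lra).
assert (Hs : 0 <= s <= 1).
{ unfold s; assert (0 < 2 ^ (n + k)) by (apply pow_lt; lra); split.
  - apply Rmult_le_pos; [apply pos_INR|left; now apply Rinv_0_lt_compat].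
  - apply Rmult_le_reg_r with (2 ^ (n + k)); [lra|]; unfold Rdiv; rewrite Rmult_assoc, Rinv_l, Rmult_1_r, Rmult_1_l by lra.
    apply le_INR in Hj; rewrite INR_pow2 in Hj; exact Hj. }
destruct (@avg_scale x L0 n HL0) as [S1 S2]; [lra|]; fold L in S1, S2.
assert (Q := dev_const_gt0).
assert (G1 := @avg_grid (n + k) x L j (conj (proj1 HL) (Rle_trans _ _ _ (proj2 HL) half_le1)) Hj).
fold s in G1.
pose (y := x - L); assert (Ey : y + L = x) by (unfold y; ring).
assert (G2 := @avg_grid (n + k) y L (2 ^ (n + k) - j) (conj (proj1 HL) (Rle_trans _ _ _ (proj2 HL) half_le1)) ltac:(lia)).
replace (INR (2 ^ (n + k) - j) / 2 ^ (n + k)) with (1 - s) in G2.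
2:{ unfold s; rewrite minus_INR, INR_pow2 by lia; field; apply pow_nonzero; lra. }
assert (M : m y L = m y ((1 - s) * L) + m (x - t) t).
{ replace L with ((1 - s) * L + t) at 1 by (rewrite Et; ring).
  rewrite m_add; [f_equal; f_equal; unfold y; rewrite Et; ring| | |]; try (rewrite Et; nra); nra. }
assert (F := m_bwd y HL); rewrite Ey in F; fold (avg x L) in F; fold (avg y L) in F.
assert (A0 : 0 <= avg x L) by (apply avg_ge0; lra).
assert (W0 := exp_le_weight A0).
assert (W1 : weight (avg y L) <= 3 * weight (avg x L)).
{ replace 3 with (/ (1 / 3)) by field.
  rewrite Rabs_minus_sym in F; eapply weight_ratio; [| |exact F]; lra. }
assert (E3 : L * ((3 / 2) ^ n * weight (avg x L0)) = 3 ^ n * L0 * weight (avg x L0)).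
{ unfold L; replace 3 with (2 * (3 / 2)) at 2 by field; rewrite (Rpow_mult_distr 2 (3/2)); ring. }
pose (X := 3 ^ n * L0 * weight (avg x L0)).
assert (X1 : L * (dev_const * weight (avg x L)) <= dev_const * X).
{ unfold X; rewrite <- E3.
  replace (dev_const * (L * ((3 / 2) ^ n * weight (avg x L0)))) with (L * (dev_const * ((3 / 2) ^ n * weight (avg x L0)))) by ring.
  apply Rmult_le_compat_l; [lra|]; apply Rmult_le_compat_l; lra. }
assert (X2 : L * (dev_const * weight (avg y L)) <= 3 * (L * (dev_const * weight (avg x L)))).
{ replace (3 * (L * (dev_const * weight (avg x L)))) with (L * (dev_const * (3 * weight (avg x L)))) by ring.
  apply Rmult_le_compat_l; [lra|]; apply Rmult_le_compat_l; lra. }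
assert (X3 : Rabs (t * (avg x L - avg x L0)) <= dev_const * X).
{ rewrite Rabs_mult, Rabs_right by (rewrite Et; nra).
  unfold X; rewrite <- E3.
  replace (dev_const * (L * ((3 / 2) ^ n * weight (avg x L0)))) with (L * (dev_const * ((3 / 2) ^ n * weight (avg x L0)))) by ring.
  apply Rmult_le_compat; [rewrite Et; nra|apply Rabs_pos|rewrite Et; nra|exact S2]. }
assert (X4 : Rabs (t * (avg x L - avg y L)) <= dev_const * X).
{ eapply Rle_trans; [|exact X1].
  rewrite Rabs_mult, Rabs_right by (rewrite Et; nra).
  apply Rmult_le_compat; [rewrite Et; nra|apply Rabs_pos|rewrite Et; nra|lra]. }
replace (5 * dev_const * 3 ^ n * L0 * weight (avg x L0)) with (5 * (dev_const * X)) by (unfold X; ring).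
assert (X0 : 0 <= dev_const * X).
{ eapply Rle_trans; [|exact X1]; generalize (weight_gt0 (avg x L)); intros; apply Rmult_le_pos; [lra|]; nra. }
rewrite (m_avg x (l := L)) in G1 by lra.
rewrite (m_avg y (l := L)) in G2, M by lra.
rewrite <- Et in G1.
replace (s * (L * avg x L)) with (t * avg x L) in G1 by (rewrite Et; ring).
replace ((1 - s) * (L * avg y L)) with (L * avg y L - t * avg y L) in G2 by (rewrite Et; ring).
apply Rabs_le_between in G1, G2, X3, X4.
split; apply Rabs_le_between; lra.
Qed.

End DyadicAverages.

(** * Testing the measure against kernels *)

Fixpoint rsum (f : nat -> R) (n : nat) : R :=
  match n with O => 0 | S p => rsum f p + f p end.

Lemma rsum_ext f g n : (forall i, (i < n)%nat -> f i = g i) -> rsum f n = rsum g n.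
Proof.
induction n as [|n IH]; intros H; simpl; [reflexivity|].
rewrite IH, (H n) by auto with arith; reflexivity.
Qed.

Lemma rsum_plus f g n : rsum (fun i => f i + g i) n = rsum f n + rsum g n.
Proof. induction n as [|n IH]; simpl; [ring|rewrite IH; ring]. Qed.

Lemma rsum_minus f g n : rsum (fun i => f i - g i) n = rsum f n - rsum g n.
Proof. induction n as [|n IH]; simpl; [ring|rewrite IH; ring]. Qed.

Lemma rsum_scal c f n : rsum (fun i => c * f i) n = c * rsum f n.
Proof. induction n as [|n IH]; simpl; [ring|rewrite IH; ring]. Qed.

Lemma rsum_telescope f n : rsum (fun i => f (S i) - f i) n = f n - f O.
Proof. induction n as [|n IH]; simpl; [ring|rewrite IH; ring]. Qed.

Lemma rsum_Rabs_le f g n : (forall i, (i < n)%nat -> Rabs (f i) <= g i) ->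
  Rabs (rsum f n) <= rsum g n.
Proof.
induction n as [|n IH]; intros H; simpl; [rewrite Rabs_R0; lra|].
eapply Rle_trans; [apply Rabs_triang|].
apply Rplus_le_compat; auto with arith.
Qed.

Lemma rsum_block f n p c : (forall i, (n <= i < n + p)%nat -> f i <= c) ->
  rsum f (n + p) <= rsum f n + INR p * c.
Proof.
induction p as [|p IH]; intros H.
- rewrite Nat.add_0_r; simpl; lra.
- rewrite Nat.add_succ_r, S_INR; simpl.
  assert (f (n + p)%nat <= c) by (apply H; lia).
  assert (rsum f (n + p) <= rsum f n + INR p * c) by (apply IH; intros; apply H; lia).
  lra.
Qed.

Lemma summation_by_parts f D n : D O = 0 ->
  rsum (fun i => f i * (D (S i) - D i)) n =
  f n * D n - rsum (fun i => (f (S i) - f i) * D (S i)) n.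
Proof. intros D0; induction n as [|n IH]; simpl; [rewrite D0; ring|rewrite IH; ring]. Qed.

(** With [h = L0 / 2^k], the indices from [2^(n+k)] to [2^(n+1+k)] contribute at most
    [2^(n+k) * kap h / (2^n L0)^3 * X 3^(n+1)], which is [3 (3/4)^n] times [kap X / L0^2]. These
    blocks sum to less than 12, the initial block adds 1, and the boundary term at the half circle
    adds 1 because [4 * 3^p <= 4^(p+1) = 1 / L0^2]. *)
Lemma abel_dyadic (f D : nat -> R) (p k : nat) (X kap : R) :
  let L0 := / 2 ^ (S p) in
  0 <= X -> 0 <= kap -> D O = 0 ->
  (forall n j, (n <= p)%nat -> (j <= 2 ^ (n + k))%nat -> Rabs (D j) <= X * 3 ^ n) ->
  (forall j, (j < 2 ^ (p + k))%nat -> Rabs (f (S j) - f j) <= kap * (L0 / 2 ^ k) / L0 ^ 3) ->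
  (forall n j, (n <= p)%nat -> (2 ^ (n + k) <= j)%nat -> (j < 2 ^ (p + k))%nat ->
     Rabs (f (S j) - f j) <= kap * (L0 / 2 ^ k) / (2 ^ n * L0) ^ 3) ->
  Rabs (f (2 ^ (p + k))%nat) <= 4 * kap ->
  Rabs (rsum (fun i => f i * (D (S i) - D i)) (2 ^ (p + k))) <= 14 * kap * X / L0 ^ 2.
Proof.
intros L0 HX Hk D0 HD Hf0 Hf HN.
assert (P2 : forall i, 0 < 2 ^ i) by (intros i; apply pow_lt; lra).
assert (HL : 0 < L0) by (apply Rinv_0_lt_compat, P2).
rewrite summation_by_parts by exact D0.
assert (S1 : forall n, (n <= p)%nat ->
  rsum (fun i => Rabs ((f (S i) - f i) * D (S i))) (2 ^ (n + k)) <=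
    kap * X / L0 ^ 2 * (13 - 12 * (3 / 4) ^ n)).
{ induction n as [|n IH]; intros Hn.
  - assert (B := @rsum_block (fun i => Rabs ((f (S i) - f i) * D (S i))) 0 (2 ^ k)
      (kap * (L0 / 2 ^ k) / L0 ^ 3 * X)).
    rewrite !Nat.add_0_l in B |- *; simpl rsum in B.
    rewrite INR_pow2 in B.
    replace (kap * X / L0 ^ 2 * (13 - 12 * (3 / 4) ^ 0)) with
      (0 + 2 ^ k * (kap * (L0 / 2 ^ k) / L0 ^ 3 * X)).
    2:{ simpl; field; split; apply Rgt_not_eq; [exact HL|apply P2]. }
    apply B; intros i Hi; rewrite Rabs_mult.
    apply Rmult_le_compat; try apply Rabs_pos.
    + apply Hf0; eapply Nat.lt_le_trans; [apply Hi|apply Nat.pow_le_mono_r; lia].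
    + assert (H := HD O (S i)); rewrite Nat.add_0_l, Rmult_1_r in H; apply H; lia.
  - assert (E : (2 ^ (S n + k) = 2 ^ (n + k) + 2 ^ (n + k))%nat) by (simpl; lia).
    rewrite E.
    eapply Rle_trans.
    { apply (@rsum_block _ _ _ (kap * (L0 / 2 ^ k) / (2 ^ n * L0) ^ 3 * (X * 3 ^ (S n)))).
      intros i Hi; rewrite Rabs_mult.
      apply Rmult_le_compat; try apply Rabs_pos.
      - apply Hf; try lia.
        eapply Nat.lt_le_trans; [apply Hi|]; rewrite <- E; apply Nat.pow_le_mono_r; lia.
      - apply HD; lia. }
    rewrite INR_pow2.
    assert (IH' := IH ltac:(lia)).
    replace (2 ^ (n + k) * (kap * (L0 / 2 ^ k) / (2 ^ n * L0) ^ 3 * (X * 3 ^ S n))) with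
      (kap * X / L0 ^ 2 * (3 * (3 / 4) ^ n)).
    2:{ rewrite pow_add; replace ((3 / 4) ^ n) with (3 ^ n / (2 ^ n * 2 ^ n)).
        - simpl; field; repeat split; apply Rgt_not_eq; solve [exact HL | apply P2].
        - rewrite <- Rpow_mult_distr; replace (2 * 2) with 4 by ring.
          unfold Rdiv; now rewrite Rpow_mult_distr, pow_inv. }
    simpl ((3 / 4) ^ S n).
    lra. }
assert (S2 := S1 p (le_n p)).
assert (S3 : Rabs (rsum (fun i => (f (S i) - f i) * D (S i)) (2 ^ (p + k))) <=
   rsum (fun i => Rabs ((f (S i) - f i) * D (S i))) (2 ^ (p + k))).
{ apply rsum_Rabs_le; intros; lra. }
assert (K : 0 <= kap * X / L0 ^ 2).
{ apply Rmult_le_pos; [nra|left; apply Rinv_0_lt_compat, pow_lt, HL]. }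
assert (Q : 0 < (3 / 4) ^ p) by (apply pow_lt; lra).
assert (S4 : Rabs (f (2 ^ (p + k))%nat * D (2 ^ (p + k))%nat) <= kap * X / L0 ^ 2).
{ rewrite Rabs_mult.
  apply Rle_trans with (4 * kap * (X * 3 ^ p)).
  - apply Rmult_le_compat; try apply Rabs_pos; [exact HN|apply HD; lia].
  - replace (kap * X / L0 ^ 2) with (kap * X * (4 * 4 ^ p)).
    + assert (3 ^ p <= 4 ^ p) by (apply pow_incr; lra).
      assert (0 <= kap * X) by nra.
      replace (4 * kap * (X * 3 ^ p)) with (kap * X * (4 * 3 ^ p)) by ring.
      apply Rmult_le_compat_l; lra.
    + unfold L0; replace 4 with (2 * 2) by ring; rewrite Rpow_mult_distr; simpl.
      field; apply Rgt_not_eq, P2. }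
replace (14 * kap * X / L0 ^ 2) with (14 * (kap * X / L0 ^ 2)) by (field; lra).
assert (S5 : kap * X / L0 ^ 2 * (13 - 12 * (3 / 4) ^ p) <= 13 * (kap * X / L0 ^ 2)) by nra.
unfold Rminus at 1; eapply Rle_trans; [apply Rabs_triang|]; rewrite Rabs_Ropp.
lra.
Qed.

(** * Comparison of the measure with a constant density on a periodic kernel *)

Section KernelTest.
Variables (nu : circ_measure) (C : R).
Hypothesis nu_fin : (nu I01 < +oo)%E.
Let m := arc_measure nu.
Hypothesis C_gt0 : 0 < C.
Hypothesis m_fwd : forall x l, 0 < l <= 1 / 2 ->
  Rabs (m x l / l - m (x + l) l / l) <= C * exp (- (m x l / l)).
Hypothesis m_bwd : forall x l, 0 < l <= 1 / 2 ->
  Rabs (m (x + l) l / l - m x l / l) <= C * exp (- (m (x + l) l / l)).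

Lemma arc_measure_add x l1 l2 : 0 <= l1 -> 0 <= l2 -> l1 + l2 <= 1 ->
  m x (l1 + l2) = m x l1 + m (x + l1) l2.
Proof.
intros H1 H2 H.
assert (E := arcint_add nu_fin x (@continuity_cst 1) H1 H2 H).
rewrite !arcint_cst, !Rmult_1_l in E; exact E.
Qed.

Lemma arcint_cells K x h n : continuity K -> 0 <= h -> INR n * h <= 1 ->
  arcint nu K x (INR n * h) = rsum (fun i => arcint nu K (x + INR i * h) h) n.
Proof.
intros HK Hh; induction n as [|n IH]; intros Hn.
- assert (E := arcint_add nu_fin x HK (Rle_refl 0) (Rle_refl 0)).
  simpl; rewrite Rmult_0_l; rewrite !Rplus_0_r in E; lra.
- rewrite S_INR in Hn |- *; simpl.
  assert (0 <= INR n * h) by (apply Rmult_le_pos; [apply pos_INR|exact Hh]).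
  rewrite <- IH by lra.
  rewrite <- arcint_add; [f_equal; ring|exact nu_fin|exact HK|assumption|exact Hh|lra].
Qed.

Lemma arcint_cells_left K x h n : continuity K -> 0 <= h -> INR n * h <= 1 ->
  arcint nu K (x - INR n * h) (INR n * h) = rsum (fun i => arcint nu K (x - INR (S i) * h) h) n.
Proof.
intros HK Hh; induction n as [|n IH]; intros Hn.
- assert (E := arcint_add nu_fin (x - 0) HK (Rle_refl 0) (Rle_refl 0)).
  simpl; rewrite Rmult_0_l; rewrite !Rplus_0_r in E; lra.
- assert (0 <= INR n * h) by (apply Rmult_le_pos; [apply pos_INR|exact Hh]).
  replace (INR (S n) * h) with (h + INR n * h) in Hn |- * by (rewrite S_INR; ring).
  rewrite arcint_add by (try exact nu_fin; try exact HK; lra).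
  replace (x - (h + INR n * h) + h) with (x - INR n * h) by ring.
  rewrite IH by lra; cbn [rsum].
  replace (x - INR (S n) * h) with (x - (h + INR n * h)) by (rewrite S_INR; ring).
  ring.
Qed.

(** Points of the arc are representatives in [[0, 1[] of points of [[x, x + h[]; periodicity of [K]
    transfers the hypothesis to them. *)
Lemma cell_bound K x h s e : continuity K -> (forall t, K (t + 1) = K t) ->
  (forall t, x <= t <= x + h -> Rabs (K t - K s) <= e) ->
  Rabs (arcint nu K x h - K s * m x h) <= e * m x h.
Proof.
intros HK Hp H; apply arcint_bound; [exact nu_fin|exact HK|].
intros t (_ & _ & j & Hj1 & Hj2).
replace (K t) with (K (t + IZR j)); [apply H; lra|].
assert (Pn : forall u n, K (u + INR n) = K u).
{ intros u n; induction n as [|n IH]; [simpl; f_equal; ring|].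
  rewrite S_INR, <- Rplus_assoc, Hp; exact IH. }
destruct (Z.le_ge_cases 0 j) as [Hj|Hj].
- rewrite <- (Znat.Z2Nat.id j Hj), <- INR_IZR_INZ; apply Pn.
- rewrite <- (Pn (t + IZR j) (Z.to_nat (- j))), INR_IZR_INZ, Znat.Z2Nat.id by lia.
  rewrite opp_IZR; f_equal; ring.
Qed.

Lemma primitive_step K G x h s e : 0 <= h -> (forall t, derivable_pt_lim G t (K t)) ->
  (forall t, x <= t <= x + h -> Rabs (K t - K s) <= e) ->
  Rabs (G (x + h) - G x - h * K s) <= h * e.
Proof.
intros Hh HG H; destruct Hh as [Hh|<-].
- destruct (@MVT_cor2 G K x (x + h)) as (c & Hc & Hc2); [lra|intros; apply HG|].
  rewrite Hc; replace (K c * (x + h - x) - h * K s) with (h * (K c - K s)) by ring.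
  rewrite Rabs_mult, Rabs_right by lra.
  apply Rmult_le_compat_l; [lra|]; apply H; lra.
- rewrite Rplus_0_r; replace (G x - G x - 0 * K s) with 0 by ring; rewrite Rabs_R0; lra.
Qed.

(** The subtracted term is the integral of [K] against the constant density [a], so this tests
    [nu - a dt] on [K]. The hypotheses on [K] describe a kernel of height [L0] centred at [theta],
    with slope at most [kap / r^3] at distance [r]. Each half circle around [theta] gives
    [14 kap X / L0^2] with [X = 5 dev_const L0 weight], hence the factor [140 = 2 * 14 * 5]. *)
Lemma kernel_test K G theta p kap :
  let L0 := / 2 ^ (S p) in let a := avg m theta L0 in
  0 <= kap -> continuity K -> (forall t, K (t + 1) = K t) ->
  (forall t, derivable_pt_lim G t (K t)) ->
  (forall t s, Rabs (K t - K s) <= kap * Rabs (t - s) / L0 ^ 3) ->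
  (forall r t s, 0 < r -> r <= Rabs t <= 1 / 2 -> r <= Rabs s <= 1 / 2 ->
     Rabs (K (theta + t) - K (theta + s)) <= kap * Rabs (t - s) / r ^ 3) ->
  Rabs (K (theta + 1 / 2)) <= 4 * kap ->
  Rabs (cint nu K - a * (G (theta + 1 / 2) - G (theta - 1 / 2))) <=
    140 * dev_const C * kap * weight C a / L0.
Proof.
intros L0 a Hkap HK Hper HG HL HR HE.
assert (P2 : forall i, 0 < 2 ^ i) by (intros i; apply pow_lt; lra).
assert (HL0 : 0 < L0) by (apply Rinv_0_lt_compat, P2).
assert (HLp : 2 ^ p * L0 = 1 / 2) by (unfold L0; simpl; field; apply Rgt_not_eq, P2).
pose (T := m 0 1).
assert (T0 : 0 <= T) by apply arc_measure_ge0.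
assert (Q := dev_const_gt0 C_gt0).
assert (W := weight_gt0 C_gt0 a).
assert (a0 : 0 <= a) by (apply avg_ge0; [apply arc_measure_ge0|exact HL0]).
pose (X := 5 * dev_const C * L0 * weight C a).
assert (HX : 0 <= X) by (unfold X; apply Rmult_le_pos; [|lra]; apply Rmult_le_pos; nra).
apply le_epsilon; intros eps Heps.
pose (Lam := kap / L0 ^ 3).
assert (HLam : 0 <= Lam).
{ apply Rmult_le_pos; [lra|left; apply Rinv_0_lt_compat, pow_lt, HL0]. }
(* Freezing [K] on cells of mesh [h] costs [Lam h] times the mass of [nu] and times the mass of the
   density [a], in total [(T + a) Lam h]. *)
assert (Hk : exists k, (T + a) * Lam * (L0 / 2 ^ k) <= eps).
{ destruct (@pow_lt_1_zero (/ 2)) with (y := eps / ((T + a) * Lam * L0 + 1)) as [k Hk].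
  - rewrite Rabs_right; lra.
  - apply Rdiv_lt_0_compat; [lra|]; assert (0 <= (T + a) * Lam * L0) by (apply Rmult_le_pos; [apply Rmult_le_pos|]; lra); lra.
  - exists k; specialize (Hk k (le_n k)).
    assert (Z : 0 <= (T + a) * Lam * L0) by (apply Rmult_le_pos; [apply Rmult_le_pos|]; lra).
    rewrite Rabs_right, pow_inv in Hk by (apply Rle_ge, pow_le; lra).
    replace ((T + a) * Lam * (L0 / 2 ^ k)) with ((T + a) * Lam * L0 * / 2 ^ k) by (field; apply Rgt_not_eq, P2).
    assert (0 < / 2 ^ k) by (apply Rinv_0_lt_compat, P2).
    apply (Rmult_lt_compat_l ((T + a) * Lam * L0 + 1)) in Hk; [|lra].
    replace (((T + a) * Lam * L0 + 1) * (eps / ((T + a) * Lam * L0 + 1))) with eps in Hk by (field; lra).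
    nra. }
destruct Hk as [k Hk].
pose (h := L0 / 2 ^ k); fold h in Hk.
assert (Hh : 0 < h) by (apply Rdiv_lt_0_compat; auto).
pose (N := (2 ^ (p + k))%nat).
assert (HN : INR N * h = 1 / 2).
{ unfold N, h; rewrite INR_pow2, pow_add, <- HLp; field; apply Rgt_not_eq, P2. }
assert (Ht : forall j, (j <= N)%nat -> INR j * h <= 1 / 2).
{ intros j Hj; rewrite <- HN; apply Rmult_le_compat_r; [lra|]; now apply le_INR. }
assert (Htp : forall j, 0 <= INR j * h) by (intros j; apply Rmult_le_pos; [apply pos_INR|lra]).
assert (Lip : forall t s, Rabs (t - s) <= h -> Rabs (K t - K s) <= Lam * h).
{ intros t s Hts; eapply Rle_trans; [apply HL|].
  unfold Lam; replace (kap * Rabs (t - s) / L0 ^ 3) with (kap / L0 ^ 3 * Rabs (t - s)) by (field; lra).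
  apply Rmult_le_compat_l; assumption. }
(* Distribution functions of [nu - a dt] to the right and to the left of [theta]. Both vanish at
   [theta], so summation by parts leaves boundary terms only at the opposite point of the circle. *)
pose (Dr := fun j => m theta (INR j * h) - INR j * h * a).
pose (Dl := fun j => m (theta - INR j * h) (INR j * h) - INR j * h * a).
pose (fr := fun j => K (theta + INR j * h)).
pose (fl := fun j => K (theta - INR j * h)).
assert (m0 : forall x, m x 0 = 0) by (apply m_0; apply arc_measure_add).
assert (Ar : Rabs (rsum (fun i => fr i * (Dr (S i) - Dr i)) N) <= 14 * kap * X / L0 ^ 2).
{ apply abel_dyadic; auto.
  - unfold Dr; simpl; rewrite !Rmult_0_l, m0; ring.
  - intros n j Hn Hj.
    assert (Hpn : 2 ^ n * L0 <= 1 / 2).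
    { rewrite <- HLp; apply Rmult_le_compat_r; [lra|]; apply Rle_pow; [lra|exact Hn]. }
    destruct (@grid_deviation m C (arc_measure_ge0 nu) arc_measure_add C_gt0 m_fwd m_bwd theta L0 n k j HL0 Hpn Hj) as [E _].
    eapply Rle_trans; [exact E|]; unfold X; right; fold a; ring.
  - intros j Hj; unfold fr; eapply Rle_trans; [apply HL|].
    right; rewrite S_INR; replace (theta + (INR j + 1) * h - (theta + INR j * h)) with h by ring.
    now rewrite Rabs_right by lra.
  - intros n j Hn Hj1 Hj2; unfold fr.
    assert (Hrj : 2 ^ n * L0 <= INR j * h).
    { apply le_INR in Hj1; rewrite INR_pow2, pow_add in Hj1.
      replace (2 ^ n * L0) with (2 ^ n * 2 ^ k * h) by (unfold h; field; apply Rgt_not_eq, P2).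
      apply Rmult_le_compat_r; lra. }
    assert (Hj3 := Ht (S j) Hj2).
    eapply Rle_trans; [apply (HR (2 ^ n * L0))|].
    + apply Rmult_lt_0_compat; auto.
    + rewrite Rabs_right by (apply Rle_ge, Htp); rewrite S_INR in Hj3 |- *; lra.
    + rewrite Rabs_right by (apply Rle_ge, Htp); rewrite S_INR in Hj3; lra.
    + right; rewrite S_INR; replace ((INR j + 1) * h - INR j * h) with h by ring.
      now rewrite Rabs_right by lra.
  - unfold fr; fold N; rewrite HN; exact HE. }
assert (Al : Rabs (rsum (fun i => fl i * (Dl (S i) - Dl i)) N) <= 14 * kap * X / L0 ^ 2).
{ apply abel_dyadic; auto.
  - unfold Dl; simpl; rewrite !Rmult_0_l, m0; ring.
  - intros n j Hn Hj.
    assert (Hpn : 2 ^ n * L0 <= 1 / 2).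
    { rewrite <- HLp; apply Rmult_le_compat_r; [lra|]; apply Rle_pow; [lra|exact Hn]. }
    destruct (@grid_deviation m C (arc_measure_ge0 nu) arc_measure_add C_gt0 m_fwd m_bwd theta L0 n k j HL0 Hpn Hj) as [_ E].
    eapply Rle_trans; [exact E|]; unfold X; right; fold a; ring.
  - intros j Hj; unfold fl; eapply Rle_trans; [apply HL|].
    right; rewrite S_INR; replace (theta - (INR j + 1) * h - (theta - INR j * h)) with (- h) by ring.
    now rewrite Rabs_Ropp, Rabs_right by lra.
  - intros n j Hn Hj1 Hj2; unfold fl.
    assert (Hrj : 2 ^ n * L0 <= INR j * h).
    { apply le_INR in Hj1; rewrite INR_pow2, pow_add in Hj1.
      replace (2 ^ n * L0) with (2 ^ n * 2 ^ k * h) by (unfold h; field; apply Rgt_not_eq, P2).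
      apply Rmult_le_compat_r; lra. }
    assert (Hj3 := Ht (S j) Hj2).
    unfold Rminus.
    eapply Rle_trans; [apply (HR (2 ^ n * L0))|].
    + apply Rmult_lt_0_compat; auto.
    + rewrite Rabs_Ropp, Rabs_right by (apply Rle_ge, Htp); rewrite S_INR in Hj3 |- *; lra.
    + rewrite Rabs_Ropp, Rabs_right by (apply Rle_ge, Htp); rewrite S_INR in Hj3; lra.
    + right; rewrite S_INR; replace (- ((INR j + 1) * h) - - (INR j * h)) with (- h) by ring.
      now rewrite Rabs_Ropp, Rabs_right by lra.
  - unfold fl; fold N; rewrite HN.
    replace (theta + 1 / 2) with (theta - 1 / 2 + 1) in HE by field; rewrite Hper in HE; exact HE. }
pose (cr := fun i => theta + INR i * h).
pose (cl := fun i => theta - INR (S i) * h).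
assert (Cr : forall i, (i < N)%nat ->
  Rabs (arcint nu K (cr i) h - fr i * m (cr i) h) <= Lam * h * m (cr i) h /\ Rabs (G (theta + INR (S i) * h) - G (theta + INR i * h) - h * fr i) <= h * (Lam * h)).
{ intros i Hi.
  assert (B : forall t, cr i <= t <= cr i + h -> Rabs (K t - K (theta + INR i * h)) <= Lam * h).
  { intros t Hti; apply Lip; unfold cr in Hti; rewrite Rabs_right; lra. }
  split; [apply cell_bound; auto|].
  replace (theta + INR (S i) * h) with (cr i + h) by (unfold cr; rewrite S_INR; ring).
  apply primitive_step; auto; lra. }
assert (Cl : forall i, (i < N)%nat ->
  Rabs (arcint nu K (cl i) h - fl i * m (cl i) h) <= Lam * h * m (cl i) h /\ Rabs (G (theta - INR i * h) - G (theta - INR (S i) * h) - h * fl i) <= h * (Lam * h)).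
{ intros i Hi.
  assert (B : forall t, cl i <= t <= cl i + h -> Rabs (K t - K (theta - INR i * h)) <= Lam * h).
  { intros t Hti; apply Lip; unfold cl in Hti; rewrite S_INR in Hti.
    apply Rabs_le; lra. }
  split; [apply cell_bound; auto|].
  replace (theta - INR i * h) with (cl i + h) by (unfold cl; rewrite S_INR; ring).
  fold (cl i); apply primitive_step; [lra|exact HG|].
  replace (cl i + h) with (theta - INR i * h) by (unfold cl; rewrite S_INR; ring).
  intros t Hti; apply Lip; unfold cl in Hti; rewrite S_INR in Hti; apply Rabs_le; lra. }
assert (Er : forall i, m (cr i) h - h * a = Dr (S i) - Dr i \/ (N <= i)%nat).
{ intros i; destruct (Nat.le_gt_cases N i) as [Hi|Hi]; [now right|left].
  assert (Hj3 := Ht (S i) Hi); rewrite S_INR in Hj3.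
  unfold Dr, cr; rewrite S_INR.
  replace ((INR i + 1) * h) with (INR i * h + h) by ring.
  rewrite arc_measure_add; [ring|apply Htp|lra|lra]. }
assert (El : forall i, m (cl i) h - h * a = Dl (S i) - Dl i \/ (N <= i)%nat).
{ intros i; destruct (Nat.le_gt_cases N i) as [Hi|Hi]; [now right|left].
  assert (Hj3 := Ht (S i) Hi); rewrite S_INR in Hj3.
  unfold Dl, cl; rewrite S_INR.
  replace (m (theta - (INR i + 1) * h) ((INR i + 1) * h)) with
    (m (theta - (INR i + 1) * h) h + m (theta - INR i * h) (INR i * h)); [ring|].
  replace ((INR i + 1) * h) with (h + INR i * h) by ring.
  rewrite arc_measure_add; [f_equal; f_equal; ring|lra|apply Htp|lra]. }
assert (Sr : Rabs (rsum (fun i => (arcint nu K (cr i) h - a * (G (theta + INR (S i) * h) - G (theta + INR i * h)))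
     - fr i * (Dr (S i) - Dr i)) N) <= rsum (fun i => Lam * h * (m (cr i) h + a * h)) N).
{ apply rsum_Rabs_le; intros i Hi.
  destruct (Er i) as [<-|?]; [|lia].
  destruct (Cr i Hi) as [B1 B2].
  apply Rabs_le_between in B1, B2; apply Rabs_le.
  assert (a * - (h * (Lam * h)) <= a * (G (theta + INR (S i) * h) - G (theta + INR i * h) - h * fr i) <= a * (h * (Lam * h))) by (split; apply Rmult_le_compat_l; lra).
  lra. }
assert (Sl : Rabs (rsum (fun i => (arcint nu K (cl i) h - a * (G (theta - INR i * h) - G (theta - INR (S i) * h)))
     - fl i * (Dl (S i) - Dl i)) N) <= rsum (fun i => Lam * h * (m (cl i) h + a * h)) N).
{ apply rsum_Rabs_le; intros i Hi.
  destruct (El i) as [<-|?]; [|lia].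
  destruct (Cl i Hi) as [B1 B2].
  apply Rabs_le_between in B1, B2; apply Rabs_le.
  assert (a * - (h * (Lam * h)) <= a * (G (theta - INR i * h) - G (theta - INR (S i) * h) - h * fl i) <= a * (h * (Lam * h))) by (split; apply Rmult_le_compat_l; lra).
  lra. }
rewrite !rsum_minus, !rsum_scal, !rsum_plus in Sr, Sl.
rewrite (@rsum_telescope (fun i => G (theta + INR i * h)) N), HN in Sr.
assert (Tl : rsum (fun i => G (theta - INR i * h) - G (theta - INR (S i) * h)) N = G theta - G (theta - 1 / 2)).
{ rewrite (@rsum_ext _ (fun i => (- G (theta - INR (S i) * h)) - (- G (theta - INR i * h)))) by (intros; ring).
  rewrite (@rsum_telescope (fun i => - G (theta - INR i * h)) N), HN; simpl.
  rewrite Rmult_0_l, Rminus_0_r; ring. }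
rewrite Tl in Sl.
assert (Cst : forall n, rsum (fun _ => a * h) n = INR n * (a * h)).
{ intros n; induction n as [|n IH]; [simpl; ring|rewrite S_INR; simpl; rewrite IH; ring]. }
rewrite Cst in Sr, Sl.
replace (INR N * (a * h)) with (a * (INR N * h)) in Sr, Sl by ring; rewrite HN in Sr, Sl.
assert (HN1 : INR N * h <= 1) by lra.
assert (Mr := @arcint_cells (fun _ => 1) theta h N (@continuity_cst 1) (Rlt_le _ _ Hh) HN1).
assert (Ml := @arcint_cells_left (fun _ => 1) theta h N (@continuity_cst 1) (Rlt_le _ _ Hh) HN1).
assert (Kr := @arcint_cells K theta h N HK (Rlt_le _ _ Hh) HN1).
assert (Kl := @arcint_cells_left K theta h N HK (Rlt_le _ _ Hh) HN1).
rewrite HN in Mr, Ml, Kr, Kl.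
rewrite arcint_cst in Mr, Ml.
rewrite (@rsum_ext _ (fun i => m (cr i) h)) in Mr by (intros; rewrite arcint_cst; apply Rmult_1_l).
rewrite (@rsum_ext _ (fun i => m (cl i) h)) in Ml by (intros; rewrite arcint_cst; apply Rmult_1_l).
fold m in Mr, Ml.
change (rsum (fun i => arcint nu K (theta + INR i * h) h) N) with (rsum (fun i => arcint nu K (cr i) h) N) in Kr.
change (rsum (fun i => arcint nu K (theta - INR (S i) * h) h) N) with (rsum (fun i => arcint nu K (cl i) h) N) in Kl.
rewrite <- Kr, <- Mr in Sr; rewrite <- Kl, <- Ml in Sl.
simpl (INR 0) in Sr; rewrite Rmult_0_l, Rplus_0_r in Sr.
assert (Kf : cint nu K = arcint nu K (theta - 1 / 2) (1 / 2) + arcint nu K theta (1 / 2)).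
{ rewrite <- (arcint_full nu K (theta - 1 / 2)).
  replace 1 with (1 / 2 + 1 / 2) at 2 by field.
  rewrite arcint_add by (try exact nu_fin; try exact HK; lra).
  f_equal; f_equal; field. }
assert (Mf : T = m (theta - 1 / 2) (1 / 2) + m theta (1 / 2)).
{ unfold T, m; rewrite !arc_measure_full, <- (arc_measure_full nu (theta - 1 / 2)); fold m.
  replace 1 with (1 / 2 + 1 / 2) at 2 by field.
  rewrite arc_measure_add by lra.
  f_equal; f_equal; field. }
replace (140 * dev_const C * kap * weight C a / L0) with (28 * kap * X / L0 ^ 2) by (unfold X; field; lra).
rewrite Kf.
replace ((T + a) * Lam * h) with (Lam * h * (1 * m theta (1 / 2) + a * (1 / 2)) + Lam * h * (1 * m (theta - 1 / 2) (1 / 2) + a * (1 / 2))) in Hk by (rewrite Mf; field).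
replace (28 * kap * X / L0 ^ 2) with (14 * kap * X / L0 ^ 2 + 14 * kap * X / L0 ^ 2) by (field; lra).

apply Rabs_le_between in Sr, Sl, Ar, Al.
apply Rabs_le.
lra.
Qed.
End KernelTest.

(** * Geometry of the unit circle *)

Lemma PI_gt3 : 3 < PI.
Proof. generalize PI2_3_2; intros; lra. Qed.

Lemma PI_le4 : PI <= 4.
Proof. apply PI_4. Qed.

Lemma zeta_plus t k : zeta (t + IZR k) = zeta t.
Proof.
rewrite !zetaE; replace (2 * PI * (t + IZR k)) with (2 * PI * t + 2 * IZR k * PI) by ring.
assert (Hn : forall u n, cos (u + 2 * INR n * PI) = cos u /\ sin (u + 2 * INR n * PI) = sin u)
  by (intros; split; [apply cos_period|apply sin_period]).
destruct (Z.le_ge_cases 0 k) as [Hk|Hk].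
- rewrite <- (Znat.Z2Nat.id k Hk), <- INR_IZR_INZ.
  destruct (Hn (2 * PI * t) (Z.to_nat k)) as [E1 E2]; rewrite E1, E2; reflexivity.
- destruct (Hn (2 * PI * t + 2 * IZR k * PI) (Z.to_nat (- k))) as [E1 E2].
  rewrite INR_IZR_INZ, Znat.Z2Nat.id, opp_IZR in E1, E2 by lia.
  replace (2 * PI * t + 2 * IZR k * PI + 2 * - IZR k * PI) with (2 * PI * t) in E1, E2 by ring.
  rewrite E1, E2; reflexivity.
Qed.

Lemma zeta_1 t : zeta (t + 1) = zeta t.
Proof. exact (zeta_plus t 1). Qed.

Lemma Cmod_sqr (z : C) : Cmod z ^ 2 = fst z ^ 2 + snd z ^ 2.
Proof. unfold Cmod; rewrite pow2_sqrt; [reflexivity|nra]. Qed.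

Lemma Cmod_le_sqr (z : C) b : 0 <= b -> fst z ^ 2 + snd z ^ 2 <= b ^ 2 -> Cmod z <= b.
Proof.
intros Hb H; rewrite <- Cmod_sqr in H.
apply Rsqr_incr_0_var; [unfold Rsqr; nra|exact Hb].
Qed.

Lemma Cmod_zeta t : Cmod (zeta t) = 1.
Proof.
assert (H := Cmod_sqr (zeta t)); rewrite zetaE in H |- *; simpl fst in H; simpl snd in H.
generalize (sin2_cos2 (2 * PI * t)) (Cmod_ge_0 (cos (2 * PI * t), sin (2 * PI * t))); unfold Rsqr; intros; nra.
Qed.

Lemma zeta_chord t s : Cmod (zeta t - zeta s) ^ 2 = 4 * sin (PI * (t - s)) ^ 2.
Proof.
rewrite Cmod_sqr, !zetaE; simpl fst; simpl snd.
assert (H : cos (2 * (PI * (t - s))) = 1 - 2 * sin (PI * (t - s)) * sin (PI * (t - s))) by apply cos_2a_sin.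
replace (2 * (PI * (t - s))) with (2 * PI * t - 2 * PI * s) in H by ring.
rewrite cos_minus in H.
generalize (sin2_cos2 (2 * PI * t)) (sin2_cos2 (2 * PI * s)); unfold Rsqr; intros; nra.
Qed.

Lemma Rabs_sin_le x : Rabs (sin x) <= Rabs x.
Proof.
assert (P : forall y, 0 <= y -> Rabs (sin y) <= y).
{ intros y Hy; destruct (Rle_dec y 1) as [H1|H1].
  - destruct Hy as [Hy|<-]; [|rewrite sin_0, Rabs_R0; lra].
    assert (0 <= sin y) by (apply sin_ge_0; generalize PI_gt3; lra).
    rewrite Rabs_right by lra; left; now apply sin_lt_x.
  - generalize (SIN_bound y); intros; apply Rabs_le; lra. }
destruct (Rle_dec 0 x) as [H|H].
- rewrite (Rabs_right x) by lra; now apply P.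
- rewrite <- (Rabs_Ropp (sin x)), <- sin_neg, (Rabs_left x) by lra; apply P; lra.
Qed.

(* [sin x >= x / 2] on [0, pi/2], from [sin x = 2 sin (x/2) cos (x/2)] and [sin y >= y cos y]. *)
Lemma sin_PI_ge u : Rabs u <= 1 / 2 -> Rabs u <= Rabs (sin (PI * u)).
Proof.
assert (P3 := PI_gt3).
assert (P : forall v, 0 < v <= 1 / 2 -> v <= sin (PI * v)).
{ intros v Hv; pose (y := PI * v / 2).
  assert (Hy : 0 < y <= PI / 4) by (unfold y; split; nra).
  destruct (@MVT_cor2 sin cos 0 y) as (c & Hc & Hc2); [lra|intros; apply derivable_pt_lim_sin|].
  rewrite sin_0, !Rminus_0_r in Hc.
  assert (C1 : / sqrt 2 <= cos c).
  { rewrite <- (Rmult_1_l (/ sqrt 2)); change (1 * / sqrt 2) with (1 / sqrt 2).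
    rewrite <- cos_PI4; apply cos_decr_1; lra. }
  assert (C2 : / sqrt 2 <= cos y).
  { rewrite <- (Rmult_1_l (/ sqrt 2)); change (1 * / sqrt 2) with (1 / sqrt 2).
    rewrite <- cos_PI4; apply cos_decr_1; lra. }
  assert (S0 : 0 < sqrt 2) by (apply sqrt_lt_R0; lra).
  assert (S2 : / sqrt 2 * / sqrt 2 = / 2).
  { rewrite <- Rinv_mult, sqrt_def by lra; reflexivity. }
  assert (S3 : 0 < / sqrt 2) by now apply Rinv_0_lt_compat.
  replace (PI * v) with (2 * y) by (unfold y; field).
  rewrite sin_2a, Hc.
  assert (/ 2 <= cos c * cos y) by (rewrite <- S2; apply Rmult_le_compat; lra).
  assert (E : 2 * (cos c * y) * cos y = 2 * y * (cos c * cos y)) by ring.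
  rewrite E.
  assert (v <= y) by (unfold y; nra).
  nra. }
intros Hu; destruct (Rtotal_order u 0) as [H|[->|H]].
- rewrite Rabs_left in * by lra.
  replace (PI * u) with (- (PI * - u)) by ring; rewrite sin_neg, Rabs_Ropp.
  eapply Rle_trans; [apply P; lra|apply Rle_abs].
- rewrite Rabs_R0; apply Rabs_pos.
- rewrite Rabs_right in * by lra.
  eapply Rle_trans; [apply P; lra|apply Rle_abs].
Qed.

(** The sharp constant is [2 PI]; 8 comes from [PI <= 4] and enters all later Lipschitz
    constants. *)
Lemma zeta_chord_le t s : Cmod (zeta t - zeta s) <= 8 * Rabs (t - s).
Proof.
assert (H := zeta_chord t s); assert (S := Rabs_sin_le (PI * (t - s))).
assert (P3 := PI_gt3); assert (P4 := PI_le4).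
rewrite Rabs_mult, (Rabs_right PI) in S by lra.
apply Rsqr_incr_0_var; [|generalize (Rabs_pos (t - s)); lra].
unfold Rsqr; rewrite <- (pow2_abs (sin _)) in H.
generalize (Rabs_pos (t - s)) (Rabs_pos (sin (PI * (t - s)))); intros A B.
assert (Rabs (sin (PI * (t - s))) <= 4 * Rabs (t - s)) by nra.
nra.
Qed.

Lemma zeta_chord_ge t s : Rabs (t - s) <= 1 / 2 -> 2 * Rabs (t - s) <= Cmod (zeta t - zeta s).
Proof.
intros Hts; assert (H := zeta_chord t s); assert (S := sin_PI_ge Hts).
apply Rsqr_incr_0_var; [|apply Cmod_ge_0].
unfold Rsqr; rewrite <- (pow2_abs (sin _)) in H.
generalize (Rabs_pos (t - s)); intros; nra.
Qed.

Lemma zeta_dist_ge z t : 1 - Cmod z <= Cmod (zeta t - z).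
Proof.
generalize (Cmod_triangle (zeta t - z) z); replace (zeta t - z + z)%C with (zeta t) by ring.
rewrite Cmod_zeta; lra.
Qed.

(** [zeta theta] is the point of the circle nearest to [r zeta theta], so the triangle inequality
    gives a chord [|zeta (theta + t) - zeta theta|] at most twice the distance on the right; the
    chord is at least [2 |t|]. *)
Lemma zeta_dist_angle r theta t : 0 <= r -> Rabs t <= 1 / 2 ->
  Rabs t <= Cmod (zeta (theta + t) - RtoC r * zeta theta).
Proof.
intros Hr Ht; pose (z := (RtoC r * zeta theta)%C); fold z.
assert (Hz : Cmod (zeta theta - z) <= Cmod (zeta (theta + t) - z)).
{ assert (M : Cmod z = r) by (unfold z; rewrite Cmod_mult, Cmod_R, Cmod_zeta, Rabs_right by lra; ring).
  replace (zeta theta - z)%C with (RtoC (1 - r) * zeta theta)%C by (unfold z; rewrite RtoC_minus; ring).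
  rewrite Cmod_mult, Cmod_R, Cmod_zeta, Rmult_1_r.
  destruct (Rle_dec r 1) as [H|H].
  - rewrite Rabs_right by lra; rewrite <- M; apply zeta_dist_ge.
  - rewrite Rabs_left by lra.
    generalize (Cmod_triangle (z - zeta (theta + t)) (zeta (theta + t))).
    replace (z - zeta (theta + t) + zeta (theta + t))%C with z by ring.
    rewrite M, Cmod_zeta.
    replace (z - zeta (theta + t))%C with (- (zeta (theta + t) - z))%C by ring.
    rewrite Cmod_opp; lra. }
assert (H2 : 2 * Rabs t <= Cmod (zeta (theta + t) - zeta theta)).
{ replace t with ((theta + t) - theta) at 1 by ring; apply zeta_chord_ge.
  replace (theta + t - theta) with t by ring; exact Ht. }
generalize (Cmod_triangle (zeta (theta + t) - z) (- (zeta theta - z))).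
replace (zeta (theta + t) - z + - (zeta theta - z))%C with (zeta (theta + t) - zeta theta)%C by ring.
rewrite Cmod_opp; lra.
Qed.

Lemma polar_form z : exists theta, z = (RtoC (Cmod z) * zeta theta)%C.
Proof.
destruct (Req_dec (Cmod z) 0) as [H|H].
- exists 0; rewrite H; rewrite (Cmod_eq_0 z H); ring.
- assert (P : 0 < Cmod z) by (generalize (Cmod_ge_0 z); lra).
  assert (Q := Cmod_sqr z).
  destruct z as [x y]; simpl fst in Q; simpl snd in Q; revert P Q; generalize (Cmod (x, y)); intros r P Q.
  pose (c := x / r).
  assert (Hc : -1 <= c <= 1).
  { unfold c; split; apply Rmult_le_reg_r with r; try lra; unfold Rdiv; rewrite Rmult_assoc, Rinv_l by lra; nra. }
  assert (C1 := cos_acos c Hc); assert (S1 := sin_acos c Hc).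
  assert (S2 : sqrt (1 - c²) = Rabs (y / r)).
  { rewrite <- sqrt_Rsqr_abs; f_equal; unfold Rsqr, c.
    replace (y / r * (y / r)) with (y ^ 2 / r ^ 2) by (field; lra).
    replace (y ^ 2) with (r ^ 2 - x ^ 2) by lra; field; lra. }
  rewrite S2 in S1.
  assert (P3 := PI_gt3).
  assert (X : forall phi, cos phi = c -> sin phi = y / r -> exists theta, (x, y) = (RtoC r * zeta theta)%C).
  { intros phi E1 E2; exists (phi / (2 * PI)); rewrite zetaE.
    replace (2 * PI * (phi / (2 * PI))) with phi by (field; lra).
    rewrite E1, E2; unfold Cmult, RtoC; simpl; f_equal; unfold c; field; lra. }
  destruct (Rle_dec 0 (y / r)) as [Hy|Hy].
  + apply (X (acos c)); [exact C1|rewrite S1, Rabs_right; lra].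
  + apply (X (- acos c)); [rewrite cos_neg; exact C1|].
    rewrite sin_neg, S1, Rabs_left; lra.
Qed.

(** * The Poisson kernel and its primitive *)

Lemma Rabs_fst_le (z : C) : Rabs (fst z) <= Cmod z.
Proof. eapply Rle_trans; [apply Rmax_l|apply Rmax_Cmod]. Qed.

Lemma Rabs_snd_le (z : C) : Rabs (snd z) <= Cmod z.
Proof. eapply Rle_trans; [apply Rmax_r|apply Rmax_Cmod]. Qed.

Lemma Cminus_fst (z w : C) : fst z - fst w = fst (z - w)%C.
Proof. destruct z, w; reflexivity. Qed.

Lemma Cminus_snd (z w : C) : snd z - snd w = snd (z - w)%C.
Proof. destruct z, w; reflexivity. Qed.

Lemma lipschitz_continuity (K : R -> R) L :
  (forall t s, Rabs (K t - K s) <= L * Rabs (t - s)) -> continuity K.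
Proof.
intros H x e He.
exists (e / (Rabs L + 1)); assert (A := Rabs_pos L); split.
- apply Rdiv_lt_0_compat; lra.
- intros y [_ Hy]; simpl in Hy |- *; unfold R_dist, Rdist in *.
  eapply Rle_lt_trans; [apply H|].
  apply Rle_lt_trans with (Rabs L * Rabs (y - x)).
  + apply Rmult_le_compat_r; [apply Rabs_pos|apply Rle_abs].
  + apply (Rmult_lt_compat_l (Rabs L + 1)) in Hy; [|lra].
    replace ((Rabs L + 1) * (e / (Rabs L + 1))) with e in Hy by (field; lra).
    generalize (Rabs_pos (y - x)); lra.
Qed.

Definition herglotz (z : C) (t : R) : C := ((zeta t + z) / (zeta t - z))%C.

Lemma zeta_sub_neq0 z t : in_disc z -> (zeta t - z <> 0)%C.
Proof.
intros Hz H; generalize (zeta_dist_ge z t); rewrite H, Cmod_0; unfold in_disc in Hz; lra.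
Qed.

Lemma poisson_herglotz z t : in_disc z -> poisson z t = fst (herglotz z t).
Proof.
intros Hz; assert (H := zeta_sub_neq0 (t := t) Hz).
assert (D := Cmod_sqr (zeta t - z)); assert (Z := Cmod_sqr (zeta t)); rewrite Cmod_zeta in Z.
assert (W := Cmod_sqr z).
assert (N : Cmod (zeta t - z) ^ 2 <> 0).
{ apply pow_nonzero; intros E; apply H; now apply Cmod_eq_0. }
unfold poisson; change (Cminus (zeta t) z) with (zeta t - z)%C.
unfold herglotz; rewrite D in N |- *; rewrite W.
destruct (zeta t) as [a b], z as [x y]; simpl in *.
replace (1 - (x * (x * 1) + y * (y * 1))) with ((a * (a * 1) + b * (b * 1)) - (x * (x * 1) + y * (y * 1))) by lra.
field; intros E; apply N; rewrite <- E; ring.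
Qed.

Lemma herglotz_sub w z t : in_disc w -> in_disc z ->
  (herglotz w t - herglotz z t = 2 * (w - z) * (zeta t / ((zeta t - w) * (zeta t - z))))%C.
Proof.
intros Hw Hz; assert (H1 := zeta_sub_neq0 (t := t) Hw); assert (H2 := zeta_sub_neq0 (t := t) Hz).
unfold herglotz; field; split; assumption.
Qed.

Lemma Cmod_div_le (a b : C) d : 0 < d -> d <= Cmod b -> Cmod (a / b) <= Cmod a / d.
Proof.
intros Hd Hb.
assert (b <> 0%C) by (intros ->; rewrite Cmod_0 in Hb; lra).
rewrite Cmod_div by assumption; unfold Rdiv; apply Rmult_le_compat_l; [apply Cmod_ge_0|].
apply Rinv_le_contravar; assumption.
Qed.

Lemma Cmod_mult3_ge (a b c : C) d : 0 < d -> d <= Cmod a -> d <= Cmod b -> d <= Cmod c ->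
  d ^ 3 <= Cmod (a * b * c).
Proof.
intros Hd Ha Hb Hc; rewrite !Cmod_mult.
replace (d ^ 3) with (d * d * d) by ring.
apply Rmult_le_compat; try nra; apply Rmult_le_compat; lra.
Qed.

(** Twice this kernel is the divided difference in [z] of the Herglotz kernel, and its derivative
    when [w = z]; both cases are used. The identity [E] extracts [zeta t - zeta s] and leaves two
    fractions with three factors of size at least [d] in the denominator. *)
Lemma cauchy_kernel_lipschitz (w z : C) t s d : Cmod w <= 1 -> 0 < d ->
  d <= Cmod (zeta t - w) -> d <= Cmod (zeta t - z) ->
  d <= Cmod (zeta s - w) -> d <= Cmod (zeta s - z) ->
  Cmod (zeta t / ((zeta t - w) * (zeta t - z)) - zeta s / ((zeta s - w) * (zeta s - z))) <=
    16 * Rabs (t - s) / d ^ 3.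
Proof.
intros Hw Hd H1 H2 H3 H4.
assert (N : forall u : C, d <= Cmod u -> u <> 0%C).
{ intros u Hu ->; rewrite Cmod_0 in Hu; lra. }
assert (N1 := N _ H1); assert (N2 := N _ H2); assert (N3 := N _ H3); assert (N4 := N _ H4).
assert (E : (zeta t / ((zeta t - w) * (zeta t - z)) - zeta s / ((zeta s - w) * (zeta s - z)) =
  - (zeta t - zeta s) * (w / ((zeta t - w) * (zeta s - w) * (zeta s - z)) +
      zeta t / ((zeta t - w) * (zeta t - z) * (zeta s - z))))%C).
{ field; repeat split; assumption. }
rewrite E, Cmod_mult, Cmod_opp.
assert (P3 : 0 < d ^ 3) by (apply pow_lt; lra).
assert (B1 : Cmod (w / ((zeta t - w) * (zeta s - w) * (zeta s - z))) <= 1 / d ^ 3).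
{ eapply Rle_trans; [apply (@Cmod_div_le _ _ (d ^ 3)); [lra|now apply Cmod_mult3_ge]|].
  apply Rmult_le_compat_r; [left; now apply Rinv_0_lt_compat|exact Hw]. }
assert (B2 : Cmod (zeta t / ((zeta t - w) * (zeta t - z) * (zeta s - z))) <= 1 / d ^ 3).
{ eapply Rle_trans; [apply (@Cmod_div_le _ _ (d ^ 3)); [lra|now apply Cmod_mult3_ge]|].
  rewrite Cmod_zeta; lra. }
assert (B3 := zeta_chord_le t s).
replace (16 * Rabs (t - s) / d ^ 3) with (8 * Rabs (t - s) * (1 / d ^ 3 + 1 / d ^ 3)) by (field; lra).
apply Rmult_le_compat; try apply Cmod_ge_0; [exact B3|].
eapply Rle_trans; [apply Cmod_triangle|]; lra.
Qed.

Lemma poisson_pos z t : in_disc z -> 0 <= poisson z t.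
Proof.
intros Hz; unfold poisson; generalize (Cmod_ge_0 z); unfold in_disc in Hz; intros.
apply Rmult_le_pos; [nra|]; left; apply Rinv_0_lt_compat, pow_lt.
change (0 < Cmod (zeta t - z)); generalize (zeta_dist_ge z t); lra.
Qed.

Lemma poisson_le z t d : in_disc z -> 0 < d -> d <= Cmod (zeta t - z) ->
  poisson z t <= 2 * (1 - Cmod z) / d ^ 2.
Proof.
intros Hz Hd H; unfold poisson; change (Cminus (zeta t) z) with (zeta t - z)%C.
generalize (Cmod_ge_0 z); unfold in_disc in Hz; intros.
apply Rmult_le_compat; [nra| |nra|].
- left; apply Rinv_0_lt_compat, pow_lt; lra.
- apply Rinv_le_contravar; [apply pow_lt; lra|]; apply pow_incr; lra.
Qed.

(** The factor [1 - Cmod z], which a bound through the Herglotz kernel would lose, is kept by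
    working with the two distances directly; [32 = 2 * 8 * 2]. *)
Lemma poisson_lipschitz z t s d : in_disc z -> 0 < d ->
  d <= Cmod (zeta t - z) -> d <= Cmod (zeta s - z) ->
  Rabs (poisson z t - poisson z s) <= 32 * (1 - Cmod z) * Rabs (t - s) / d ^ 3.
Proof.
intros Hz Hd H1 H2; unfold poisson.
change (Cminus (zeta t) z) with (zeta t - z)%C; change (Cminus (zeta s) z) with (zeta s - z)%C.
assert (B3 := zeta_chord_le t s).
assert (B4 : Rabs (Cmod (zeta s - z) - Cmod (zeta t - z)) <= Cmod (zeta t - zeta s)).
{ apply Rabs_le; split.
  - generalize (Cmod_triangle (zeta t - zeta s) (zeta s - z)).
    replace (zeta t - zeta s + (zeta s - z))%C with (zeta t - z)%C by ring; lra.
  - generalize (Cmod_triangle (- (zeta t - zeta s)) (zeta t - z)).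
    replace (- (zeta t - zeta s) + (zeta t - z))%C with (zeta s - z)%C by ring; rewrite Cmod_opp; lra. }
unfold in_disc in Hz; assert (Z := Cmod_ge_0 z).
revert H1 H2 B4; generalize (Cmod (zeta t - z)) (Cmod (zeta s - z)); intros a b H1 H2 B4.
replace ((1 - Cmod z ^ 2) / a ^ 2 - (1 - Cmod z ^ 2) / b ^ 2) with
  ((1 - Cmod z ^ 2) * (b - a) * (/ a * (/ b * / b) + / b * (/ a * / a))) by (field; lra).
assert (Ia : 0 < / a <= / d) by (split; [apply Rinv_0_lt_compat; lra|apply Rinv_le_contravar; lra]).
assert (Ib : 0 < / b <= / d) by (split; [apply Rinv_0_lt_compat; lra|apply Rinv_le_contravar; lra]).
rewrite !Rabs_mult.
replace (32 * (1 - Cmod z) * Rabs (t - s) / d ^ 3) with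
  (2 * (1 - Cmod z) * (8 * Rabs (t - s)) * (/ d * (/ d * / d) + / d * (/ d * / d))) by (field; lra).
assert (M : forall p q r v, 0 < p <= v -> 0 < q <= v -> 0 < r <= v -> 0 < p * (q * r) <= v * (v * v)).
{ intros; assert (0 < q * r <= v * v) by (split; [nra|apply Rmult_le_compat; lra]).
  split; [apply Rmult_lt_0_compat; lra|apply Rmult_le_compat; lra]. }
assert (M1 := M _ _ _ _ Ia Ib Ib); assert (M2 := M _ _ _ _ Ib Ia Ia).
apply Rmult_le_compat.
- apply Rmult_le_pos; apply Rabs_pos.
- apply Rabs_pos.
- apply Rmult_le_compat; try apply Rabs_pos; [rewrite Rabs_right; nra|lra].
- rewrite Rabs_right; lra.
Qed.

Lemma near_dist_ge w z t : Cmod (w - z) <= (1 - Cmod z) / 2 ->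
  Cmod (zeta t - z) / 2 <= Cmod (zeta t - w).
Proof.
intros H; generalize (zeta_dist_ge z t) (Cmod_triangle (zeta t - w) (w - z)).
replace (zeta t - w + (w - z))%C with (zeta t - z)%C by ring; lra.
Qed.

Lemma near_in_disc w z : in_disc z -> Cmod (w - z) <= (1 - Cmod z) / 2 -> in_disc w.
Proof.
unfold in_disc; intros Hz H; generalize (Cmod_triangle (w - z) z).
replace (w - z + z)%C with w by ring; lra.
Qed.

Lemma poisson_diff_lipschitz w z t s d : in_disc z -> 0 < d ->
  Cmod (w - z) <= (1 - Cmod z) / 2 ->
  d <= Cmod (zeta t - z) -> d <= Cmod (zeta s - z) ->
  Rabs ((poisson w t - poisson z t) - (poisson w s - poisson z s)) <=
    256 * Cmod (w - z) * Rabs (t - s) / d ^ 3.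
Proof.
intros Hz Hd Hw H1 H2; assert (Hwd := near_in_disc Hz Hw).
assert (G1 := near_dist_ge t Hw); assert (G2 := near_dist_ge s Hw).
rewrite !poisson_herglotz by assumption.
rewrite !Cminus_fst, !herglotz_sub by assumption.
eapply Rle_trans; [apply Rabs_fst_le|].
match goal with |- Cmod ?X <= _ => replace X with
  (2 * (w - z) * (zeta t / ((zeta t - w) * (zeta t - z)) - zeta s / ((zeta s - w) * (zeta s - z))))%C by ring end.
rewrite !Cmod_mult.
assert (E2 : Cmod 2 = 2) by (change (RtoC 2) with (RtoC 2); rewrite Cmod_R, Rabs_right; lra).
rewrite E2.
assert (L := @cauchy_kernel_lipschitz w z t s (d / 2)).
replace (256 * Cmod (w - z) * Rabs (t - s) / d ^ 3) with
  (2 * Cmod (w - z) * (16 * Rabs (t - s) / (d / 2) ^ 3)) by (field; lra).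
apply Rmult_le_compat_l; [generalize (Cmod_ge_0 (w - z)); lra|].
apply L; unfold in_disc in Hwd; lra.
Qed.

Lemma poisson_diff_le w z t d : in_disc z -> 0 < d -> Cmod (w - z) <= (1 - Cmod z) / 2 ->
  d <= Cmod (zeta t - z) ->
  Rabs (poisson w t - poisson z t) <= 4 * Cmod (w - z) / d ^ 2.
Proof.
intros Hz Hd Hw H1; assert (Hwd := near_in_disc Hz Hw).
assert (G1 := near_dist_ge t Hw).
rewrite !poisson_herglotz by assumption.
rewrite !Cminus_fst, !herglotz_sub by assumption.
eapply Rle_trans; [apply Rabs_fst_le|].
rewrite !Cmod_mult.
assert (E2 : Cmod 2 = 2) by (rewrite Cmod_R, Rabs_right; lra).
rewrite E2.
replace (4 * Cmod (w - z) / d ^ 2) with (2 * Cmod (w - z) * (1 / (d / 2 * d))) by (field; lra).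
apply Rmult_le_compat_l; [generalize (Cmod_ge_0 (w - z)); lra|].
eapply Rle_trans; [apply (@Cmod_div_le _ _ (d / 2 * d)); [nra|]|rewrite Cmod_zeta; lra].
rewrite Cmod_mult; apply Rmult_le_compat; lra.
Qed.

(** This is [- arg (1 - r e^(i phi))], the principal value being correct because the real part is
    positive for [0 <= r < 1]. Its derivatives in [phi] and in [r] yield the Poisson kernel and the
    conjugate kernel. *)
Definition poisson_arg (r phi : R) : R := atan (r * sin phi / (1 - r * cos phi)).

Lemma arg_denom_pos r phi : 0 <= r < 1 -> 0 < 1 - r * cos phi.
Proof. intros Hr; generalize (COS_bound phi); intros; nra. Qed.

Lemma dist_sqr_polar r theta t :
  Cmod (zeta t - RtoC r * zeta theta) ^ 2 = 1 - 2 * r * cos (2 * PI * (t - theta)) + r ^ 2.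
Proof.
rewrite Cmod_sqr, !zetaE; simpl fst; simpl snd.
replace (2 * PI * (t - theta)) with (2 * PI * t - 2 * PI * theta) by ring; rewrite cos_minus.
generalize (sin2_cos2 (2 * PI * t)) (sin2_cos2 (2 * PI * theta)); unfold Rsqr; intros A B; nra.
Qed.

Lemma arg_denom2_pos r phi : 0 <= r < 1 -> 0 < 1 - 2 * r * cos phi + r ^ 2.
Proof. intros Hr; generalize (COS_bound phi); intros; nra. Qed.

Lemma is_derive_arg_phi r phi : 0 <= r < 1 ->
  derivable_pt_lim (poisson_arg r) phi ((r * cos phi - r ^ 2) / (1 - 2 * r * cos phi + r ^ 2)).
Proof.
intros Hr; assert (H := arg_denom_pos phi Hr); assert (H2 := arg_denom2_pos phi Hr).
apply is_derive_Reals; unfold poisson_arg.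
auto_derive; [lra|].
assert (S := sin2_cos2 phi); unfold Rsqr in S.
assert (E : 1 - 2 * r * cos phi + r ^ 2 = (1 - r * cos phi) ^ 2 + (r * sin phi) ^ 2) by nra.
assert (E2 : r * cos phi - r ^ 2 = r * cos phi * (1 - r * cos phi) - (r * sin phi) ^ 2) by nra.
rewrite E in H2 |- *; rewrite E2; field; split; [nra|lra].
Qed.

Lemma is_derive_arg_r r phi : 0 <= r < 1 ->
  derivable_pt_lim (fun x => poisson_arg x phi) r (sin phi / (1 - 2 * r * cos phi + r ^ 2)).
Proof.
intros Hr; assert (H := arg_denom_pos phi Hr); assert (H2 := arg_denom2_pos phi Hr).
apply is_derive_Reals; unfold poisson_arg.
auto_derive; [lra|].
assert (S := sin2_cos2 phi); unfold Rsqr in S.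
assert (E : 1 - 2 * r * cos phi + r ^ 2 = (1 - r * cos phi) ^ 2 + (r * sin phi) ^ 2) by nra.
rewrite E in H2 |- *; field; split; [nra|lra].
Qed.

Lemma in_disc_polar r theta : 0 <= r < 1 -> in_disc (RtoC r * zeta theta).
Proof.
intros Hr; unfold in_disc; rewrite Cmod_mult, Cmod_R, Cmod_zeta, Rabs_right by lra; lra.
Qed.

Lemma Cmod_polar r theta : 0 <= r -> Cmod (RtoC r * zeta theta) = r.
Proof. intros Hr; rewrite Cmod_mult, Cmod_R, Cmod_zeta, Rabs_right by lra; ring. Qed.

Lemma poisson_polar r theta t : 0 <= r < 1 ->
  poisson (RtoC r * zeta theta) t =
  1 + 2 * ((r * cos (2 * PI * (t - theta)) - r ^ 2) / (1 - 2 * r * cos (2 * PI * (t - theta)) + r ^ 2)).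
Proof.
intros Hr; unfold poisson.
change (Cminus (zeta t) (RtoC r * zeta theta)) with (zeta t - RtoC r * zeta theta)%C.
rewrite dist_sqr_polar, Cmod_polar by lra.
generalize (arg_denom2_pos (2 * PI * (t - theta)) Hr); intros; field; lra.
Qed.

Definition poisson_primitive (r theta t : R) : R :=
  t + poisson_arg r (2 * PI * (t - theta)) / PI.

Lemma poisson_primitive_derive r theta t : 0 <= r < 1 ->
  derivable_pt_lim (poisson_primitive r theta) t (poisson (RtoC r * zeta theta) t).
Proof.
intros Hr; rewrite poisson_polar by exact Hr.
assert (P := PI_gt3); apply is_derive_Reals; unfold poisson_primitive.
assert (D := is_derive_arg_phi (2 * PI * (t - theta)) Hr); apply is_derive_Reals in D.
revert D; generalize ((r * cos (2 * PI * (t - theta)) - r ^ 2) / (1 - 2 * r * cos (2 * PI * (t - theta)) + r ^ 2)); intros l D.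
replace (1 + 2 * l) with (1 + / PI * (2 * PI * l)) by (field; lra).
apply (is_derive_plus (V := R_NormedModule)); [apply (@is_derive_id R_AbsRing)|].
apply (is_derive_ext (fun s => / PI * poisson_arg r (2 * PI * (s - theta)))).
{ intros s; unfold Rdiv; apply Rmult_comm. }
apply is_derive_scal.
apply (is_derive_comp (poisson_arg r) (fun s => 2 * PI * (s - theta))); [exact D|].
auto_derive; [exact I|ring].
Qed.

Lemma poisson_arg_period r phi : poisson_arg r (phi + 2 * PI) = poisson_arg r phi.
Proof.
unfold poisson_arg; assert (S := sin_period phi 1); assert (C := cos_period phi 1).
simpl INR in S, C; rewrite Rmult_1_r in S, C; rewrite S, C; reflexivity.
Qed.

(** Only the linear term of the primitive survives a full period. This mean value 1 makes [a] the
    main term when the Poisson kernel is tested, and cancels the main term for a difference of two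
    such kernels. *)
Lemma poisson_primitive_mean r theta b :
  poisson_primitive r theta (b + 1 / 2) - poisson_primitive r theta (b - 1 / 2) = 1.
Proof.
unfold poisson_primitive.
replace (2 * PI * (b + 1 / 2 - theta)) with (2 * PI * (b - 1 / 2 - theta) + 2 * PI) by field.
rewrite poisson_arg_period; field; apply PI_neq0.
Qed.

(** * From the arc condition to the Poisson integral *)

Lemma dyadic_scale d : 0 < d <= 1 -> exists p, / 2 ^ (S p) <= d <= 2 * / 2 ^ (S p).
Proof.
intros Hd.
assert (P2 : forall i, 0 < 2 ^ i) by (intros i; apply pow_lt; lra).
assert (H : forall n, / 2 ^ n <= d -> exists p, / 2 ^ (S p) <= d <= 2 * / 2 ^ (S p)).
{ induction n as [|n IH]; intros Hn.
  - simpl in Hn; rewrite Rinv_1 in Hn; exists O; simpl; lra.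
  - destruct (Rle_dec (/ 2 ^ n) d) as [L|L]; [now apply IH|].
    exists n; split; [exact Hn|].
    replace (2 * / 2 ^ S n) with (/ 2 ^ n) by (simpl; field; apply Rgt_not_eq, P2); lra. }
destruct (@pow_lt_1_zero (/ 2)) with (y := d) as [n Hn]; [rewrite Rabs_right; lra|lra|].
apply (H n); specialize (Hn n (le_n n)).
rewrite Rabs_right, pow_inv in Hn by (apply Rle_ge, pow_le; lra); lra.
Qed.

Section HarmonicExtension.
Variable nu : circ_measure.
Hypothesis nu_fin : (nu I01 < +oo)%E.
Let m := arc_measure nu.

Definition pois (z : C) : R := cint nu (poisson z).

Lemma cint_sub f g : continuity f -> continuity g ->
  cint nu (fun t => f t - g t) = cint nu f - cint nu g.
Proof.
intros Hf Hg.
rewrite (@cint_ext nu (fun t => f t - g t) (fun t => f t + (-1) * g t)) by (intros; ring).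
rewrite cint_add, cint_scal; try exact nu_fin; try exact Hg; try exact Hf; [ring|].
apply (continuity_scal g (-1)); exact Hg.
Qed.

Lemma poisson_cont z : in_disc z -> continuity (poisson z).
Proof.
intros Hz; assert (D : 0 < 1 - Cmod z) by (unfold in_disc in Hz; lra).
apply (@lipschitz_continuity _ (32 * (1 - Cmod z) / (1 - Cmod z) ^ 3)); intros t s.
eapply Rle_trans; [apply (poisson_lipschitz Hz D); apply zeta_dist_ge|].
right; field; lra.
Qed.

Lemma pois_ge0 z : in_disc z -> 0 <= pois z.
Proof.
intros Hz; assert (H := @cint_atom nu nu_fin (poisson z) 0 (poisson_cont Hz)).
eapply Rle_trans; [|apply H; [split; lra|intros; now apply poisson_pos]].
apply Rmult_le_pos; [now apply poisson_pos|apply fine_measure_ge0].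
Qed.

Lemma poisson_period z t : poisson z (t + 1) = poisson z t.
Proof. unfold poisson; now rewrite zeta_1. Qed.

Section ArcCondition.
Variable C : R.
Hypothesis C_gt0 : 0 < C.
Hypothesis m_fwd : forall x l, 0 < l <= 1 / 2 ->
  Rabs (m x l / l - m (x + l) l / l) <= C * exp (- (m x l / l)).
Hypothesis m_bwd : forall x l, 0 < l <= 1 / 2 ->
  Rabs (m (x + l) l / l - m x l / l) <= C * exp (- (m (x + l) l / l)).

Lemma weight_le_exp a : weight C a <= exp (- a).
Proof.
rewrite exp_Ropp; apply Rinv_le_contravar; [apply exp_pos|lra].
Qed.

(** [a] is the average over the arc starting at the angle of [z] with dyadic length between
    [(1 - Cmod z) / 2] and [1 - Cmod z]. The kernel test runs with [kap = 32 (1 - r)] for the value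
    and [kap = 256 Cmod (w - z)] for the increments. In the first estimate the weight is merely
    bounded by 1, which suffices to exchange [exp (- a)] for [exp (- pois z)] afterwards. *)
Lemma pois_test z : in_disc z -> exists a, 0 <= a /\
  Rabs (pois z - a) <= 8960 * dev_const C /\
  forall w, Cmod (w - z) <= (1 - Cmod z) / 2 ->
    Rabs (pois w - pois z) <= 71680 * dev_const C * Cmod (w - z) * exp (- a) / (1 - Cmod z).
Proof.
intros Hz; destruct (polar_form z) as [theta Ez].
assert (Z0 := Cmod_ge_0 z); assert (Z1 := Hz); unfold in_disc in Z1.
pose (r := Cmod z); assert (Hr : 0 <= r < 1) by (unfold r; lra).
fold r in Ez |- *.
destruct (@dyadic_scale (1 - r)) as [p Hp]; [lra|].
pose (L0 := / 2 ^ S p); fold L0 in Hp.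
assert (HL0 : 0 < L0) by (apply Rinv_0_lt_compat, pow_lt; lra).
pose (a := avg m theta L0).
assert (a0 : 0 <= a) by (apply avg_ge0; [apply arc_measure_ge0|exact HL0]).
assert (Q := dev_const_gt0 C_gt0).
assert (W := weight_gt0 C_gt0 a).
assert (We := weight_le_exp a).
assert (D1 : forall t, L0 <= Cmod (zeta t - z)).
{ intros t; generalize (zeta_dist_ge z t); fold r; lra. }
assert (D2 : forall t, Rabs t <= 1 / 2 -> Rabs t <= Cmod (zeta (theta + t) - z)).
{ intros t Ht; rewrite Ez; apply zeta_dist_angle; [lra|exact Ht]. }
assert (D3 : 1 / 2 <= Cmod (zeta (theta + 1 / 2) - z)).
{ rewrite <- (Rabs_right (1 / 2)) at 1 by lra; apply D2; rewrite Rabs_right; lra. }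
exists a; split; [exact a0|split].
- assert (K := @kernel_test nu C nu_fin C_gt0 m_fwd m_bwd (poisson z) (poisson_primitive r theta) theta p (32 * (1 - r))).
  cbv zeta beta in K; fold L0 m in K; fold a in K.
  rewrite poisson_primitive_mean, Rmult_1_r in K.
  eapply Rle_trans; [apply K|].
  + lra.
  + now apply poisson_cont.
  + apply poisson_period.
  + intros t; rewrite Ez; now apply poisson_primitive_derive.
  + intros t s; unfold r; now apply poisson_lipschitz.
  + intros q t s Hq Ht Hs.
    replace (t - s) with (theta + t - (theta + s)) by ring.
    unfold r; apply poisson_lipschitz; auto.
    * eapply Rle_trans; [apply Ht|apply D2; lra].
    * eapply Rle_trans; [apply Hs|apply D2; lra].
  + rewrite Rabs_right by now apply Rle_ge, poisson_pos.
    eapply Rle_trans; [apply (@poisson_le z _ (1 / 2) Hz); [lra|exact D3]|].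
    fold r; unfold Rdiv; simpl; lra.
  + assert (W1 : weight C a <= 1).
    { eapply Rle_trans; [exact We|]; rewrite <- exp_0.
      destruct a0 as [a0|<-]; [left; apply exp_increasing; lra|rewrite Ropp_0; lra]. }
    assert (H1 : (1 - r) / L0 <= 2).
    { apply Rmult_le_reg_r with L0; [lra|]; unfold Rdiv; rewrite Rmult_assoc, Rinv_l; lra. }
    assert (H0 : 0 <= (1 - r) / L0) by (apply Rmult_le_pos; [lra|left; now apply Rinv_0_lt_compat]).
    replace (140 * dev_const C * (32 * (1 - r)) * weight C a / L0) with
      (4480 * dev_const C * ((1 - r) / L0 * weight C a)) by (field; lra).
    replace (8960 * dev_const C) with (4480 * dev_const C * (2 * 1)) by ring.
    apply Rmult_le_compat_l; [lra|]; apply Rmult_le_compat; lra.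
- intros w Hw.
  assert (Hwd := near_in_disc Hz Hw).
  destruct (polar_form w) as [theta' Ew].
  assert (W0 := Cmod_ge_0 w); assert (Hr' : 0 <= Cmod w < 1) by (unfold in_disc in Hwd; lra).
  assert (M0 := Cmod_ge_0 (w - z)).
  assert (K := @kernel_test nu C nu_fin C_gt0 m_fwd m_bwd (fun t => poisson w t - poisson z t)
    (fun t => poisson_primitive (Cmod w) theta' t - poisson_primitive r theta t) theta p (256 * Cmod (w - z))).
  cbv zeta beta in K; fold L0 m in K; fold a in K.
  replace (poisson_primitive (Cmod w) theta' (theta + 1 / 2) - poisson_primitive r theta (theta + 1 / 2) -
    (poisson_primitive (Cmod w) theta' (theta - 1 / 2) - poisson_primitive r theta (theta - 1 / 2))) with 0 in K.
  2:{ generalize (poisson_primitive_mean (Cmod w) theta' theta) (poisson_primitive_mean r theta theta); lra. }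
  rewrite Rmult_0_r, Rminus_0_r, cint_sub in K by now apply poisson_cont.
  eapply Rle_trans; [apply K|].
  + lra.
  + apply continuity_minus; now apply poisson_cont.
  + intros t; now rewrite !poisson_period.
  + intros t; apply derivable_pt_lim_minus; [rewrite Ew at 2|rewrite Ez]; now apply poisson_primitive_derive.
  + intros t s; now apply poisson_diff_lipschitz.
  + intros q t s Hq Ht Hs.
    replace (t - s) with (theta + t - (theta + s)) by ring.
    apply poisson_diff_lipschitz; auto.
    * eapply Rle_trans; [apply Ht|apply D2; lra].
    * eapply Rle_trans; [apply Hs|apply D2; lra].
  + eapply Rle_trans; [apply (@poisson_diff_le w z _ (1 / 2) Hz); [lra|exact Hw|exact D3]|].
    unfold Rdiv; simpl; lra.
  + assert (H1 : / L0 <= 2 / (1 - r)).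
    { replace (2 / (1 - r)) with (/ ((1 - r) / 2)) by (field; lra).
      apply Rinv_le_contravar; lra. }
    assert (H0 : 0 < / L0) by now apply Rinv_0_lt_compat.
    replace (140 * dev_const C * (256 * Cmod (w - z)) * weight C a / L0) with
      (35840 * dev_const C * Cmod (w - z) * (weight C a * / L0)) by (field; lra).
    replace (71680 * dev_const C * Cmod (w - z) * exp (- a) / (1 - r)) with
      (35840 * dev_const C * Cmod (w - z) * (exp (- a) * (2 / (1 - r)))) by (field; lra).
    apply Rmult_le_compat_l; [apply Rmult_le_pos; lra|]; apply Rmult_le_compat; lra.
Qed.

Lemma pois_lipschitz : exists A, 0 < A /\ forall z w, in_disc z -> Cmod (w - z) <= (1 - Cmod z) / 2 ->
  Rabs (pois w - pois z) <= A * Cmod (w - z) * exp (- pois z) / (1 - Cmod z).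
Proof.
assert (Q := dev_const_gt0 C_gt0).
exists (71680 * dev_const C * exp (8960 * dev_const C)); split.
{ apply Rmult_lt_0_compat; [lra|apply exp_pos]. }
intros z w Hz Hw; destruct (pois_test Hz) as (a & Ha & H1 & H2).
eapply Rle_trans; [now apply H2|].
assert (E : exp (- a) <= exp (8960 * dev_const C) * exp (- pois z)).
{ rewrite <- exp_plus; apply Rabs_le_between in H1.
  destruct (Req_dec (- a) (8960 * dev_const C + - pois z)) as [->|N]; [lra|].
  left; apply exp_increasing; lra. }
assert (D : 0 < 1 - Cmod z) by (unfold in_disc in Hz; lra).
replace (71680 * dev_const C * exp (8960 * dev_const C) * Cmod (w - z) * exp (- pois z) / (1 - Cmod z)) with
  (71680 * dev_const C * Cmod (w - z) * (exp (8960 * dev_const C) * exp (- pois z)) / (1 - Cmod z)) by (field; lra).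
unfold Rdiv; apply Rmult_le_compat_r; [left; now apply Rinv_0_lt_compat|].
apply Rmult_le_compat_l; [|exact E].
apply Rmult_le_pos; [lra|apply Cmod_ge_0].
Qed.
End ArcCondition.
End HarmonicExtension.

(** * The Herglotz integral and complex derivatives *)

Lemma derivable_pt_lim_quad (f : R -> R) x l d B : 0 < d ->
  (forall h, Rabs h < d -> Rabs (f (x + h) - f x - h * l) <= B * h ^ 2) ->
  derivable_pt_lim f x l.
Proof.
intros Hd H e He.
assert (A := Rabs_pos B).
assert (P : 0 < Rmin d (e / (Rabs B + 1))).
{ apply Rmin_pos; [exact Hd|]; apply Rdiv_lt_0_compat; lra. }
exists (mkposreal _ P); simpl; intros h Hh Hh2.
assert (H1 := Rlt_le_trans _ _ _ Hh2 (Rmin_l _ _)).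
assert (H2 := Rlt_le_trans _ _ _ Hh2 (Rmin_r _ _)).
assert (Ph : 0 < Rabs h) by now apply Rabs_pos_lt.
replace ((f (x + h) - f x) / h - l) with ((f (x + h) - f x - h * l) / h) by (field; exact Hh).
unfold Rdiv; rewrite Rabs_mult, Rabs_inv.
apply Rmult_lt_reg_r with (Rabs h); [exact Ph|].
rewrite Rmult_assoc, Rinv_l, Rmult_1_r by lra.
eapply Rle_lt_trans; [now apply H|].
rewrite <- (pow2_abs h).
apply (Rmult_lt_compat_l (Rabs B + 1)) in H2; [|lra].
replace ((Rabs B + 1) * (e / (Rabs B + 1))) with e in H2 by (field; lra).
generalize (Rle_abs B); intros; nra.
Qed.

Lemma cderive_eps (f : C -> C) z l :
  Coquelicot.Derive.is_derive (K := C_AbsRing) (V := C_NormedModule) f z l <->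
  forall e, 0 < e -> exists d, 0 < d /\ forall y, Cmod (y - z) < d ->
    Cmod (f y - f z - (y - z) * l) <= e * Cmod (y - z).
Proof.
split.
- intros [_ H] e He.
  destruct (H z (fun P HP => HP) (mkposreal e He)) as [d Hd].
  exists d; split; [apply cond_pos|]; intros y Hy; exact (Hd y Hy).
- intros H; split; [apply is_linear_scal_l|].
  intros x Hx e.
  assert (E : x = z) by (symmetry; apply (is_filter_lim_locally_unique (K := C_AbsRing) (V := AbsRing_NormedModule C_AbsRing)); exact Hx).
  rewrite E; destruct (H e (cond_pos e)) as (d & Hd & Hy).
  exists (mkposreal d Hd); intros y Hyd; exact (Hy y Hyd).
Qed.

Lemma cderive_inv (f : C -> C) z l : f z <> 0%C ->
  Coquelicot.Derive.is_derive (K := C_AbsRing) (V := C_NormedModule) f z l ->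
  Coquelicot.Derive.is_derive (K := C_AbsRing) (V := C_NormedModule) (fun w => Cinv (f w)) z (- l / (f z * f z))%C.
Proof.
intros Hf H; rewrite cderive_eps in H |- *; intros e He.
assert (Pa : 0 < Cmod (f z)) by now apply Cmod_gt_0.
pose (a := Cmod (f z)); fold a in Pa.
assert (L0 := Cmod_ge_0 l).
destruct (H 1 Rlt_0_1) as (d1 & Hd1 & H1).
destruct (H (e * a ^ 2 / 2)) as (d2 & Hd2 & H2).
{ apply Rdiv_lt_0_compat; [apply Rmult_lt_0_compat; [exact He|apply pow_lt; exact Pa]|lra]. }
(* [b] bounds the difference quotients of [f]. Within [d3] this keeps [Cmod (f y) >= a / 2], and
   within [d4] it makes the quadratic remainder at most [e / 2] times the increment. *)
pose (b := Cmod l + 1); assert (Hb : 0 < b) by (unfold b; lra).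
pose (d3 := a / 2 / b); assert (Hd3 : 0 < d3) by (repeat apply Rdiv_lt_0_compat; lra).
pose (d4 := e * a ^ 3 / (4 * b ^ 2)).
assert (Hd4 : 0 < d4).
{ apply Rdiv_lt_0_compat; [apply Rmult_lt_0_compat; [exact He|apply pow_lt; exact Pa]|].
  apply Rmult_lt_0_compat; [lra|apply pow_lt; exact Hb]. }
exists (Rmin (Rmin d1 d2) (Rmin d3 d4)); split.
{ repeat apply Rmin_pos; assumption. }
intros y Hy.
assert (Y1 : Cmod (y - z) < d1) by (eapply Rlt_le_trans; [exact Hy|]; eapply Rle_trans; [apply Rmin_l|apply Rmin_l]).
assert (Y2 : Cmod (y - z) < d2) by (eapply Rlt_le_trans; [exact Hy|]; eapply Rle_trans; [apply Rmin_l|apply Rmin_r]).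
assert (Y3 : Cmod (y - z) < d3) by (eapply Rlt_le_trans; [exact Hy|]; eapply Rle_trans; [apply Rmin_r|apply Rmin_l]).
assert (Y4 : Cmod (y - z) < d4) by (eapply Rlt_le_trans; [exact Hy|]; eapply Rle_trans; [apply Rmin_r|apply Rmin_r]).
assert (Y0 := Cmod_ge_0 (y - z)).
assert (B1 := H1 y Y1); assert (B2 := H2 y Y2).
assert (B3 : Cmod (f y - f z) <= b * Cmod (y - z)).
{ generalize (Cmod_triangle (f y - f z - (y - z) * l) ((y - z) * l)).
  replace (f y - f z - (y - z) * l + (y - z) * l)%C with (f y - f z)%C by ring.
  rewrite Cmod_mult; unfold b; lra. }
assert (B4 : a / 2 <= Cmod (f y)).
{ assert (b * Cmod (y - z) <= a / 2).
  { apply (Rmult_lt_compat_l b) in Y3; [|exact Hb].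
    replace (b * d3) with (a / 2) in Y3 by (unfold d3; field; lra); lra. }
  generalize (Cmod_triangle (f y) (- (f y - f z))).
  replace (f y + - (f y - f z))%C with (f z) by ring; rewrite Cmod_opp; fold a; lra. }
assert (Ny : f y <> 0%C) by (intros E; rewrite E, Cmod_0 in B4; lra).
replace (/ f y - / f z - (y - z) * (- l / (f z * f z)))%C with
  (- (f y - f z - (y - z) * l) / (f z * f z) + (f y - f z) * (f y - f z) / (f z * f z * f y))%C
  by (field; split; assumption).
eapply Rle_trans; [apply Cmod_triangle|].
assert (C1 : Cmod (- (f y - f z - (y - z) * l) / (f z * f z)) <= e / 2 * Cmod (y - z)).
{ eapply Rle_trans; [apply (@Cmod_div_le _ _ (a ^ 2)); [apply pow_lt; exact Pa|rewrite Cmod_mult; fold a; right; ring]|].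
  rewrite Cmod_opp; apply Rmult_le_reg_r with (a ^ 2); [apply pow_lt; exact Pa|].
  unfold Rdiv at 1; rewrite Rmult_assoc, Rinv_l, Rmult_1_r by (apply pow_nonzero; lra); lra. }
assert (C2 : Cmod ((f y - f z) * (f y - f z) / (f z * f z * f y)) <= e / 2 * Cmod (y - z)).
{ eapply Rle_trans; [apply (@Cmod_div_le _ _ (a * a * (a / 2)))|].
  - apply Rmult_lt_0_compat; [nra|lra].
  - rewrite !Cmod_mult; fold a; apply Rmult_le_compat_l; [nra|exact B4].
  - rewrite Cmod_mult.
    apply Rmult_le_reg_r with (a * a * (a / 2)); [apply Rmult_lt_0_compat; [nra|lra]|].
    unfold Rdiv at 1; rewrite Rmult_assoc, Rinv_l, Rmult_1_r.
    2:{ apply Rgt_not_eq, Rmult_lt_0_compat; [nra|lra]. }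
    assert (Cmod (f y - f z) * Cmod (f y - f z) <= (b * Cmod (y - z)) * (b * Cmod (y - z))).
    { apply Rmult_le_compat; try apply Cmod_ge_0; exact B3. }
    assert (b ^ 2 * Cmod (y - z) <= e * a ^ 3 / 4).
    { apply (Rmult_lt_compat_l (b ^ 2)) in Y4; [|apply pow_lt; exact Hb].
      replace (b ^ 2 * d4) with (e * a ^ 3 / 4) in Y4 by (unfold d4; field; lra); lra. }
    assert (b ^ 2 * Cmod (y - z) * Cmod (y - z) <= e * a ^ 3 / 4 * Cmod (y - z)) by (apply Rmult_le_compat_r; lra).
    lra. }
lra.
Qed.

Section Herglotz.
Variable nu : circ_measure.
Hypothesis nu_fin : (nu I01 < +oo)%E.
Let T := arc_measure nu 0 1.
Notation pois := (pois nu).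

Definition herglotz' (z : C) (t : R) : C := (2 * (zeta t / ((zeta t - z) * (zeta t - z))))%C.
Definition cpois (z : C) : R := cint nu (fun t => snd (herglotz z t)).
(** The derivative of the Herglotz integral [pois + i cpois], given in advance as the integral of
    the differentiated kernel, real and imaginary parts separately. *)
Definition hfun' (z : C) : C := (cint nu (fun t => fst (herglotz' z t)), cint nu (fun t => snd (herglotz' z t))).

Lemma Cmod_2 : Cmod 2 = 2.
Proof. rewrite Cmod_R, Rabs_right; lra. Qed.

Lemma herglotz_lipschitz z t s : in_disc z ->
  Cmod (herglotz z t - herglotz z s) <= 16 / (1 - Cmod z) ^ 2 * Rabs (t - s).
Proof.
intros Hz; assert (H1 := zeta_sub_neq0 (t := t) Hz); assert (H2 := zeta_sub_neq0 (t := s) Hz).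
unfold in_disc in Hz.
assert (G1 := zeta_dist_ge z t); assert (G2 := zeta_dist_ge z s); assert (B := zeta_chord_le t s).
assert (Z0 := Cmod_ge_0 z).
replace (herglotz z t - herglotz z s)%C with (- (2 * z * (zeta t - zeta s)) / ((zeta t - z) * (zeta s - z)))%C
  by (unfold herglotz; field; split; assumption).
eapply Rle_trans; [apply (@Cmod_div_le _ _ ((1 - Cmod z) ^ 2)); [apply pow_lt; lra|]|].
- rewrite Cmod_mult; simpl; rewrite Rmult_1_r; apply Rmult_le_compat; lra.
- rewrite Cmod_opp, !Cmod_mult, Cmod_2.
  replace (16 / (1 - Cmod z) ^ 2 * Rabs (t - s)) with (2 * (8 * Rabs (t - s)) / (1 - Cmod z) ^ 2) by (field; lra).
  apply Rmult_le_compat_r; [left; apply Rinv_0_lt_compat, pow_lt; lra|].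
  generalize (Cmod_ge_0 (zeta t - zeta s)); intros; nra.
Qed.

Lemma herglotz'_lipschitz z t s : in_disc z ->
  Cmod (herglotz' z t - herglotz' z s) <= 32 / (1 - Cmod z) ^ 3 * Rabs (t - s).
Proof.
intros Hz; unfold herglotz'; unfold in_disc in Hz.
assert (F : forall a b : C, (2 * a - 2 * b = 2 * (a - b))%C) by (intros; ring).
rewrite F; clear F.
rewrite Cmod_mult, Cmod_2.
replace (32 / (1 - Cmod z) ^ 3 * Rabs (t - s)) with (2 * (16 * Rabs (t - s) / (1 - Cmod z) ^ 3)) by (field; lra).
apply Rmult_le_compat_l; [lra|].
apply cauchy_kernel_lipschitz; try apply zeta_dist_ge; lra.
Qed.

Lemma lipschitz_fst_cont (k : R -> C) L : (forall t s, Cmod (k t - k s) <= L * Rabs (t - s)) ->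
  continuity (fun t => fst (k t)).
Proof.
intros H; apply (@lipschitz_continuity _ L); intros t s; rewrite Cminus_fst.
eapply Rle_trans; [apply Rabs_fst_le|apply H].
Qed.

Lemma lipschitz_snd_cont (k : R -> C) L : (forall t s, Cmod (k t - k s) <= L * Rabs (t - s)) ->
  continuity (fun t => snd (k t)).
Proof.
intros H; apply (@lipschitz_continuity _ L); intros t s; rewrite Cminus_snd.
eapply Rle_trans; [apply Rabs_snd_le|apply H].
Qed.

Lemma herglotz_snd_cont z : in_disc z -> continuity (fun t => snd (herglotz z t)).
Proof. intros Hz; eapply lipschitz_snd_cont; intros; now apply herglotz_lipschitz. Qed.

Lemma herglotz_fst_cont z : in_disc z -> continuity (fun t => fst (herglotz z t)).
Proof. intros Hz; eapply lipschitz_fst_cont; intros; now apply herglotz_lipschitz. Qed.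

Lemma herglotz'_fst_cont z : in_disc z -> continuity (fun t => fst (herglotz' z t)).
Proof. intros Hz; eapply lipschitz_fst_cont; intros; now apply herglotz'_lipschitz. Qed.

Lemma herglotz'_snd_cont z : in_disc z -> continuity (fun t => snd (herglotz' z t)).
Proof. intros Hz; eapply lipschitz_snd_cont; intros; now apply herglotz'_lipschitz. Qed.

Lemma pois_fst z : in_disc z -> pois z = cint nu (fun t => fst (herglotz z t)).
Proof. intros Hz; apply cint_ext; intros t; now apply poisson_herglotz. Qed.

(** The second-order remainder is uniform in [t], so integrating it against a finite measure
    differentiates under the integral sign without a limit theorem. *)
Lemma herglotz_quad w z t : in_disc z -> Cmod (w - z) <= (1 - Cmod z) / 2 ->
  Cmod (herglotz w t - herglotz z t - (w - z) * herglotz' z t) <= 4 * Cmod (w - z) ^ 2 / (1 - Cmod z) ^ 3.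
Proof.
intros Hz Hw; assert (Hwd := near_in_disc Hz Hw).
assert (H1 := zeta_sub_neq0 (t := t) Hz); assert (H2 := zeta_sub_neq0 (t := t) Hwd).
assert (G1 := zeta_dist_ge z t); assert (G2 := near_dist_ge t Hw).
unfold in_disc in Hz.
replace (herglotz w t - herglotz z t - (w - z) * herglotz' z t)%C with
  (2 * zeta t * (w - z) * (w - z) / ((zeta t - w) * (zeta t - z) * (zeta t - z)))%C
  by (unfold herglotz, herglotz'; field; split; assumption).
pose (d := 1 - Cmod z); fold d in G1 |- *; assert (Hd : 0 < d) by (unfold d; lra).
eapply Rle_trans; [apply (@Cmod_div_le _ _ (d / 2 * d * d))|].
- repeat apply Rmult_lt_0_compat; lra.
- rewrite !Cmod_mult; apply Rmult_le_compat; [nra|lra| |exact G1].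
  apply Rmult_le_compat; lra.
- rewrite !Cmod_mult, Cmod_2, Cmod_zeta; right; field; lra.
Qed.

Lemma cint_lin3 f g h1 h2 x y : continuity f -> continuity g -> continuity h1 -> continuity h2 ->
  cint nu (fun t => f t - g t - (x * h1 t + y * h2 t)) =
  cint nu f - cint nu g - (x * cint nu h1 + y * cint nu h2).
Proof.
intros Hf Hg H1 H2.
assert (X1 : continuity (fun t => x * h1 t)) by exact (continuity_scal h1 x H1).
assert (X2 : continuity (fun t => y * h2 t)) by exact (continuity_scal h2 y H2).
rewrite (@cint_sub nu nu_fin (fun t => f t - g t)) by first [exact (continuity_minus f g Hf Hg)|exact (continuity_plus _ _ X1 X2)].
rewrite cint_sub, cint_add, !cint_scal by assumption; reflexivity.
Qed.

Lemma pois_quad w z : in_disc z -> Cmod (w - z) <= (1 - Cmod z) / 2 ->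
  Rabs (pois w - pois z - fst ((w - z) * hfun' z)%C) <= 4 * Cmod (w - z) ^ 2 / (1 - Cmod z) ^ 3 * T.
Proof.
intros Hz Hw; assert (Hwd := near_in_disc Hz Hw).
replace (fst ((w - z) * hfun' z)%C) with
  (fst (w - z)%C * cint nu (fun t => fst (herglotz' z t)) + - snd (w - z)%C * cint nu (fun t => snd (herglotz' z t)))
  by (simpl; ring).
rewrite !pois_fst by assumption.
rewrite <- cint_lin3 by (try apply herglotz_fst_cont; try apply herglotz'_fst_cont; try apply herglotz'_snd_cont; assumption).
apply cint_bound; [exact nu_fin| |].
- apply (@continuity_minus (fun t => fst (herglotz w t) - fst (herglotz z t))).
  + apply (@continuity_minus (fun t => fst (herglotz w t)) (fun t => fst (herglotz z t))); now apply herglotz_fst_cont.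
  + apply (@continuity_plus (fun t => fst (w - z)%C * fst (herglotz' z t)) (fun t => - snd (w - z)%C * snd (herglotz' z t))).
    * apply (continuity_scal (fun t => fst (herglotz' z t))); now apply herglotz'_fst_cont.
    * apply (continuity_scal (fun t => snd (herglotz' z t))); now apply herglotz'_snd_cont.
- intros t; eapply Rle_trans; [|apply (herglotz_quad t Hz Hw)].
  eapply Rle_trans; [|apply Rabs_fst_le].
  right; f_equal; simpl; ring.
Qed.

Lemma cpois_quad w z : in_disc z -> Cmod (w - z) <= (1 - Cmod z) / 2 ->
  Rabs (cpois w - cpois z - snd ((w - z) * hfun' z)%C) <= 4 * Cmod (w - z) ^ 2 / (1 - Cmod z) ^ 3 * T.
Proof.
intros Hz Hw; assert (Hwd := near_in_disc Hz Hw).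
replace (snd ((w - z) * hfun' z)%C) with
  (snd (w - z)%C * cint nu (fun t => fst (herglotz' z t)) + fst (w - z)%C * cint nu (fun t => snd (herglotz' z t)))
  by (simpl; ring).
unfold cpois.
rewrite <- cint_lin3 by (try apply herglotz_snd_cont; try apply herglotz'_fst_cont; try apply herglotz'_snd_cont; assumption).
apply cint_bound; [exact nu_fin| |].
- apply (@continuity_minus (fun t => snd (herglotz w t) - snd (herglotz z t))).
  + apply (@continuity_minus (fun t => snd (herglotz w t)) (fun t => snd (herglotz z t))); now apply herglotz_snd_cont.
  + apply (@continuity_plus (fun t => snd (w - z)%C * fst (herglotz' z t)) (fun t => fst (w - z)%C * snd (herglotz' z t))).
    * apply (continuity_scal (fun t => fst (herglotz' z t))); now apply herglotz'_fst_cont.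
    * apply (continuity_scal (fun t => snd (herglotz' z t))); now apply herglotz'_snd_cont.
- intros t; eapply Rle_trans; [|apply (herglotz_quad t Hz Hw)].
  eapply Rle_trans; [|apply Rabs_snd_le].
  right; f_equal; simpl; ring.
Qed.

Lemma line_quad (F : C -> R) (L : C -> R) z e s B : in_disc (z + RtoC s * e) ->
  (forall c u, L (RtoC c * u)%C = c * L u) ->
  (forall w, Cmod (w - (z + RtoC s * e)) <= (1 - Cmod (z + RtoC s * e)) / 2 ->
     Rabs (F w - F (z + RtoC s * e)%C - L (w - (z + RtoC s * e))%C) <= B * Cmod (w - (z + RtoC s * e)) ^ 2) ->
  derivable_pt_lim (fun x => F (z + RtoC x * e)%C) s (L e).
Proof.
intros Hz HL H.
assert (E0 := Cmod_ge_0 e); unfold in_disc in Hz.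
apply (@derivable_pt_lim_quad _ s _ ((1 - Cmod (z + RtoC s * e)) / 2 / (Cmod e + 1)) (B * Cmod e ^ 2)).
- repeat apply Rdiv_lt_0_compat; lra.
- intros h Hh.
  assert (W : (z + RtoC (s + h) * e - (z + RtoC s * e) = RtoC h * e)%C) by (rewrite RtoC_plus; ring).
  assert (M : Cmod (RtoC h * e) = Rabs h * Cmod e) by (rewrite Cmod_mult, Cmod_R; reflexivity).
  specialize (H (z + RtoC (s + h) * e)%C); rewrite W, M, HL in H.
  rewrite Rpow_mult_distr, pow2_abs in H.
  replace (B * Cmod e ^ 2 * h ^ 2) with (B * (h ^ 2 * Cmod e ^ 2)) by ring.
  apply H.
  apply (Rmult_lt_compat_l (Cmod e + 1)) in Hh; [|lra].
  replace ((Cmod e + 1) * ((1 - Cmod (z + RtoC s * e)) / 2 / (Cmod e + 1))) with ((1 - Cmod (z + RtoC s * e)) / 2) in Hh by (field; lra).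
  generalize (Rabs_pos h); lra.
Qed.

Lemma pois_line z e s : in_disc (z + RtoC s * e) ->
  derivable_pt_lim (fun x => pois (z + RtoC x * e)%C) s (fst (e * hfun' (z + RtoC s * e))%C).
Proof.
intros Hz.
apply (@line_quad pois (fun u => fst (u * hfun' (z + RtoC s * e))%C) z e s (4 / (1 - Cmod (z + RtoC s * e)) ^ 3 * T) Hz).
- intros c u; simpl; ring.
- intros w Hw; eapply Rle_trans; [apply (pois_quad Hz Hw)|].
  right; unfold in_disc in Hz; field; lra.
Qed.

Lemma cpois_line z e s : in_disc (z + RtoC s * e) ->
  derivable_pt_lim (fun x => cpois (z + RtoC x * e)%C) s (snd (e * hfun' (z + RtoC s * e))%C).
Proof.
intros Hz.
apply (@line_quad cpois (fun u => snd (u * hfun' (z + RtoC s * e))%C) z e s (4 / (1 - Cmod (z + RtoC s * e)) ^ 3 * T) Hz).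
- intros c u; simpl; ring.
- intros w Hw; eapply Rle_trans; [apply (cpois_quad Hz Hw)|].
  right; unfold in_disc in Hz; field; lra.
Qed.
End Herglotz.

(** * The Bloch condition in terms of the Herglotz integral *)

Lemma cderive_line (f : C -> C) (z l e : C) :
  Coquelicot.Derive.is_derive (K := C_AbsRing) (V := C_NormedModule) f z l ->
  derivable_pt_lim (fun s => fst (f (z + RtoC s * e)%C)) 0 (fst (e * l)%C) /\
  derivable_pt_lim (fun s => snd (f (z + RtoC s * e)%C)) 0 (snd (e * l)%C).
Proof.
intros H; rewrite cderive_eps in H.
assert (E0 := Cmod_ge_0 e).
assert (Q : forall eps, 0 < eps -> exists d : posreal, forall h, h <> 0 -> Rabs h < d ->
  Cmod (f (z + RtoC (0 + h) * e)%C - f (z + RtoC 0 * e)%C - RtoC h * (e * l)) < eps * Rabs h).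
{ intros eps Heps.
  destruct (H (eps / 2 / (Cmod e + 1))) as (d & Hd & Hy); [repeat apply Rdiv_lt_0_compat; lra|].
  assert (Pd : 0 < d / (Cmod e + 1)) by (apply Rdiv_lt_0_compat; lra).
  exists (mkposreal _ Pd); simpl; intros h Hh Hh2.
  assert (Ph : 0 < Rabs h) by now apply Rabs_pos_lt.
  assert (W : (z + RtoC (0 + h) * e - z = RtoC h * e)%C) by (rewrite Rplus_0_l; ring).
  assert (M : Cmod (RtoC h * e) = Rabs h * Cmod e) by (rewrite Cmod_mult, Cmod_R; reflexivity).
  specialize (Hy (z + RtoC (0 + h) * e)%C); rewrite W, M in Hy.
  replace (z + RtoC 0 * e)%C with z by ring.
  replace (RtoC h * (e * l))%C with (RtoC h * e * l)%C by ring.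
  eapply Rle_lt_trans; [apply Hy|].
  - apply (Rmult_lt_compat_l (Cmod e + 1)) in Hh2; [|lra].
    replace ((Cmod e + 1) * (d / (Cmod e + 1))) with d in Hh2 by (field; lra).
    nra.
  - assert (eps / 2 / (Cmod e + 1) * (Rabs h * Cmod e) <= eps / 2 / (Cmod e + 1) * (Rabs h * (Cmod e + 1))).
    { apply Rmult_le_compat_l; [left; repeat apply Rdiv_lt_0_compat; lra|]; apply Rmult_le_compat_l; lra. }
    replace (eps / 2 / (Cmod e + 1) * (Rabs h * (Cmod e + 1))) with (eps / 2 * Rabs h) in H0 by (field; lra).
    nra. }
split; intros eps Heps; destruct (Q eps Heps) as [d Hd]; exists d; intros h Hh Hh2;
  assert (B := Hd h Hh Hh2); assert (Ph : 0 < Rabs h) by (now apply Rabs_pos_lt);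
  apply Rmult_lt_reg_r with (Rabs h); try exact Ph; rewrite <- Rabs_mult;
  (eapply Rle_lt_trans; [|exact B]).
- eapply Rle_trans; [|apply Rabs_fst_le]; right; f_equal; simpl; field; exact Hh.
- eapply Rle_trans; [|apply Rabs_snd_le]; right; f_equal; simpl; field; exact Hh.
Qed.

Lemma ln_Cmod (z : C) : z <> 0%C -> ln (Cmod z) = / 2 * ln (fst z ^ 2 + snd z ^ 2).
Proof.
intros Hz; assert (P := proj1 (Cmod_gt_0 z) Hz).
rewrite <- Cmod_sqr; simpl; rewrite Rmult_1_r, ln_mult by exact P; field.
Qed.

Lemma is_derive_ln_sqr (p q : R -> R) (x p' q' : R) : is_derive p x p' -> is_derive q x q' ->
  0 < p x ^ 2 + q x ^ 2 ->
  is_derive (fun s => / 2 * ln (p s ^ 2 + q s ^ 2)) x ((p x * p' + q x * q') / (p x ^ 2 + q x ^ 2)).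
Proof.
intros D1 D2 H; auto_derive.
- repeat split; [eexists; exact D1|eexists; exact D2|simpl in H; lra].
- replace (Derive (fun s => p s) x) with p' by (symmetry; exact (is_derive_unique _ _ _ D1)).
  replace (Derive (fun s => q s) x) with q' by (symmetry; exact (is_derive_unique _ _ _ D2)).
  simpl in *; field; lra.
Qed.

Lemma line_in_disc z e : in_disc z -> exists d, 0 < d /\ forall s, Rabs s < d -> in_disc (z + RtoC s * e).
Proof.
unfold in_disc; intros Hz; assert (E0 := Cmod_ge_0 e).
exists ((1 - Cmod z) / (Cmod e + 1)); split; [apply Rdiv_lt_0_compat; lra|].
intros s Hs; apply (Rmult_lt_compat_l (Cmod e + 1)) in Hs; [|lra].
replace ((Cmod e + 1) * ((1 - Cmod z) / (Cmod e + 1))) with (1 - Cmod z) in Hs by (field; lra).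
eapply Rle_lt_trans; [apply Cmod_triangle|]; rewrite Cmod_mult, Cmod_R; generalize (Rabs_pos s); intros; nra.
Qed.

Lemma derivable_pt_lim_bound f l B d : 0 < d -> derivable_pt_lim f 0 l ->
  (forall s, Rabs s < d -> Rabs (f s - f 0) <= B * Rabs s) -> Rabs l <= B.
Proof.
intros Hd H HB; apply le_epsilon; intros eps Heps.
destruct (H eps Heps) as [d' Hd'].
pose (s := Rmin d d' / 2).
assert (P : 0 < Rmin d d') by (apply Rmin_pos; [exact Hd|apply cond_pos]).
assert (Q1 := Rmin_l d d'); assert (Q2 := Rmin_r d d').
assert (Hs : Rabs s = s) by (apply Rabs_right; unfold s; lra).
assert (X := Hd' s ltac:(unfold s; lra) ltac:(rewrite Hs; unfold s; lra)).
assert (Y := HB s ltac:(rewrite Hs; unfold s; lra)).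
rewrite Rplus_0_l in X; rewrite Hs in Y.
assert (Z : Rabs ((f s - f 0) / s) <= B).
{ unfold Rdiv; rewrite Rabs_mult, Rabs_inv, Hs.
  apply Rmult_le_reg_r with s; [unfold s; lra|].
  rewrite Rmult_assoc, Rinv_l by (unfold s; lra); lra. }
generalize (Rabs_triang_inv l ((f s - f 0) / s)); rewrite (Rabs_minus_sym l); lra.
Qed.

Lemma Cmod_le_sum (z : C) : Cmod z <= Rabs (fst z) + Rabs (snd z).
Proof.
apply Cmod_le_sqr; [generalize (Rabs_pos (fst z)) (Rabs_pos (snd z)); lra|].
rewrite <- (pow2_abs (fst z)), <- (pow2_abs (snd z)).
generalize (Rabs_pos (fst z)) (Rabs_pos (snd z)); intros; nra.
Qed.

Section Bridge.
Variable nu : circ_measure.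
Hypothesis nu_fin : (nu I01 < +oo)%E.
Notation pois := (pois nu).
Notation hfun' := (hfun' nu).

(** No branch of the logarithm is chosen. Along every line through [z] the real functions [ln |h|]
    and [sg * pois] have the same derivative, so the two complex numbers agree after multiplication
    by any [e] and taking real parts; [e = 1] and [e = i] suffice. *)
Lemma log_derivative (h : C -> C) (z l : C) sg : in_disc z ->
  Coquelicot.Derive.is_derive (K := C_AbsRing) (V := C_NormedModule) h z l ->
  (forall w, in_disc w -> h w <> 0%C) ->
  (forall w, in_disc w -> ln (Cmod (h w)) = sg * pois w) ->
  (l / h z = RtoC sg * hfun' z)%C.
Proof.
intros Hz Hd Hnz Hln.
assert (Q : forall e, fst (e * (l / h z))%C = fst (e * (RtoC sg * hfun' z))%C).
{ intros e.
  destruct (cderive_line e Hd) as [D1 D2]; apply is_derive_Reals in D1, D2.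
  assert (D3 := @pois_line nu nu_fin z e 0); apply is_derive_Reals in D3.
  2:{ replace (z + RtoC 0 * e)%C with z by ring; exact Hz. }
  replace (z + RtoC 0 * e)%C with z in D3 by ring.
  assert (D4 := is_derive_scal _ _ sg _ D3).
  destruct (line_in_disc e Hz) as (d & Hd0 & Hdd).
  assert (D5 : is_derive (fun s => / 2 * ln (fst (h (z + RtoC s * e)%C) ^ 2 + snd (h (z + RtoC s * e)%C) ^ 2)) 0
     (fst (e * (l / h z))%C)).
  { assert (N := Hnz z Hz).
    assert (P : 0 < fst (h z) ^ 2 + snd (h z) ^ 2).
    { rewrite <- Cmod_sqr; apply pow_lt; now apply Cmod_gt_0. }
    revert D1 D2; set (p := fun s => fst (h (z + RtoC s * e)%C)); set (q := fun s => snd (h (z + RtoC s * e)%C)); intros D1 D2.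
    assert (Ep : p 0 = fst (h z)) by (unfold p; do 2 f_equal; ring).
    assert (Eq : q 0 = snd (h z)) by (unfold q; do 2 f_equal; ring).
    replace (fst (e * (l / h z))%C) with ((p 0 * fst (e * l)%C + q 0 * snd (e * l)%C) / (p 0 ^ 2 + q 0 ^ 2)).
    - apply (is_derive_ln_sqr D1 D2); rewrite Ep, Eq; exact P.
    - rewrite Ep, Eq; destruct (h z) as [a b], l as [x y], e as [u v]; simpl in *; field; nra. }
  assert (D6 : is_derive (fun s => sg * pois (z + RtoC s * e)%C) 0 (fst (e * (l / h z))%C)).
  { eapply is_derive_ext_loc; [|exact D5].
    exists (mkposreal d Hd0); intros s Hs; simpl.
    assert (Hs' : in_disc (z + RtoC s * e)).
    { apply Hdd; unfold ball in Hs; simpl in Hs; unfold AbsRing_ball, abs, minus, plus, opp in Hs; simpl in Hs.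
      change (Rabs (s + - 0) < d) in Hs; rewrite Ropp_0, Rplus_0_r in Hs; exact Hs. }
    rewrite <- Hln, ln_Cmod by auto; reflexivity. }
  etransitivity; [symmetry; exact (is_derive_unique _ _ _ D6)|].
  etransitivity; [exact (is_derive_unique _ _ _ D4)|].
  simpl; ring. }
assert (Q1 := Q (RtoC 1)); assert (Q2 := Q Ci); revert Q1 Q2.
destruct (l / h z)%C as [x y], (RtoC sg * hfun' z)%C as [x' y']; simpl; intros; f_equal; lra.
Qed.

Lemma bloch_iff (f : C -> C) : holomorphic_disc f -> (forall z, in_disc z -> f z <> 0%C) ->
  (forall z, in_disc z -> - ln (Cmod (f z)) = pois z) ->
  bloch (fun z => Cinv (f z)) <->
  exists M, forall z, in_disc z -> (1 - Cmod z) * Cmod (hfun' z) <= M * exp (- pois z).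
Proof.
intros Hf Hnz Hln.
assert (Hi : forall z, in_disc z -> (/ f z <> 0)%C).
{ intros z Hz E; assert (X := Cinv_r (f z) (Hnz z Hz)); rewrite E, Cmult_0_r in X.
  apply C1_nz; symmetry; exact X. }
assert (Hm : forall z, in_disc z -> Cmod (f z) = exp (- pois z)).
{ intros z Hz; rewrite <- Hln, Ropp_involutive, exp_ln by solve [exact Hz | now apply Cmod_gt_0, Hnz]; reflexivity. }
assert (Hli : forall z, in_disc z -> ln (Cmod (/ f z)) = 1 * pois z).
{ intros z Hz; rewrite Cmod_inv, ln_Rinv, <- Hln by solve [auto | now apply Cmod_gt_0, Hnz]; ring. }
split.
- intros (g' & Hg & M & HM); exists M; intros z Hz.
  assert (E := log_derivative Hz (Hg z Hz) Hi Hli).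
  replace (RtoC 1 * hfun' z)%C with (hfun' z) in E by ring.
  rewrite <- E, Cmod_div, Cmod_inv, Hm by auto.
  unfold Rdiv; rewrite Rinv_inv, <- Rmult_assoc.
  apply Rmult_le_compat_r; [left; apply exp_pos|now apply HM].
- intros (M & HM); exists (fun z => hfun' z / f z)%C; split.
  + intros z Hz; destruct (Hf z Hz) as [l Hl].
    assert (E : (l / f z = RtoC (-1) * hfun' z)%C).
    { apply (log_derivative Hz Hl Hnz); intros w Hw; rewrite <- Hln by exact Hw; ring. }
    replace (hfun' z / f z)%C with (- l / (f z * f z))%C.
    * apply cderive_inv; auto.
    * assert (E' : hfun' z = (- (l / f z))%C) by (rewrite E; apply injective_projections; simpl; ring).
      rewrite E'; field; auto.
  + exists M; intros z Hz; specialize (HM z Hz).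
    rewrite Cmod_div, Hm by auto.
    unfold Rdiv; rewrite <- exp_Ropp, Ropp_involutive, <- Rmult_assoc.
    apply Rmult_le_reg_r with (exp (- pois z)); [apply exp_pos|].
    rewrite Rmult_assoc, <- exp_plus, Rplus_opp_r, exp_0; lra.
Qed.

(** The increments of [pois] in the directions [1] and [i] bound the real and the imaginary part of
    [hfun'], hence the factor 2. *)
Lemma arcs_hfun' Cst : 0 < Cst ->
  (forall x l, 0 < l <= 1 / 2 ->
    Rabs (arc_measure nu x l / l - arc_measure nu (x + l) l / l) <= Cst * exp (- (arc_measure nu x l / l))) ->
  (forall x l, 0 < l <= 1 / 2 ->
    Rabs (arc_measure nu (x + l) l / l - arc_measure nu x l / l) <= Cst * exp (- (arc_measure nu (x + l) l / l))) ->
  exists M, forall z, in_disc z -> (1 - Cmod z) * Cmod (hfun' z) <= M * exp (- pois z).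
Proof.
intros HC H1 H2.
destruct (pois_lipschitz nu_fin HC H1 H2) as (A & HA & HL).
exists (2 * A); intros z Hz.
assert (D : 0 < 1 - Cmod z) by (unfold in_disc in Hz; lra).
assert (Q : forall e, Cmod e = 1 -> Rabs (fst (e * hfun' z)%C) <= A * exp (- pois z) / (1 - Cmod z)).
{ intros e He.
  assert (D3 := @pois_line nu nu_fin z e 0); replace (z + RtoC 0 * e)%C with z in D3 by ring.
  apply (@derivable_pt_lim_bound _ _ _ ((1 - Cmod z) / 2) ltac:(lra) (D3 Hz)).
  intros s Hs; replace (z + RtoC 0 * e)%C with z by ring.
  assert (W : (z + RtoC s * e - z = RtoC s * e)%C) by ring.
  assert (M : Cmod (RtoC s * e) = Rabs s) by (rewrite Cmod_mult, Cmod_R, He; ring).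
  assert (X := HL z (z + RtoC s * e)%C Hz); rewrite W, M in X.
  eapply Rle_trans; [apply X; lra|]; right; field; lra. }
assert (Q1 := Q (RtoC 1) ltac:(rewrite Cmod_R; apply Rabs_R1)).
assert (Q2 := Q Ci ltac:(apply Cmod_Ci)).
replace (fst (RtoC 1 * hfun' z)%C) with (fst (hfun' z)) in Q1 by (simpl; ring).
replace (fst (Ci * hfun' z)%C) with (- snd (hfun' z)) in Q2 by (simpl; ring).
rewrite Rabs_Ropp in Q2.
assert (S := Cmod_le_sum (hfun' z)).
apply Rle_trans with ((1 - Cmod z) * (2 * (A * exp (- pois z) / (1 - Cmod z)))).
- apply Rmult_le_compat_l; lra.
- right; field; lra.
Qed.
End Bridge.

(** * Variation of the Poisson integral under the Bloch condition *)

Lemma mvt_bound (f f' : R -> R) a b B : a <= b ->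
  (forall x, a <= x <= b -> derivable_pt_lim f x (f' x)) ->
  (forall x, a <= x <= b -> Rabs (f' x) <= B) -> Rabs (f b - f a) <= B * (b - a).
Proof.
intros [Hab|<-] Hd HB.
- destruct (MVT_cor2 f f' a b Hab Hd) as (c & Hc & Hc2).
  rewrite Hc, Rabs_mult, (Rabs_right (b - a)) by lra.
  apply Rmult_le_compat_r; [lra|]; apply HB; lra.
- rewrite !Rminus_diag, Rabs_R0; lra.
Qed.

Lemma Cmod_segment (z w : C) x s : 0 <= x <= 1 -> Cmod z <= 1 - s -> Cmod w <= 1 - s ->
  Cmod (z + RtoC x * (w - z)) <= 1 - s.
Proof.
intros Hx Hz Hw.
replace (z + RtoC x * (w - z))%C with (RtoC (1 - x) * z + RtoC x * w)%C by (rewrite RtoC_minus; ring).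
eapply Rle_trans; [apply Cmod_triangle|].
rewrite !Cmod_mult, !Cmod_R, !Rabs_right by lra; nra.
Qed.

Section BlochSide.
Variable nu : circ_measure.
Hypothesis nu_fin : (nu I01 < +oo)%E.
Variable M : R.
Hypothesis M_gt0 : 0 < M.
Notation pois := (pois nu).
Notation cpois := (cpois nu).
Notation hfun' := (hfun' nu).
Let m := arc_measure nu.
Let T := arc_measure nu 0 1.
Hypothesis bloch_bound : forall z, in_disc z -> (1 - Cmod z) * Cmod (hfun' z) <= M * exp (- pois z).

Lemma hfun'_bound z s : 0 < s -> Cmod z <= 1 - s -> Cmod (hfun' z) <= M * exp (- pois z) / s.
Proof.
intros Hs Hz.
assert (B := bloch_bound (z := z) ltac:(unfold in_disc; lra)).
apply Rmult_le_reg_l with s; [exact Hs|].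
replace (s * (M * exp (- pois z) / s)) with (M * exp (- pois z)) by (field; lra).
eapply Rle_trans; [|exact B]; apply Rmult_le_compat_r; [apply Cmod_ge_0|lra].
Qed.

(** In the gradient of [exp pois] the factor [exp (- pois)] of the Bloch bound cancels, leaving at
    most [M / s] on the disc of radius [1 - s]; this disc is convex and contains the segment. *)
Lemma exp_pois_variation z w s : 0 < s -> Cmod z <= 1 - s -> Cmod w <= 1 - s ->
  Rabs (exp (pois w) - exp (pois z)) <= M / s * Cmod (w - z).
Proof.
intros Hs Hz Hw.
assert (D : forall x, 0 <= x <= 1 -> in_disc (z + RtoC x * (w - z))).
{ intros x Hx; unfold in_disc; generalize (Cmod_segment Hx Hz Hw); lra. }
assert (X := @mvt_bound (fun x => exp (pois (z + RtoC x * (w - z))%C))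
  (fun x => exp (pois (z + RtoC x * (w - z))%C) * fst ((w - z) * hfun' (z + RtoC x * (w - z)))%C) 0 1 (M / s * Cmod (w - z))).
cbv beta in X.
replace (z + RtoC 1 * (w - z))%C with w in X by ring.
replace (z + RtoC 0 * (w - z))%C with z in X by ring.
rewrite Rminus_0_r, Rmult_1_r in X; apply X; [lra| |].
- intros x Hx.
  exact (derivable_pt_lim_comp _ exp x _ _ (pois_line nu_fin (D x Hx)) (derivable_pt_lim_exp _)).
- intros x Hx; rewrite Rabs_mult, Rabs_right by (left; apply exp_pos).
  assert (F := Rabs_fst_le ((w - z) * hfun' (z + RtoC x * (w - z)))%C).
  rewrite Cmod_mult in F.
  assert (B := hfun'_bound Hs (Cmod_segment Hx Hz Hw)).
  apply Rle_trans with (exp (pois (z + RtoC x * (w - z))%C) * (Cmod (w - z) * (M * exp (- pois (z + RtoC x * (w - z))%C) / s))).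
  + apply Rmult_le_compat_l; [left; apply exp_pos|].
    eapply Rle_trans; [exact F|]; apply Rmult_le_compat_l; [apply Cmod_ge_0|exact B].
  + right; replace (exp (pois (z + RtoC x * (w - z))%C) * (Cmod (w - z) * (M * exp (- pois (z + RtoC x * (w - z))%C) / s)))
      with (M / s * Cmod (w - z) * (exp (pois (z + RtoC x * (w - z))%C) * exp (- pois (z + RtoC x * (w - z))%C))) by (field; lra).
    rewrite <- exp_plus, Rplus_opp_r, exp_0; ring.
Qed.

(* Comparable to [exp (- pois z)]; the shift [24 M] is large enough for the ratio over a
   hyperbolically bounded step to be at most [3/2]. *)
Definition hweight (z : C) : R := / (exp (pois z) + 24 * M).
Definition step_const : R := 12 * M * (1 + 24 * M).

Lemma step_const_gt0 : 0 < step_const.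
Proof. unfold step_const; nra. Qed.

Lemma hweight_gt0 z : 0 < hweight z.
Proof. apply Rinv_0_lt_compat; generalize (exp_pos (pois z)); lra. Qed.

Lemma hweight_le z : hweight z <= exp (- pois z).
Proof. rewrite exp_Ropp; apply Rinv_le_contravar; [apply exp_pos|lra]. Qed.

Lemma exp_pois_ge1 z : in_disc z -> 1 <= exp (pois z).
Proof.
intros Hz; rewrite <- exp_0; destruct (pois_ge0 nu_fin Hz) as [H|<-]; [left; now apply exp_increasing|lra].
Qed.

Lemma hweight_le1 z : in_disc z -> hweight z <= 1.
Proof.
intros Hz; rewrite <- Rinv_1; apply Rinv_le_contravar; generalize (exp_pois_ge1 Hz); lra.
Qed.

Lemma exp_le_hweight z : in_disc z -> exp (- pois z) <= (1 + 24 * M) * hweight z.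
Proof.
intros Hz; assert (E := exp_pois_ge1 Hz); rewrite exp_Ropp; unfold hweight.
apply Rmult_le_reg_l with (exp (pois z)); [lra|]; rewrite Rinv_r by lra.
apply Rmult_le_reg_r with (exp (pois z) + 24 * M); [lra|].
rewrite <- Rmult_assoc, (Rmult_assoc _ (/ _)), Rinv_l by lra; nra.
Qed.

(** [exp pois] drops by at most [M / s] times [8 s], that is [8 M], one third of the shift [24 M].
    Steps of length [8 s] are allowed so that an arc of length [s] at height [s] is a single
    step. *)
Lemma hweight_step z w s : 0 < s -> Cmod z <= 1 - s -> Cmod w <= 1 - s -> Cmod (w - z) <= 8 * s ->
  hweight w <= 3 / 2 * hweight z.
Proof.
intros Hs Hz Hw Hd.
assert (V := exp_pois_variation Hs Hz Hw).
assert (B : M / s * Cmod (w - z) <= 8 * M).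
{ replace (8 * M) with (M / s * (8 * s)) by (field; lra).
  apply Rmult_le_compat_l; [left; apply Rdiv_lt_0_compat; lra|exact Hd]. }
apply Rabs_le_between in V.
assert (P := exp_pos (pois z)).
unfold hweight; replace (3 / 2) with (/ (2 / 3)) by field.
rewrite <- Rinv_mult; apply Rinv_le_contravar; lra.
Qed.

(** Origin of [step_const]: the length [8 s] times the growth [3/2] of the weight gives the 12, and
    [1 + 24 M] is the price of replacing [exp (- pois)] by the weight. *)
Lemma hfun'_segment z w s x : 0 < s -> Cmod z <= 1 - s -> Cmod w <= 1 - s -> Cmod (w - z) <= 8 * s ->
  0 <= x <= 1 -> Cmod ((w - z) * hfun' (z + RtoC x * (w - z))) <= step_const * hweight z.
Proof.
intros Hs Hz Hw Hd Hx.
assert (Hv := Cmod_segment Hx Hz Hw).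
assert (B := hfun'_bound Hs Hv).
assert (S : hweight (z + RtoC x * (w - z)) <= 3 / 2 * hweight z).
{ apply (hweight_step Hs Hz Hv).
  replace (z + RtoC x * (w - z) - z)%C with (RtoC x * (w - z))%C by ring.
  rewrite Cmod_mult, Cmod_R, Rabs_right by lra; generalize (Cmod_ge_0 (w - z)); intros; nra. }
assert (E := exp_le_hweight (z := (z + RtoC x * (w - z))%C) ltac:(unfold in_disc; lra)).
rewrite Cmod_mult.
apply Rle_trans with (8 * s * (M * ((1 + 24 * M) * (3 / 2 * hweight z)) / s)).
- apply Rmult_le_compat; try apply Cmod_ge_0; [exact Hd|].
  eapply Rle_trans; [exact B|].
  unfold Rdiv; apply Rmult_le_compat_r; [left; now apply Rinv_0_lt_compat|].
  apply Rmult_le_compat_l; [lra|]; eapply Rle_trans; [exact E|].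
  apply Rmult_le_compat_l; lra.
- right; unfold step_const; field; lra.
Qed.

Lemma pois_step z w s : 0 < s -> Cmod z <= 1 - s -> Cmod w <= 1 - s -> Cmod (w - z) <= 8 * s ->
  Rabs (pois w - pois z) <= step_const * hweight z /\
  Rabs (cpois w - cpois z) <= step_const * hweight z.
Proof.
intros Hs Hz Hw Hd.
assert (D : forall x, 0 <= x <= 1 -> in_disc (z + RtoC x * (w - z))).
{ intros x Hx; unfold in_disc; generalize (Cmod_segment Hx Hz Hw); lra. }
assert (E1 : (z + RtoC 1 * (w - z))%C = w) by ring.
assert (E0 : (z + RtoC 0 * (w - z))%C = z) by ring.
split.
- assert (X := @mvt_bound (fun x => pois (z + RtoC x * (w - z))%C)
    (fun x => fst ((w - z) * hfun' (z + RtoC x * (w - z)))%C) 0 1 (step_const * hweight z)).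
  cbv beta in X; rewrite E1, E0, Rminus_0_r, Rmult_1_r in X; apply X; [lra| |].
  + intros x Hx; exact (pois_line nu_fin (D x Hx)).
  + intros x Hx; eapply Rle_trans; [apply Rabs_fst_le|now apply (hfun'_segment Hs)].
- assert (X := @mvt_bound (fun x => cpois (z + RtoC x * (w - z))%C)
    (fun x => snd ((w - z) * hfun' (z + RtoC x * (w - z)))%C) 0 1 (step_const * hweight z)).
  cbv beta in X; rewrite E1, E0, Rminus_0_r, Rmult_1_r in X; apply X; [lra| |].
  + intros x Hx; exact (cpois_line nu_fin (D x Hx)).
  + intros x Hx; eapply Rle_trans; [apply Rabs_snd_le|now apply (hfun'_segment Hs)].
Qed.

Lemma radial_diff a b theta : (RtoC a * zeta theta - RtoC b * zeta theta = RtoC (a - b) * zeta theta)%C.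
Proof. rewrite RtoC_minus; ring. Qed.

Lemma Cmod_radial_diff a b theta : Cmod (RtoC a * zeta theta - RtoC b * zeta theta) = Rabs (a - b).
Proof. rewrite radial_diff, Cmod_mult, Cmod_R, Cmod_zeta; ring. Qed.

(** Halving the height [l / 2^k] is one admissible step, which multiplies the weight by at most
    [3/2]; the factor [2 ((3/2)^n - 1)] is the sum of [(3/2)^k] over [k < n]. *)
Lemma radial_chain theta l n : 0 < l <= 1 / 2 ->
  let z k := (RtoC (1 - l / 2 ^ k) * zeta theta)%C in
  hweight (z n) <= (3 / 2) ^ n * hweight (z O) /\
  Rabs (cpois (z n) - cpois (z O)) <= 2 * step_const * ((3 / 2) ^ n - 1) * hweight (z O).
Proof.
intros Hl z.
assert (Q := step_const_gt0).
induction n as [|n [IH1 IH2]].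
- assert (H := hweight_gt0 (z O)); simpl pow; split; [lra|].
  rewrite Rminus_diag, Rabs_R0; lra.
- assert (P2 : 0 < 2 ^ n) by (apply pow_lt; lra).
  assert (P1 : 1 <= 2 ^ n) by (apply pow_R1_Rle; lra).
  pose (s := l / 2 ^ S n).
  assert (Hs : 0 < s) by (apply Rdiv_lt_0_compat; [lra|apply pow_lt; lra]).
  assert (E : l / 2 ^ n = 2 * s) by (unfold s; simpl; field; lra).
  assert (L : l / 2 ^ n <= l).
  { apply Rmult_le_reg_r with (2 ^ n); [lra|]; unfold Rdiv; rewrite Rmult_assoc, Rinv_l by lra; nra. }
  assert (M1 : Cmod (z n) <= 1 - s) by (unfold z; rewrite Cmod_polar by lra; lra).
  assert (M2 : Cmod (z (S n)) <= 1 - s) by (unfold z; fold s; rewrite Cmod_polar by lra; lra).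
  assert (M3 : Cmod (z (S n) - z n) <= 8 * s).
  { unfold z; rewrite Cmod_radial_diff; fold s; rewrite E.
    replace (1 - s - (1 - 2 * s)) with s by ring; rewrite Rabs_right; lra. }
  assert (S1 := hweight_step Hs M1 M2 M3).
  destruct (pois_step Hs M1 M2 M3) as [_ S2].
  simpl pow; split; [lra|].
  assert (S3 : step_const * hweight (z n) <= step_const * ((3 / 2) ^ n * hweight (z O))) by (apply Rmult_le_compat_l; lra).
  replace (cpois (z (S n)) - cpois (z O)) with ((cpois (z (S n)) - cpois (z n)) + (cpois (z n) - cpois (z O))) by ring.
  eapply Rle_trans; [apply Rabs_triang|]; lra.
Qed.

(** One further step reaches an intermediate radius and adds [(3/2)^n] to the [2 (3/2)^n] of the
    chain. *)
Lemma radial_cpois theta l n rho : 0 < l <= 1 / 2 -> 1 - l / 2 ^ n <= rho <= 1 - l / 2 ^ S n ->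
  Rabs (cpois (RtoC rho * zeta theta) - cpois (RtoC (1 - l) * zeta theta)) <=
    3 * step_const * (3 / 2) ^ n * hweight (RtoC (1 - l) * zeta theta).
Proof.
intros Hl Hr.
assert (Q := step_const_gt0).
destruct (@radial_chain theta l n Hl) as [R1 R2].
replace (l / 2 ^ 0) with l in R1, R2 by (simpl; field).
assert (P2 : 0 < 2 ^ n) by (apply pow_lt; lra).
assert (P1 : 1 <= 2 ^ n) by (apply pow_R1_Rle; lra).
pose (s := l / 2 ^ S n); fold s in Hr.
assert (Hs : 0 < s) by (apply Rdiv_lt_0_compat; [lra|apply pow_lt; lra]).
assert (E : l / 2 ^ n = 2 * s) by (unfold s; simpl; field; lra).
assert (L : l / 2 ^ n <= l).
{ apply Rmult_le_reg_r with (2 ^ n); [lra|]; unfold Rdiv; rewrite Rmult_assoc, Rinv_l by lra; nra. }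
assert (M1 : Cmod (RtoC (1 - l / 2 ^ n) * zeta theta) <= 1 - s) by (rewrite Cmod_polar by lra; lra).
assert (M2 : Cmod (RtoC rho * zeta theta) <= 1 - s) by (rewrite Cmod_polar by lra; lra).
assert (M3 : Cmod (RtoC rho * zeta theta - RtoC (1 - l / 2 ^ n) * zeta theta) <= 8 * s).
{ rewrite Cmod_radial_diff, Rabs_right; lra. }
destruct (pois_step Hs M1 M2 M3) as [_ S2].
set (W := hweight (RtoC (1 - l) * zeta theta)) in *.
assert (W0 : 0 < W) by apply hweight_gt0.
assert (S3 : step_const * hweight (RtoC (1 - l / 2 ^ n) * zeta theta) <= step_const * ((3 / 2) ^ n * W)) by (apply Rmult_le_compat_l; lra).
replace (cpois (RtoC rho * zeta theta) - cpois (RtoC (1 - l) * zeta theta)) with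
 ((cpois (RtoC rho * zeta theta) - cpois (RtoC (1 - l / 2 ^ n) * zeta theta)) +
  (cpois (RtoC (1 - l / 2 ^ n) * zeta theta) - cpois (RtoC (1 - l) * zeta theta))) by ring.
eapply Rle_trans; [apply Rabs_triang|].
assert (0 <= step_const * W) by (apply Rmult_le_pos; lra).
lra.
Qed.

Lemma angular_step l x y : 0 < l <= 1 / 2 -> Rabs (y - x) <= l ->
  hweight (RtoC (1 - l) * zeta y) <= 3 / 2 * hweight (RtoC (1 - l) * zeta x) /\
  Rabs (pois (RtoC (1 - l) * zeta y) - pois (RtoC (1 - l) * zeta x)) <= step_const * hweight (RtoC (1 - l) * zeta x) /\
  Rabs (cpois (RtoC (1 - l) * zeta y) - cpois (RtoC (1 - l) * zeta x)) <= step_const * hweight (RtoC (1 - l) * zeta x).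
Proof.
intros Hl Hy.
assert (M1 : Cmod (RtoC (1 - l) * zeta x) <= 1 - l) by (rewrite Cmod_polar; lra).
assert (M2 : Cmod (RtoC (1 - l) * zeta y) <= 1 - l) by (rewrite Cmod_polar; lra).
assert (M3 : Cmod (RtoC (1 - l) * zeta y - RtoC (1 - l) * zeta x) <= 8 * l).
{ replace (RtoC (1 - l) * zeta y - RtoC (1 - l) * zeta x)%C with (RtoC (1 - l) * (zeta y - zeta x))%C by ring.
  rewrite Cmod_mult, Cmod_R, Rabs_right by lra.
  generalize (zeta_chord_le y x) (Cmod_ge_0 (zeta y - zeta x)); intros; nra. }
destruct (pois_step (proj1 Hl) M1 M2 M3) as [P1 P2].
split; [exact (hweight_step (proj1 Hl) M1 M2 M3)|split; assumption].
Qed.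

(** At height [s] below a point of mass [c] the Poisson integral is at least [c / s], while the
    Bloch condition lets its exponential grow only like [M / s]. *)
Lemma atom_zero p : I01 p -> fine (nu [set p]%classic) = 0.
Proof.
intros Hp; set (c := fine (nu [set p]%classic)).
assert (c0 : 0 <= c) by apply fine_measure_ge0.
destruct c0 as [c0|c0]; [exfalso|now rewrite c0].
pose (H0 := exp (pois 0)).
assert (PH : 0 < H0) by apply exp_pos.
assert (B : forall s, 0 < s < 1 -> exp (c / s) <= H0 + M / s).
{ intros s Hs.
  assert (M1 : Cmod 0 <= 1 - s) by (rewrite Cmod_0; lra).
  assert (M2 : Cmod (RtoC (1 - s) * zeta p) <= 1 - s) by (rewrite Cmod_polar; lra).
  assert (V := exp_pois_variation (proj1 Hs) M1 M2).
  assert (Hd : in_disc (RtoC (1 - s) * zeta p)) by (unfold in_disc; lra).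
  assert (A := cint_atom nu_fin (poisson_cont Hd) Hp (fun t => poisson_pos t Hd)).
  fold c in A; change (poisson (RtoC (1 - s) * zeta p) p * c <= pois (RtoC (1 - s) * zeta p)) in A.
  assert (PP : / s <= poisson (RtoC (1 - s) * zeta p) p).
  { unfold poisson; change (Cminus (zeta p) (RtoC (1 - s) * zeta p)) with (zeta p - RtoC (1 - s) * zeta p)%C.
    replace (zeta p - RtoC (1 - s) * zeta p)%C with (RtoC s * zeta p)%C by (rewrite RtoC_minus; ring).
    rewrite !Cmod_polar by lra.
    replace ((1 - (1 - s) ^ 2) / s ^ 2) with ((2 - s) * / s) by (field; lra).
    assert (0 < / s) by now apply Rinv_0_lt_compat. nra. }
  replace (RtoC (1 - s) * zeta p - 0)%C with (RtoC (1 - s) * zeta p)%C in V by ring.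
  rewrite Cmod_polar in V by lra.
  apply Rabs_le_between in V; fold H0 in V.
  assert (E : exp (c / s) <= exp (pois (RtoC (1 - s) * zeta p))).
  { assert (c / s <= pois (RtoC (1 - s) * zeta p)).
    { eapply Rle_trans; [|exact A]; unfold Rdiv; rewrite Rmult_comm; apply Rmult_le_compat_r; lra. }
    destruct H as [H|H]; [left; now apply exp_increasing|rewrite <- H; lra]. }
  assert (0 < M / s) by (apply Rdiv_lt_0_compat; lra).
  assert (M / s * (1 - s) <= M / s) by nra.
  lra. }
(* From [exp y >= y^2 / 4] the bound [B] gives [c^2 / 4 <= H0 s^2 + M s <= (H0 + M) s]; with
   [k s <= c^2] the right side is at most [c^2 / 8], which is absurd. *)
pose (k := 8 * (H0 + M)).
assert (Hk : 0 < k) by (unfold k; lra).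
pose (s := Rmin (1 / 2) (c ^ 2 / k)).
assert (Hs : 0 < s < 1).
{ unfold s; split; [apply Rmin_pos; [lra|apply Rdiv_lt_0_compat; [nra|lra]]|].
  generalize (Rmin_l (1 / 2) (c ^ 2 / k)); lra. }
assert (Hs2 : k * s <= c ^ 2).
{ generalize (Rmin_r (1 / 2) (c ^ 2 / k)); fold s; intros.
  replace (c ^ 2) with (k * (c ^ 2 / k)) by (field; lra); apply Rmult_le_compat_l; lra. }
specialize (B s Hs).
assert (G : (c / s) ^ 2 / 4 <= exp (c / s)).
{ assert (Pcs : 0 < c / s) by (apply Rdiv_lt_0_compat; lra).
  revert Pcs; generalize (c / s); intros y Py.
  replace y with (y / 2 + y / 2) at 2 by field; rewrite exp_plus.
  generalize (exp_ineq1_le (y / 2)); intros; nra. }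
assert (G2 : (c / s) ^ 2 / 4 * (s * s) <= (H0 + M / s) * (s * s)) by (apply Rmult_le_compat_r; nra).
replace ((c / s) ^ 2 / 4 * (s * s)) with (c ^ 2 / 4) in G2 by (field; lra).
replace ((H0 + M / s) * (s * s)) with (H0 * s * s + M * s) in G2 by (field; lra).
unfold k in Hs2.
assert (H0 * s * s <= H0 * s) by (assert (0 < H0 * s) by nra; nra).
nra.
Qed.
End BlochSide.

(** * Angular primitive of the Poisson integral *)

Lemma taylor1_bound (f f' : R -> R) x d B h : Rabs h < d ->
  (forall y, Rabs (y - x) < d -> derivable_pt_lim f y (f' y)) ->
  (forall y, Rabs (y - x) < d -> Rabs (f' y - f' x) <= B * Rabs (y - x)) ->
  Rabs (f (x + h) - f x - h * f' x) <= Rabs B * h ^ 2.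
Proof.
intros Hh Hd HB.
assert (K : exists c, Rabs (c - x) <= Rabs h /\ f (x + h) - f x = f' c * h).
{ destruct (Rtotal_order h 0) as [H|[->|H]].
  - rewrite (Rabs_left h) in * by exact H.
    destruct (MVT_cor2 f f' (x + h) x) as (c & Hc & Hc2); [lra| |].
    + intros c Hc; apply Hd; rewrite Rabs_left1; lra.
    + exists c; split; [rewrite Rabs_left; lra|].
      replace (f (x + h) - f x) with (- (f x - f (x + h))) by ring; rewrite Hc; ring.
  - exists x; rewrite Rminus_diag, !Rplus_0_r; split; [lra|ring].
  - rewrite (Rabs_right h) in * by lra.
    destruct (MVT_cor2 f f' x (x + h)) as (c & Hc & Hc2); [lra| |].
    + intros c Hc; apply Hd; rewrite Rabs_right; lra.
    + exists c; split; [rewrite Rabs_right; lra|]; rewrite Hc; ring. }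
destruct K as (c & Hc & ->).
replace (f' c * h - h * f' x) with (h * (f' c - f' x)) by ring.
rewrite Rabs_mult, <- (pow2_abs h).
assert (X := HB c ltac:(lra)).
assert (Y : B * Rabs (c - x) <= Rabs B * Rabs h).
{ apply Rle_trans with (Rabs B * Rabs (c - x)).
  - apply Rmult_le_compat_r; [apply Rabs_pos|apply Rle_abs].
  - apply Rmult_le_compat_l; [apply Rabs_pos|exact Hc]. }
assert (0 <= Rabs h) by apply Rabs_pos.
replace (Rabs B * Rabs h ^ 2) with (Rabs h * (Rabs B * Rabs h)) by ring.
apply Rmult_le_compat_l; lra.
Qed.

Lemma poisson_arg_cont r theta : 0 <= r < 1 -> continuity (fun t => poisson_arg r (2 * PI * (theta - t))).
Proof.
intros Hr.
apply (continuity_comp (fun t => 2 * PI * (theta - t)) (poisson_arg r)).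
- apply (@lipschitz_continuity _ (2 * PI)); intros t s.
  replace (2 * PI * (theta - t) - 2 * PI * (theta - s)) with (2 * PI * - (t - s)) by ring.
  rewrite Rabs_mult, Rabs_Ropp, (Rabs_right (2 * PI)); [lra|generalize PI_gt3; lra].
- apply derivable_continuous; intros phi; exists ((r * cos phi - r ^ 2) / (1 - 2 * r * cos phi + r ^ 2)).
  now apply is_derive_arg_phi.
Qed.

Lemma poisson_arg_bound r phi : Rabs (poisson_arg r phi) <= PI / 2.
Proof. apply Rabs_le; unfold poisson_arg; generalize (atan_bound (r * sin phi / (1 - r * cos phi))); lra. Qed.

Lemma poisson_arg_opp r phi : poisson_arg r (- phi) = - poisson_arg r phi.
Proof.
unfold poisson_arg; rewrite sin_neg, cos_neg, <- atan_opp; f_equal; unfold Rdiv; ring.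
Qed.

Lemma poisson_arg_plus r v k : poisson_arg r (2 * PI * (v + IZR k)) = poisson_arg r (2 * PI * v).
Proof.
assert (E := zeta_plus v k); rewrite !zetaE in E; injection E as Ec Es.
unfold poisson_arg; now rewrite Ec, Es.
Qed.

Lemma poisson_arg_theta r t theta : 0 <= r < 1 ->
  derivable_pt_lim (fun y => poisson_arg r (2 * PI * (y - t))) theta (PI * (poisson (RtoC r * zeta theta) t - 1)).
Proof.
intros Hr; rewrite poisson_polar by exact Hr.
assert (D := is_derive_arg_phi (2 * PI * (theta - t)) Hr); apply is_derive_Reals in D.
replace (2 * PI * (t - theta)) with (- (2 * PI * (theta - t))) by ring; rewrite cos_neg.
apply is_derive_Reals.
revert D; generalize ((r * cos (2 * PI * (theta - t)) - r ^ 2) / (1 - 2 * r * cos (2 * PI * (theta - t)) + r ^ 2)); intros l D.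
replace (PI * (1 + 2 * l - 1)) with (2 * PI * l) by ring.
apply (is_derive_comp (poisson_arg r) (fun s => 2 * PI * (s - t))); [exact D|].
auto_derive; [exact I|ring].
Qed.

Lemma poisson_rotate r theta t : 0 <= r < 1 -> poisson (RtoC r * zeta theta) t = poisson (RtoC r * zeta 0) (t - theta).
Proof. intros Hr; rewrite !poisson_polar by exact Hr; now rewrite Rminus_0_r. Qed.

Lemma herglotz_snd_polar r theta t : 0 <= r < 1 ->
  snd (herglotz (RtoC r * zeta theta) t) =
  2 * r * (sin (2 * PI * (theta - t)) / (1 - 2 * r * cos (2 * PI * (theta - t)) + r ^ 2)).
Proof.
intros Hr; assert (H := arg_denom2_pos (2 * PI * (theta - t)) Hr).
assert (Ha := in_disc_polar theta Hr).
assert (N := zeta_sub_neq0 (t := t) Ha).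
assert (D := dist_sqr_polar r theta t).
replace (2 * PI * (t - theta)) with (- (2 * PI * (theta - t))) in D by ring; rewrite cos_neg in D.
rewrite <- D in H |- *; clear D; rewrite Cmod_sqr in H |- *.
replace (2 * PI * (theta - t)) with (2 * PI * theta - 2 * PI * t) by ring; rewrite sin_minus.
unfold herglotz; rewrite !zetaE in *; simpl in *.
field; nra.
Qed.

Section ArgIntegral.
Variable nu : circ_measure.
Hypothesis nu_fin : (nu I01 < +oo)%E.
Notation pois := (pois nu).
Notation cpois := (cpois nu).
Let m := arc_measure nu.
Let T := arc_measure nu 0 1.

Lemma cint_derive (k k' : R -> R -> R) x d B : 0 < d ->
  (forall y, Rabs (y - x) < d -> continuity (k y)) -> continuity (k' x) ->
  (forall t y, Rabs (y - x) < d -> derivable_pt_lim (fun y => k y t) y (k' y t)) ->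
  (forall t y, Rabs (y - x) < d -> Rabs (k' y t - k' x t) <= B * Rabs (y - x)) ->
  derivable_pt_lim (fun y => cint nu (k y)) x (cint nu (k' x)).
Proof.
intros Hd Hk Hk' HD HB.
apply (@derivable_pt_lim_quad _ x _ d (Rabs B * T) Hd); intros h Hh.
assert (K1 : continuity (k (x + h))) by (apply Hk; replace (x + h - x) with h by ring; exact Hh).
assert (K2 : continuity (k x)) by (apply Hk; rewrite Rminus_diag, Rabs_R0; exact Hd).
assert (K3 : continuity (fun t => h * k' x t)) by exact (continuity_scal (k' x) h Hk').
assert (E : cint nu (fun t => k (x + h) t - k x t - h * k' x t) = cint nu (k (x + h)) - cint nu (k x) - h * cint nu (k' x)).
{ rewrite (@cint_sub nu nu_fin (fun t => k (x + h) t - k x t)) by first [exact K3|exact (continuity_minus _ _ K1 K2)].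
  rewrite cint_sub, cint_scal by assumption; reflexivity. }
rewrite <- E.
replace (Rabs B * T * h ^ 2) with (Rabs B * h ^ 2 * T) by ring.
apply cint_bound; [exact nu_fin|exact (continuity_minus _ _ (continuity_minus _ _ K1 K2) K3)|].
intros t; apply (@taylor1_bound (fun y => k y t) (fun y => k' y t) x d); auto.
Qed.

(** Adding [PI * T * theta] gives an angular primitive of [PI * pois], so the integral of [pois]
    over an arc of the circle of radius [r] is read off from an increment of [argint]. *)
Definition argint (r theta : R) : R := cint nu (fun t => poisson_arg r (2 * PI * (theta - t))).

Lemma cint_1 : cint nu (fun _ => 1) = T.
Proof. rewrite <- (arcint_full nu _ 0), arcint_cst; apply Rmult_1_l. Qed.

Lemma argint_theta r theta : 0 <= r < 1 ->
  derivable_pt_lim (argint r) theta (PI * (pois (RtoC r * zeta theta) - T)).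
Proof.
intros Hr.
assert (Hc : forall y, continuity (poisson (RtoC r * zeta y))) by (intros y; apply poisson_cont; now apply in_disc_polar).
replace (PI * (pois (RtoC r * zeta theta) - T)) with (cint nu (fun t => PI * (poisson (RtoC r * zeta theta) t - 1))).
2:{ rewrite cint_scal, cint_sub, cint_1; try reflexivity; try exact nu_fin; auto.
    - apply continuity_cst.
    - apply (continuity_minus _ (fun _ => 1)); [apply Hc|apply continuity_cst]. }
apply (@cint_derive (fun y t => poisson_arg r (2 * PI * (y - t))) (fun y t => PI * (poisson (RtoC r * zeta y) t - 1))
  theta 1 (PI * (32 * (1 - r) / (1 - r) ^ 3)) Rlt_0_1).
- intros y _; now apply poisson_arg_cont.
- apply (continuity_scal (fun t => poisson (RtoC r * zeta theta) t - 1)).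
  apply (continuity_minus _ (fun _ => 1)); [apply Hc|apply continuity_cst].
- intros t y _; now apply poisson_arg_theta.
- intros t y _.
  replace (PI * (poisson (RtoC r * zeta y) t - 1) - PI * (poisson (RtoC r * zeta theta) t - 1)) with
    (PI * (poisson (RtoC r * zeta y) t - poisson (RtoC r * zeta theta) t)) by ring.
  assert (P3 := PI_gt3).
  rewrite Rabs_mult, (Rabs_right PI), Rmult_assoc by lra; apply Rmult_le_compat_l; [lra|].
  rewrite (poisson_rotate y), (poisson_rotate theta) by exact Hr.
  assert (Hd := in_disc_polar 0 Hr).
  assert (D0 : 0 < 1 - Cmod (RtoC r * zeta 0)) by (unfold in_disc in Hd; lra).
  eapply Rle_trans; [apply (poisson_lipschitz Hd D0); apply zeta_dist_ge|].
  rewrite Cmod_polar by lra.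
  replace (t - y - (t - theta)) with (- (y - theta)) by ring; rewrite Rabs_Ropp.
  right; field; lra.
Qed.

(** The [r]-derivative of the kernel is [sin phi / |1 - r e^(i phi)|^2], the conjugate Poisson
    kernel divided by [2 r]: the Cauchy-Riemann equations in polar form. Staying within [d / 2] of
    [r] keeps both denominators above [(d / 2)^2], whence [64 / d^4]. *)
Lemma argint_r r theta : 0 < r < 1 ->
  derivable_pt_lim (fun rho => argint rho theta) r (/ (2 * r) * cpois (RtoC r * zeta theta)).
Proof.
intros Hr; assert (Hr0 : 0 <= r < 1) by lra.
replace (/ (2 * r) * cpois (RtoC r * zeta theta)) with
  (cint nu (fun t => / (2 * r) * snd (herglotz (RtoC r * zeta theta) t))).
2:{ apply cint_scal; [exact nu_fin|]; apply herglotz_snd_cont; now apply in_disc_polar. }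
pose (d := 1 - r); assert (Hd : 0 < d) by (unfold d; lra).
assert (Pm : 0 < Rmin r (d / 2)) by (apply Rmin_pos; lra).
assert (R1 : forall y, Rabs (y - r) < Rmin r (d / 2) -> 0 < y < 1 /\ d / 2 <= 1 - y).
{ intros y Hy; assert (A := Rlt_le_trans _ _ _ Hy (Rmin_l _ _)); assert (B := Rlt_le_trans _ _ _ Hy (Rmin_r _ _)).
  apply Rabs_def2 in A, B; unfold d in *; lra. }
assert (KE : forall y t, 0 < y < 1 -> / (2 * y) * snd (herglotz (RtoC y * zeta theta) t) =
  sin (2 * PI * (theta - t)) / (1 - 2 * y * cos (2 * PI * (theta - t)) + y ^ 2)).
{ intros y t Hy; rewrite herglotz_snd_polar by lra.
  generalize (arg_denom2_pos (2 * PI * (theta - t)) (conj (Rlt_le _ _ (proj1 Hy)) (proj2 Hy))); intros; field; lra. }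
apply (@cint_derive (fun y t => poisson_arg y (2 * PI * (theta - t)))
  (fun y t => / (2 * y) * snd (herglotz (RtoC y * zeta theta) t)) r (Rmin r (d / 2)) (64 / d ^ 4) Pm).
- intros y Hy; apply poisson_arg_cont; destruct (R1 y Hy); lra.
- apply (continuity_scal (fun t => snd (herglotz (RtoC r * zeta theta) t))).
  apply herglotz_snd_cont; now apply in_disc_polar.
- intros t y Hy; destruct (R1 y Hy) as [Hy1 _]; rewrite KE by exact Hy1.
  apply is_derive_arg_r; lra.
- intros t y Hy; destruct (R1 y Hy) as [Hy1 Hy2]; rewrite !KE by assumption.
  set (phi := 2 * PI * (theta - t)).
  assert (S := SIN_bound phi); assert (Cb := COS_bound phi).
  assert (LB : forall v, 0 < v < 1 -> d / 2 <= 1 - v -> (d / 2) ^ 2 <= 1 - 2 * v * cos phi + v ^ 2).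
  { intros v Hv Hv2.
    assert ((d / 2) ^ 2 <= (1 - v) ^ 2) by (apply pow_incr; lra). nra. }
  assert (B1 := LB y Hy1 Hy2); assert (B2 := LB r Hr ltac:(unfold d; lra)).
  assert (P2 : 0 < (d / 2) ^ 2) by (apply pow_lt; lra).
  set (a := 1 - 2 * y * cos phi + y ^ 2) in *; set (b := 1 - 2 * r * cos phi + r ^ 2) in *.
  replace (sin phi / a - sin phi / b) with (sin phi * (b - a) * (/ a * / b)) by (field; lra).
  rewrite !Rabs_mult.
  assert (X : Rabs (b - a) <= 4 * Rabs (y - r)).
  { unfold a, b.
    replace (1 - 2 * r * cos phi + r ^ 2 - (1 - 2 * y * cos phi + y ^ 2)) with ((y - r) * (2 * cos phi - r - y)) by ring.
    rewrite Rabs_mult, Rmult_comm; apply Rmult_le_compat_r; [apply Rabs_pos|]; apply Rabs_le; lra. }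
  assert (Ia : 0 < / a <= / (d / 2) ^ 2) by (split; [apply Rinv_0_lt_compat; lra|apply Rinv_le_contravar; lra]).
  assert (Ib : 0 < / b <= / (d / 2) ^ 2) by (split; [apply Rinv_0_lt_compat; lra|apply Rinv_le_contravar; lra]).
  replace (64 / d ^ 4 * Rabs (y - r)) with (1 * (4 * Rabs (y - r)) * (/ (d / 2) ^ 2 * / (d / 2) ^ 2)) by (field; lra).
  apply Rmult_le_compat.
  + apply Rmult_le_pos; apply Rabs_pos.
  + rewrite <- Rabs_mult; apply Rabs_pos.
  + apply Rmult_le_compat; try apply Rabs_pos; [apply Rabs_le; lra|exact X].
  + rewrite !Rabs_right by lra; apply Rmult_le_compat; lra.
Qed.

Lemma atan_half_angle v : 0 < v < 1 -> atan (sin (2 * PI * v) / (1 - cos (2 * PI * v))) = PI / 2 - PI * v.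
Proof.
intros Hv; assert (P3 := PI_gt3).
assert (S : 0 < sin (PI * v)) by (apply sin_gt_0; [apply Rmult_lt_0_compat; lra|apply Rmult_lt_reg_l with (/ PI); [apply Rinv_0_lt_compat; lra|rewrite <- Rmult_assoc, Rinv_l by lra; lra]]).
replace (2 * PI * v) with (2 * (PI * v)) by ring.
rewrite cos_2a_sin, sin_2a.
replace (2 * sin (PI * v) * cos (PI * v) / (1 - (1 - 2 * sin (PI * v) * sin (PI * v)))) with (tan (PI / 2 - PI * v)).
- assert (0 < PI * v) by (apply Rmult_lt_0_compat; lra).
  assert (PI * v < PI * 1) by (apply Rmult_lt_compat_l; lra).
  apply atan_tan; lra.
- unfold tan; rewrite sin_shift, cos_shift.
  generalize (Rmult_lt_0_compat _ _ S S); intros; field; split; lra.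
Qed.

(** Away from integer [v] the denominator [1 - cos (2 PI v)] is positive, so the kernel extends
    continuously to [r = 1]. There it is a sawtooth, by the half-angle formula. *)
Lemma poisson_arg_limit v (r : nat -> R) : 0 < v < 1 -> Un_cv r 1 ->
  Un_cv (fun n => poisson_arg (r n) (2 * PI * v)) (PI / 2 - PI * v).
Proof.
intros Hv Hr; assert (P3 := PI_gt3).
assert (S : 0 < sin (PI * v)) by (apply sin_gt_0; [apply Rmult_lt_0_compat; lra|apply Rmult_lt_reg_l with (/ PI); [apply Rinv_0_lt_compat; lra|rewrite <- Rmult_assoc, Rinv_l by lra; lra]]).
assert (C1 : 0 < 1 - cos (2 * PI * v)).
{ replace (2 * PI * v) with (2 * (PI * v)) by ring; rewrite cos_2a_sin; generalize (Rmult_lt_0_compat _ _ S S); lra. }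
replace (PI / 2 - PI * v) with (poisson_arg 1 (2 * PI * v)).
2:{ unfold poisson_arg; rewrite !Rmult_1_l; now apply atan_half_angle. }
apply (continuity_seq (fun x => poisson_arg x (2 * PI * v))); [|exact Hr].
apply derivable_continuous_pt.
assert (D : ex_derive (fun x => poisson_arg x (2 * PI * v)) 1).
{ unfold poisson_arg; auto_derive; lra. }
exists (Derive (fun x => poisson_arg x (2 * PI * v)) 1); apply is_derive_Reals; now apply Derive_correct.
Qed.

Lemma unit_representative x : exists p k, I01 p /\ p = x + IZR k.
Proof.
exists (x + IZR (1 - up x)), (1 - up x)%Z; split; [|reflexivity].
rewrite minus_IZR; generalize (archimed x); unfold I01, mkset; lra.
Qed.

Lemma I01_unique p t k : I01 p -> I01 t -> t = p + IZR k -> t = p.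
Proof.
intros [P0 P1] [T0 T1] E.
assert (k = 0%Z) as ->; [|rewrite E; ring].
assert (IZR k < IZR 1 /\ IZR (-1) < IZR k) as [A B] by (split; [change (IZR 1) with 1|change (IZR (-1)) with (-1)]; lra).
apply lt_IZR in A, B; lia.
Qed.

(** The difference of the sawtooths based at [x + l] and [x] is [PI (1 - l)] inside the arc and
    [- PI l] outside. Integrating this step function gives the limit; only the two endpoints escape,
    and they have no mass. *)
Lemma argint_limit x l (r : nat -> R) : 0 < l <= 1 / 2 -> (forall n, 0 <= r n < 1) -> Un_cv r 1 ->
  (forall p, I01 p -> fine (nu [set p]%classic) = 0) ->
  Un_cv (fun n => argint (r n) (x + l) - argint (r n) x) (PI * (m x l - l * T)).
Proof.
intros Hl Hr Hc Hat; assert (P3 := PI_gt3).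
destruct (unit_representative x) as (p1 & k1 & Ip1 & Ep1).
destruct (unit_representative (x + l)) as (p2 & k2 & Ip2 & Ep2).
assert (Hcont : forall n theta, continuity (fun t => poisson_arg (r n) (2 * PI * (theta - t)))).
{ intros; now apply poisson_arg_cont. }
assert (Lim := @cint_dct nu nu_fin
  (fun n t => poisson_arg (r n) (2 * PI * (x + l - t)) - poisson_arg (r n) (2 * PI * (x - t)))
  PI (PI * (1 - l)) (- (PI * l)) x l p1 p2).
replace (PI * (m x l - l * T)) with (PI * (1 - l) * arc_measure nu x l + - (PI * l) * (arc_measure nu 0 1 - arc_measure nu x l))
  by (unfold m, T; ring).
eapply Un_cv_ext; [|apply Lim; clear Lim].
- intros n; unfold argint; apply cint_sub; auto.
- intros n; apply (continuity_minus (fun t => poisson_arg (r n) (2 * PI * (x + l - t)))); apply Hcont.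
- intros n t; generalize (poisson_arg_bound (r n) (2 * PI * (x + l - t))) (poisson_arg_bound (r n) (2 * PI * (x - t))).
  intros A B; apply Rabs_le_between in A, B; apply Rabs_le; lra.
- exact Ip1.
- exact Ip2.
- now apply Hat.
- now apply Hat.
- intros t It N1 N2 (_ & _ & k & A1 & A2).
  (* [y] is the position of [t] measured from [x]. The value [y = 0] is the endpoint [p1], excluded
     by [N1]. *)
  pose (y := t + IZR k - x).
  assert (Y0 : 0 < y).
  { assert (0 <= y) as [H|H] by (unfold y; lra); [exact H|exfalso].
    apply N1, (I01_unique Ip1 It (k := (- k - k1)%Z)).
    rewrite Ep1, minus_IZR, opp_IZR; unfold y in H; lra. }
  apply Un_cv_ext with (fun n => poisson_arg (r n) (2 * PI * (l - y)) + poisson_arg (r n) (2 * PI * y)).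
  + intros n.
    replace (2 * PI * (x + l - t)) with (2 * PI * (l - y + IZR k)) by (unfold y; ring).
    replace (2 * PI * (x - t)) with (2 * PI * (- y + IZR k)) by (unfold y; ring).
    rewrite !poisson_arg_plus; replace (2 * PI * - y) with (- (2 * PI * y)) by ring.
    rewrite poisson_arg_opp; ring.
  + replace (PI * (1 - l)) with ((PI / 2 - PI * (l - y)) + (PI / 2 - PI * y)) by field.
    apply CV_plus; apply poisson_arg_limit; auto; unfold y; unfold y in Y0; lra.
- intros t It N1 N2 Na.
  pose (k := (1 - up (t - x))%Z); pose (y := t + IZR k - x).
  assert (Yb : 0 <= y < 1) by (unfold y, k; rewrite minus_IZR; generalize (archimed (t - x)); lra).
  assert (Y1 : l < y).
  { destruct (Rtotal_order l y) as [H|[H|H]]; [exact H| |]; exfalso.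
    - apply N2, (I01_unique Ip2 It (k := (- k - k2)%Z)).
      rewrite Ep2, minus_IZR, opp_IZR; unfold y in H; lra.
    - destruct It as [T0 T1]; apply Na; split; [exact T0|split; [exact T1|]].
      exists k; unfold y in Yb, H; lra. }
  apply Un_cv_ext with (fun n => poisson_arg (r n) (2 * PI * y) - poisson_arg (r n) (2 * PI * (y - l))).
  + intros n.
    replace (2 * PI * (x + l - t)) with (2 * PI * (- (y - l) + IZR k)) by (unfold y; ring).
    replace (2 * PI * (x - t)) with (2 * PI * (- y + IZR k)) by (unfold y; ring).
    rewrite !poisson_arg_plus; replace (2 * PI * - y) with (- (2 * PI * y)) by ring.
    replace (2 * PI * - (y - l)) with (- (2 * PI * (y - l))) by ring.
    rewrite !poisson_arg_opp; ring.
  + replace (- (PI * l)) with ((PI / 2 - PI * y) - (PI / 2 - PI * (y - l))) by field.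
    apply CV_minus; apply poisson_arg_limit; auto; lra.
Qed.
End ArgIntegral.

(** * From the Bloch condition to arcs *)

Lemma Un_cv_Rabs_bound (u : nat -> R) l c B : Un_cv u l -> (forall n, Rabs (u n - c) <= B) -> Rabs (l - c) <= B.
Proof.
intros Hu HB; apply le_epsilon; intros e He.
destruct (Hu e He) as [n Hn]; specialize (Hn n (le_n n)); unfold Rdist in Hn.
replace (l - c) with (- (u n - l) + (u n - c)) by ring.
eapply Rle_trans; [apply Rabs_triang|]; rewrite Rabs_Ropp; specialize (HB n); lra.
Qed.

Section BlochToArcs.
Variable nu : circ_measure.
Hypothesis nu_fin : (nu I01 < +oo)%E.
Variable M : R.
Hypothesis M_gt0 : 0 < M.
Notation pois := (pois nu).
Notation cpois := (cpois nu).
Notation argint := (argint nu).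
Notation hweight := (hweight nu M).
Notation K := (step_const M).
Let m := arc_measure nu.
Let T := arc_measure nu 0 1.
Hypothesis bloch_bound : forall z, in_disc z -> (1 - Cmod z) * Cmod (hfun' nu z) <= M * exp (- pois z).

(** The conjugate function at angles [x] and [x + l] is compared through height [l]: two radial
    chains cost [3] and [3 * 3/2], the angular step 1, together at most 9 units of [K (3/2)^n W].
    The factor [/ (2 r)] is at most 1 since [r >= 1/2], and the radii span an interval of length
    [l / 2^(n+1)]. *)
Lemma argint_increment x l n : 0 < l <= 1 / 2 ->
  let g r := argint r (x + l) - argint r x in
  Rabs (g (1 - l / 2 ^ S n) - g (1 - l / 2 ^ n)) <=
    9 / 2 * K * l * (3 / 4) ^ n * hweight (RtoC (1 - l) * zeta x).
Proof.
intros Hl g.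
assert (Q := step_const_gt0 M_gt0).
assert (P2 : 0 < 2 ^ n) by (apply pow_lt; lra).
assert (P1 : 1 <= 2 ^ n) by (apply pow_R1_Rle; lra).
pose (s := l / 2 ^ S n).
assert (Hs : 0 < s) by (apply Rdiv_lt_0_compat; [lra|apply pow_lt; lra]).
assert (E : l / 2 ^ n = 2 * s) by (unfold s; simpl; field; lra).
assert (L : l / 2 ^ n <= l).
{ apply Rmult_le_reg_r with (2 ^ n); [lra|]; unfold Rdiv; rewrite Rmult_assoc, Rinv_l by lra; nra. }
set (W := hweight (RtoC (1 - l) * zeta x)).
assert (W0 : 0 < W) by now apply hweight_gt0.
assert (P32 : 1 <= (3 / 2) ^ n) by (apply pow_R1_Rle; lra).
assert (X := @mvt_bound g
  (fun r => / (2 * r) * cpois (RtoC r * zeta (x + l)) - / (2 * r) * cpois (RtoC r * zeta x))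
  (1 - l / 2 ^ n) (1 - l / 2 ^ S n) (9 * K * (3 / 2) ^ n * W)).
replace (9 / 2 * K * l * (3 / 4) ^ n * W) with (9 * K * (3 / 2) ^ n * W * (1 - l / 2 ^ S n - (1 - l / 2 ^ n))).
2:{ replace ((3 / 4) ^ n) with ((3 / 2) ^ n * / 2 ^ n).
    - simpl; field; lra.
    - rewrite <- pow_inv, <- Rpow_mult_distr; f_equal; field. }
apply X; clear X.
- fold s; rewrite E; lra.
- intros r Hr; fold s in Hr; rewrite E in Hr.
  apply derivable_pt_lim_minus; apply argint_r; try exact nu_fin; lra.
- intros r Hr.
  destruct (angular_step nu_fin M_gt0 bloch_bound (l := l) (x := x) (y := x + l) Hl) as (A1 & _ & A3).
  { replace (x + l - x) with l by ring; rewrite Rabs_right; lra. }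
  assert (R1 := radial_cpois nu_fin M_gt0 bloch_bound x Hl Hr).
  assert (R2 := radial_cpois nu_fin M_gt0 bloch_bound (x + l) Hl Hr).
  fold W in A1, A3, R1.
  assert (R3 : 3 * K * (3 / 2) ^ n * hweight (RtoC (1 - l) * zeta (x + l)) <= 3 * K * (3 / 2) ^ n * (3 / 2 * W)).
  { apply Rmult_le_compat_l; [|exact A1]; apply Rmult_le_pos; lra. }
  assert (R4 : K * W * 1 <= K * W * (3 / 2) ^ n) by (apply Rmult_le_compat_l; [nra|lra]).
  fold s in Hr; rewrite E in Hr.
  rewrite <- Rmult_minus_distr_l, Rabs_mult.
  assert (I : 0 < / (2 * r) <= 1).
  { split; [apply Rinv_0_lt_compat; lra|]; rewrite <- Rinv_1; apply Rinv_le_contravar; lra. }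
  rewrite (Rabs_right (/ (2 * r))) by lra.
  apply Rle_trans with (1 * Rabs (cpois (RtoC r * zeta (x + l)) - cpois (RtoC r * zeta x))).
  { apply Rmult_le_compat_r; [apply Rabs_pos|lra]. }
  apply Rabs_le_between in R1, R2, A3.
  rewrite Rmult_1_l; apply Rabs_le.
  assert (0 <= K * W * (3 / 2) ^ n) by (apply Rmult_le_pos; nra).
  lra.
Qed.

(** The increments sum to [18 K l W], because [9/2] times the sum of [(3/4)^n] is 18. Dividing by
    [PI l] with [PI > 3] leaves 6. The mean value theorem at height [l] then produces [pois] at some
    angle of the arc, and moving that angle to [x] costs one more step: [7 = 6 + 1]. *)
Lemma arc_average_pois x l : 0 < l <= 1 / 2 ->
  Rabs (m x l / l - pois (RtoC (1 - l) * zeta x)) <= 7 * K * hweight (RtoC (1 - l) * zeta x).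
Proof.
intros Hl; assert (P3 := PI_gt3).
assert (Q := step_const_gt0 M_gt0).
set (W := hweight (RtoC (1 - l) * zeta x)).
assert (W0 : 0 < W) by now apply hweight_gt0.
pose (g := fun r => argint r (x + l) - argint r x).
assert (KW : 0 < K * W) by (apply Rmult_lt_0_compat; lra).
assert (G : forall n, Rabs (g (1 - l / 2 ^ n) - g (1 - l)) <= 18 * K * l * W * (1 - (3 / 4) ^ n)).
{ intros n; induction n as [|n IH].
  - simpl; replace (l / 1) with l by field; rewrite !Rminus_diag, Rabs_R0; lra.
  - assert (X := @argint_increment x l n Hl); cbv zeta in X; fold W in X.
    change (Rabs (g (1 - l / 2 ^ S n) - g (1 - l / 2 ^ n)) <= 9 / 2 * K * l * (3 / 4) ^ n * W) in X.
    replace (g (1 - l / 2 ^ S n) - g (1 - l)) with ((g (1 - l / 2 ^ S n) - g (1 - l / 2 ^ n)) + (g (1 - l / 2 ^ n) - g (1 - l))) by ring.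
    eapply Rle_trans; [apply Rabs_triang|].
    replace ((3 / 4) ^ S n) with (3 / 4 * (3 / 4) ^ n) by (simpl; ring); lra. }
assert (Pw : forall n, 0 < 2 ^ n /\ 1 <= 2 ^ n) by (intros n; split; [apply pow_lt|apply pow_R1_Rle]; lra).
assert (Hr : forall n, 0 <= 1 - l / 2 ^ n < 1).
{ intros n; destruct (Pw n) as [A B].
  assert (0 < l / 2 ^ n) by (apply Rdiv_lt_0_compat; lra).
  assert (l / 2 ^ n <= l).
  { apply Rmult_le_reg_r with (2 ^ n); [lra|]; unfold Rdiv; rewrite Rmult_assoc, Rinv_l by lra; nra. }
  lra. }
assert (Hcv : Un_cv (fun n => 1 - l / 2 ^ n) 1).
{ intros e He.
  destruct (@pow_lt_1_zero (/ 2)) with (y := e) as [N HN]; [rewrite Rabs_right; lra|lra|].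
  exists N; intros n Hn; specialize (HN n Hn); unfold Rdist.
  rewrite pow_inv, Rabs_right in HN by (apply Rle_ge; left; apply Rinv_0_lt_compat; apply Pw).
  assert (0 < / 2 ^ n) by (apply Rinv_0_lt_compat; apply Pw).
  replace (1 - l / 2 ^ n - 1) with (- (l * / 2 ^ n)) by (unfold Rdiv; ring).
  rewrite Rabs_Ropp, Rabs_right by nra; nra. }
assert (Lim := argint_limit nu_fin x Hl Hr Hcv (atom_zero nu_fin M_gt0 bloch_bound)).
assert (B1 := @Un_cv_Rabs_bound _ _ (g (1 - l)) (18 * K * l * W) Lim).
assert (B2 : Rabs (PI * (m x l - l * T) - g (1 - l)) <= 18 * K * l * W).
{ apply B1; intros n; eapply Rle_trans; [apply G|].
  assert (0 < (3 / 4) ^ n) by (apply pow_lt; lra).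
  assert (0 < K * l * W) by (replace (K * l * W) with (l * (K * W)) by ring; apply Rmult_lt_0_compat; lra).
  nra. }
assert (Hl1 : 0 <= 1 - l < 1) by lra.
assert (B3 : exists xi, Rabs (xi - x) <= l /\ g (1 - l) = PI * (pois (RtoC (1 - l) * zeta xi) - T) * l).
{ destruct (MVT_cor2 (argint (1 - l)) (fun th => PI * (pois (RtoC (1 - l) * zeta th) - T)) x (x + l)) as (xi & H1 & H2); [lra| |].
  - intros; now apply argint_theta.
  - exists xi; split; [rewrite Rabs_right; lra|]; unfold g; rewrite H1; ring. }
destruct B3 as (xi & Hxi & B3).
destruct (angular_step nu_fin M_gt0 bloch_bound Hl Hxi) as (_ & A2 & _); fold W in A2.
rewrite B3 in B2.
replace (PI * (m x l - l * T) - PI * (pois (RtoC (1 - l) * zeta xi) - T) * l) with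
  (PI * l * (m x l / l - pois (RtoC (1 - l) * zeta xi))) in B2 by (field; lra).
rewrite Rabs_mult, Rabs_right in B2 by nra.
assert (B4 : Rabs (m x l / l - pois (RtoC (1 - l) * zeta xi)) <= 6 * (K * W)).
{ apply Rmult_le_reg_l with (PI * l); [nra|].
  eapply Rle_trans; [exact B2|].
  replace (18 * K * l * W) with (3 * (6 * l * (K * W))) by ring.
  replace (PI * l * (6 * (K * W))) with (PI * (6 * l * (K * W))) by ring.
  apply Rmult_le_compat_r; [apply Rmult_le_pos; lra|lra]. }
apply Rabs_le_between in A2, B4; apply Rabs_le; lra.
Qed.

(** The two averages are within [7 K W] and [7 K * 3/2 W] of their Poisson values, which differ by
    [K W]; the total is at most [19 K W]. As [W <= 1], the first estimate also gives
    [|m x l / l - u| <= 7 K], which turns [exp (- u)] into [exp (7 K)] times the exponential of the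
    average. *)
Lemma bloch_arcs x y l : 0 < l <= 1 / 2 -> Rabs (y - x) <= l ->
  Rabs (m x l / l - m y l / l) <= 19 * K * exp (7 * K) * exp (- (m x l / l)).
Proof.
intros Hl Hy.
assert (Q := step_const_gt0 M_gt0).
assert (A := arc_average_pois x Hl); assert (B := arc_average_pois y Hl).
destruct (angular_step nu_fin M_gt0 bloch_bound Hl Hy) as (S1 & S2 & _).
assert (Hd : in_disc (RtoC (1 - l) * zeta x)) by (apply in_disc_polar; lra).
assert (H1 := hweight_le1 nu_fin M_gt0 Hd).
assert (H2 := hweight_le nu M_gt0 (RtoC (1 - l) * zeta x)).
assert (H0 := hweight_gt0 nu M_gt0 (RtoC (1 - l) * zeta x)).
set (W := hweight (RtoC (1 - l) * zeta x)) in *.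
set (u := pois (RtoC (1 - l) * zeta x)) in *.
assert (B' : 7 * K * hweight (RtoC (1 - l) * zeta y) <= 7 * K * (3 / 2 * W)) by (apply Rmult_le_compat_l; lra).
apply Rabs_le_between in A, B, S2.
assert (E : W <= exp (7 * K) * exp (- (m x l / l))).
{ eapply Rle_trans; [exact H2|]; rewrite <- exp_plus.
  assert (7 * K * W <= 7 * K * 1) by (apply Rmult_le_compat_l; lra).
  destruct (Req_dec (- u) (7 * K + - (m x l / l))) as [->|N]; [lra|].
  left; apply exp_increasing; lra. }
apply Rle_trans with (19 * K * W).
- assert (0 < K * W) by nra; apply Rabs_le; lra.
- rewrite (Rmult_assoc (19 * K)); apply Rmult_le_compat_l; lra.
Qed.
End BlochToArcs.

Theorem theorem1p8 (f : C -> C)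
  (f_hol : holomorphic_disc f)
  (f_bnd : forall z : C, in_disc z -> (Cmod (f z) <= 1)%R)
  (f_nz : forall z : C, in_disc z -> f z <> 0%C)
  (nu : circ_measure)
  (nu_HN : HN_measure f nu) :
  bloch (fun z => Cinv (f z)) <->
  exists C : R, (0 < C)%R /\
    forall a l a' l' : R, contiguous_same_length a l a' l' ->
      (Rabs (arc_measure nu a l / l - arc_measure nu a' l' / l')
        <= C * exp (- (arc_measure nu a l / l)))%R.
Proof.
assert (nu_fin := proj1 (proj2 nu_HN)).
rewrite (bloch_iff nu_fin f_hol f_nz (HN_log nu_HN)).
split.
- intros (M & HM).
  (* The weights are built from a strictly positive constant, while the bound [M] comes without a
     sign. *)
  assert (PM : 0 < Rabs M + 1) by (generalize (Rabs_pos M); lra).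
  assert (HM' : forall z, in_disc z -> (1 - Cmod z) * Cmod (hfun' nu z) <= (Rabs M + 1) * exp (- pois nu z)).
  { intros z Hz; eapply Rle_trans; [now apply HM|].
    apply Rmult_le_compat_r; [left; apply exp_pos|generalize (Rle_abs M); lra]. }
  assert (Q := step_const_gt0 PM).
  exists (19 * step_const (Rabs M + 1) * exp (7 * step_const (Rabs M + 1))); split.
  + apply Rmult_lt_0_compat; [lra|apply exp_pos].
  + intros a l a' l' (<- & Hl & Ha).
    apply (bloch_arcs nu_fin PM HM' Hl).
    destruct Ha as [->| ->].
    * replace (a + l - a) with l by ring; rewrite Rabs_right; lra.
    * replace (a' - (a' + l)) with (- l) by ring; rewrite Rabs_Ropp, Rabs_right; lra.
- intros (C & HC & HA).
  apply (arcs_hfun' nu_fin HC); intros x l Hl; apply HA; (split; [reflexivity|split; [exact Hl|]]).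
  + now left.
  + now right.
Qed.
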